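(* Let $(u,v,P,\eta,U)$ be a solitary wave with $\sup u<c$ (supremum over the fluid domain) satisfying, for some $0<\alpha<1$ and $r=2/(1-\alpha)$, the regularity $u,v,P\in W^{1,r}_{\mathrm{loc}}(\overline{D_\eta})\subset C^\alpha_{\mathrm{loc}}(\overline{D_\eta})$, $\eta\in C^{1+\alpha}(\mathbb{R})$, $U\in W^{1,r}(-d,0)\subset C^\alpha[-d,0]$. Let $F>0$ be its Froude number. Then $F\neq 1$. Moreover, $F>1$ if the wave is a wave of elevation, and $F<1$ if it is a wave of depression.
   Context: Fix constants $g>0$ (gravity), $d>0$ (asymptotic depth), $c>0$ (wave speed). A solitary wave consists of functions $\eta:\mathbb{R}\to\mathbb{R}$ with $\eta>-d$, functions $u,v,P$ on $\overline{D_\eta}$, where $D_\eta=\{(x,y): -d<y<\eta(x)\}$ is the fluid domain, and $U:[-d,0]\to\mathbb{R}$, satisfying the steady incompressible Euler equations (in $L^r_{\mathrm{loc}}(\overline{D_\eta})$) $$(u-c)u_x+vu_y=-P_x,\quad (u-c)v_x+vv_y=-P_y-g,\quad u_x+v_y=0 ,$$ the pointwise boundary conditions $v=0$ on $y=-d$, $v=(u-c)\eta_x$ and $P=0$ on $y=\eta(x)$, and the asymptotic conditions $\eta\to0$, $v\to 0$, $u\to U(y)$ as $x\to\pm\infty$, uniformly in $y$. Here $w\in W^{1,r}_{\mathrm{loc}}(\overline{D_\eta})$ means $w\in W^{1,r}(D')$ whenever $\overline{D'}\subset\overline{D_\eta}$ is compact, and similarly for $C^\alpha_{\mathrm{loc}}(\overline{D_\eta})$.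 A solitary wave is called trivial if $\eta\equiv0$, $v\equiv0$ and $u\equiv U$. It is a wave of elevation if $\eta(x)\ge0$ for all $x$ but $\eta\not\equiv0$, and a wave of depression if $\eta(x)\le0$ for all $x$ but $\eta\not\equiv0$. The Froude number $F>0$ is defined by $\displaystyle \frac1{F^2}=g\int_{-d}^0\frac{dy}{(c-U(y))^2}$ (note $U<c$ when $\sup u<c$).
   Formalization: The solitary wave is assumed nontrivial; without this F≠1 fails, e.g. for the trivial wave η=0, v=0, u=U=0, P=-gy with c²=gd, which has F=1. *)

(* Defs.v *)
From HB Require Import structures.
From mathcomp Require Import all_boot all_order all_algebra.
From mathcomp Require Import all_classical all_reals all_analysis.

Set Implicit Arguments.
Unset Strict Implicit.
Unset Printing Implicit Defensive.

Import Order.TTheory GRing.Theory Num.Theory.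
Import numFieldNormedType.Exports.

Local Open Scope classical_set_scope.
Local Open Scope ring_scope.

Section FunctionSpaces.
Context {R : realType}.

Definition leb2 := (@lebesgue_measure R \x @lebesgue_measure R)%E.

(* C^a(A), with finite sup norm and finite Hölder seminorm. On R * R the norm
   is the sup norm, which is equivalent to the Euclidean one. *)
Definition holder_on (V : normedModType R) (a : R) (A : set V) (f : V -> R) :=
  (exists M : R, forall p, A p -> `|f p| <= M) /\
  (exists C : R, forall p q, A p -> A q -> `|f p - f q| <= C * `|p - q| `^ a).

(* C^(1+a)(R), a global (not local) Hölder space *)
Definition C1holder (a : R) (f : R -> R) :=
  [/\ forall x, derivable f x 1,
      exists M : R, forall x, `|f x| <= M &
      holder_on a [set: R] f^`()%classic].

(* C^1_c(D). As in Gilbarg-Trudinger, first-order weak derivatives are tested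
   against C^1 functions with compact support. *)
Definition test_function (V : normedModType R) (D : set V) (phi : V -> R) :=
  [/\ forall p w : V, derivable phi p w,
      forall w : V, continuous ('D_w phi),
      compact (closure [set p | phi p != 0]) &
      closure [set p | phi p != 0] `<=` D].

Definition weak_deriv1 (D : set R) (f f' : R -> R) :=
  forall phi : R -> R, test_function D phi ->
    \int[lebesgue_measure]_(x in D) (f x * 'D_1 phi x) =
    - \int[lebesgue_measure]_(x in D) (f' x * phi x).

(* f' is the weak derivative of f on D in the direction e *)
Definition weak_deriv2 (D : set (R * R)) (e : R * R) (f f' : R * R -> R) :=
  forall phi : R * R -> R, test_function D phi ->
    \int[leb2]_(p in D) (f p * 'D_e phi p) =
    - \int[leb2]_(p in D) (f' p * phi p).

Definition Lr1 (r : R) (D : set R) (f : R -> R) :=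
  f \_ D \in Lfun lebesgue_measure r%:E.

Definition Lr2 (r : R) (D : set (R * R)) (f : R * R -> R) :=
  f \_ D \in Lfun leb2 r%:E.

Definition W1r1 (r : R) (D : set R) (f : R -> R) :=
  Lr1 r D f /\ exists2 f', Lr1 r D f' & weak_deriv1 D f f'.

Definition W1r2 (r : R) (D : set (R * R)) (f : R * R -> R) :=
  [/\ Lr2 r D f,
      exists2 fx, Lr2 r D fx & weak_deriv2 D (1, 0) f fx &
      exists2 fy, Lr2 r D fy & weak_deriv2 D (0, 1) f fy].

(* Membership in X_loc(closure D), for a space X(D') of functions on D' *)
Definition loc_closure (X : set (R * R) -> (R * R -> R) -> Prop)
    (D : set (R * R)) (f : R * R -> R) :=
  forall D' : set (R * R), open D' -> compact (closure D') ->
    closure D' `<=` closure D -> X D' f.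

Definition Lr_loc (r : R) := loc_closure (Lr2 r).
Definition W1r_loc (r : R) := loc_closure (W1r2 r).
Definition Ca_loc (a : R) := loc_closure (fun D' => holder_on a (closure D')).

Definition weak_grad_loc (r : R) (D : set (R * R)) (f fx fy : R * R -> R) :=
  [/\ Lr_loc r D fx, Lr_loc r D fy,
      weak_deriv2 D (1, 0) f fx & weak_deriv2 D (0, 1) f fy].

End FunctionSpaces.

Section SolitaryWaves.
Context {R : realType}.
Implicit Types (g d c r alpha F : R) (eta U : R -> R) (u v P : R * R -> R).

(* Functions on the closed fluid domain (resp. on [-d, 0]) are represented by
   total functions, whose values elsewhere are never constrained. *)
Definition fluid d eta : set (R * R) :=
  [set p | - d < p.2 < eta p.1].

Definition euler_equations g c r (D : set (R * R)) u v P :=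
  exists ux uy vx vy Px Py : R * R -> R,
    [/\ weak_grad_loc r D u ux uy, weak_grad_loc r D v vx vy,
        weak_grad_loc r D P Px Py &
        {ae leb2, forall p, D p ->
          [/\ (u p - c) * ux p + v p * uy p = - Px p,
              (u p - c) * vx p + v p * vy p = - Py p - g &
              ux p + vy p = 0]}].

(* f (x, y) - f0 y tends to 0 along the filter Fx of the x variable,
   uniformly in the y such that (x, y) lies in the closed fluid domain *)
Definition unif_asymptotic (Fx : set_system R) (D : set (R * R))
    (f : R * R -> R) (f0 : R -> R) :=
  forall e : R, 0 < e ->
    \forall x \near Fx, forall y, closure D (x, y) -> `|f (x, y) - f0 y| < e.

(* Since U lives on [-d, 0] while y ranges over [-d, eta x], U is continued by
   the constant U 0 above y = 0; the strip 0 < y <= eta x shrinks as eta -> 0. *)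
Record solitary_wave g d c r eta u v P U : Prop := SolitaryWave {
  sw_depth : forall x, - d < eta x;
  sw_euler : euler_equations g c r (fluid d eta) u v P;
  sw_bed : forall x, v (x, - d) = 0;
  sw_kinematic : forall x, v (x, eta x) = (u (x, eta x) - c) * eta^`()%classic x;
  sw_dynamic : forall x, P (x, eta x) = 0;
  sw_eta_pinfty : eta x @[x --> +oo] --> (0 : R);
  sw_eta_ninfty : eta x @[x --> -oo] --> (0 : R);
  sw_v_pinfty : unif_asymptotic +oo (fluid d eta) v (fun=> 0);
  sw_v_ninfty : unif_asymptotic -oo (fluid d eta) v (fun=> 0);
  sw_u_pinfty :
    unif_asymptotic +oo (fluid d eta) u (fun y => U (Num.min y 0));
  sw_u_ninfty :
    unif_asymptotic -oo (fluid d eta) u (fun y => U (Num.min y 0)) }.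

(* The C^alpha conditions on u, v, P and U say that the pointwise-defined
   functions are the continuous representatives of their Sobolev classes,
   i.e. those provided by the embedding of W^(1,r) into C^alpha. *)
Record regular_wave d alpha r eta u v P U : Prop := RegularWave {
  rw_u : W1r_loc r (fluid d eta) u /\ Ca_loc alpha (fluid d eta) u;
  rw_v : W1r_loc r (fluid d eta) v /\ Ca_loc alpha (fluid d eta) v;
  rw_P : W1r_loc r (fluid d eta) P /\ Ca_loc alpha (fluid d eta) P;
  rw_eta : C1holder alpha eta;
  rw_U : W1r1 r `]- d, 0[%classic U /\ holder_on alpha `[- d, 0]%classic U }.

Definition trivial_wave d eta u v U :=
  [/\ forall x, eta x = 0,
      forall p, closure (fluid d eta) p -> v p = 0 &
      forall p, closure (fluid d eta) p -> u p = U p.2].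

Definition wave_of_elevation eta :=
  (forall x, 0 <= eta x) /\ exists x, eta x <> 0.

Definition wave_of_depression eta :=
  (forall x, eta x <= 0) /\ exists x, eta x <> 0.

Definition is_froude_number g d c U F :=
  0 < F /\
  1 / F ^+ 2 = g * \int[lebesgue_measure]_(y in `[- d, 0]) (1 / (c - U y) ^+ 2).

End SolitaryWaves.

(* Main.v *)
Require Import Defs.
From HB Require Import structures.
From mathcomp Require Import all_boot all_order all_algebra.
From mathcomp Require Import all_classical all_reals all_analysis.
From mathcomp Require Import measurable_realfun ring lra.
Import Order.TTheory GRing.Theory Num.Theory.
Import numFieldNormedType.Exports.
Local Open Scope classical_set_scope.
Local Open Scope ring_scope.

(** Write [a = c - u > 0] for the relative speed, [Q = P + g y] for the pressure
    without its hydrostatic part, and [psi] for the stream function, so that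
    [psi_y = a] and [psi_x = v].  The bed and the surface are the streamlines
    [psi = 0] and [psi = m].  Label a point by [x] and the value [p] of [psi],
    and let [A] be the limit of the relative speed at infinity, a function of [p].

    Bernoulli.  [Q + (a^2 + v^2) / 2] is constant along each streamline
    ([streamline_invariant]).  Since [a] tends to [A] and [v] to [0] far away,
    where [Q] tends to [0] as well, [2 Q = A^2 - a^2 - v^2] ([pressure_formula]).

    Convexity.  The tangent inequality [1/a - 1/A >= (A^2 - a^2) / (2 A^3)]
    ([cubic_convexity]) reads [1/a - 1/A >= Q / A^3 + v^2 / (2 A^3)].  The left
    side integrates over [0 <= p <= m] to the difference of the depths, which
    is [eta], so that [eta >= int Q / A^3 dp + int v^2 / (2 A^3) dp].

    Vertical momentum.  The integral of [Q] over the part [-M <= x <= M] of a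
    streamline differs from its value on the surface, [g] times the integral
    [N] of [eta], only by the values of [v] at [x = M] and [x = -M]
    ([pressure_balance]), which are small for large [M].

    Integrating the convexity inequality over [-M <= x <= M] therefore gives
    [(1 - g kappa) N >= int int v^2 / (2 A^3) - small], where [kappa] is the
    integral of [1 / A^3] in [p], that is, of [1 / (c - U)^2] in [y]; hence
    [g kappa = 1 / F^2].  If [v] is not identically zero, the right side is
    positive for large [M] ([wave_gap]): so [F <> 1], and [F - 1] has the sign
    of [N].  If [v] vanishes identically, the wave is trivial ([still_wave]).
    The truncation at [M] is there because [eta] is not known to be integrable.

    Regularity.  Only first weak derivatives of [u], [v] and [P] are available.
    The product rule for continuous functions with locally integrable weak
    derivatives ([wderM]) turns the Euler equations into three conservation
    laws for continuous fluxes: mass, vertical momentum, and transport of the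
    Bernoulli function ([euler_laws]).  By the first law [psi] is of class
    [C^1], so products [w(x) z(psi(x, y))] are test functions; inserting them
    into the other two laws and changing variables from [y] to [psi] expresses
    these laws in the labels [(x, p)] with no further derivative
    ([conserved_strip]).  The lemma of du Bois-Reymond, used in each variable,
    converts a weak law for continuous fluxes into the exact vanishing of the
    flux through rectangles ([rectangle_flux]), and continuity carries the
    resulting identities to the bed and to the surface. *)

Set Implicit Arguments.
Unset Strict Implicit.
Unset Printing Implicit Defensive.

(** * Continuous functions *)

Section Continuity.
Context {R : realType}.

Lemma cont_comp (S T U : topologicalType) (g : S -> T) (f : T -> U) :
  continuous f -> continuous g -> continuous (fun x => f (g x)).
Proof. by move=> cf cg x; apply: continuous_comp; [exact: cg|exact: cf]. Qed.

Lemma cont_pair (S T U : topologicalType) (g : S -> T) (f : S -> U) :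
  continuous g -> continuous f -> continuous (fun x => (g x, f x)).
Proof. by move=> cg cf x; apply: cvg_pair; [exact: cg|exact: cf]. Qed.

Lemma cont_fst (S T : topologicalType) : continuous (@fst S T).
Proof. by move=> x; exact: cvg_fst. Qed.

Lemma cont_snd (S T : topologicalType) : continuous (@snd S T).
Proof. by move=> x; exact: cvg_snd. Qed.

Lemma cont_cst (S T : topologicalType) (a : T) : continuous (fun _ : S => a).
Proof. by move=> x; exact: cvg_cst. Qed.

Lemma cont_id (S : topologicalType) : continuous (fun x : S => x).
Proof. by move=> x. Qed.

Lemma cont_pairl (S T : topologicalType) (a : S) : continuous (@pair S T a).
Proof. exact: cont_pair (@cont_cst _ _ a) (@cont_id _). Qed.

Context {T : topologicalType}.
Implicit Types f g : T -> R.

Lemma contD f g : continuous f -> continuous g -> continuous (fun x => f x + g x).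
Proof. by move=> cf cg x; apply: cvgD; [exact: cf|exact: cg]. Qed.

Lemma contN f : continuous f -> continuous (fun x => - f x).
Proof. by move=> cf x; apply: cvgN; exact: cf. Qed.

Lemma contM f g : continuous f -> continuous g -> continuous (fun x => f x * g x).
Proof. by move=> cf cg x; apply: cvgM; [exact: cf|exact: cg]. Qed.

Lemma contX f n : continuous f -> continuous (fun x => f x ^+ n).
Proof.
move=> cf; elim: n => [|n IH]; first by under eq_fun do rewrite expr0; exact: cont_cst.
by under eq_fun do rewrite exprS; exact: contM.
Qed.

Lemma contV f : (forall x, f x != 0) -> continuous f -> continuous (fun x => (f x)^-1).
Proof. by move=> f0 cf x; apply: cvgV => //; exact: cf. Qed.

Lemma cont_norm f : continuous f -> continuous (fun x => `|f x|).
Proof. by move=> cf x; apply: cvg_norm; exact: cf. Qed.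

Lemma cont_max f g :
  continuous f -> continuous g -> continuous (fun x => Num.max (f x) (g x)).
Proof.
move=> cf cg; have E : (fun x => Num.max (f x) (g x)) =
    (fun x => (f x + g x + `|f x - g x|) * 2^-1).
  by apply/funext => x; rewrite maxr_absE.
rewrite E; apply: contM; last exact: cont_cst.
by apply: contD; [exact: contD|apply: cont_norm; apply: contD => //; exact: contN].
Qed.

Lemma cont_min f g :
  continuous f -> continuous g -> continuous (fun x => Num.min (f x) (g x)).
Proof.
move=> cf cg; have E : (fun x => Num.min (f x) (g x)) =
    (fun x => (f x + g x - `|f x - g x|) * 2^-1).
  by apply/funext => x; rewrite minr_absE.
rewrite E; apply: contM; last exact: cont_cst.
by apply: contD; [exact: contD|apply: contN; apply: cont_norm; apply: contD => //; exact: contN].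
Qed.

End Continuity.

Lemma cont_opp {R : realType} : continuous (fun x : R => - x).
Proof. exact: contN (@cont_id R). Qed.

Lemma cont_addl {R : realType} (a : R) : continuous (fun x : R => a + x).
Proof. exact: contD (@cont_cst R R a) (@cont_id R). Qed.

Lemma cont_mull {R : realType} (a : R) : continuous (fun x : R => a * x).
Proof. exact: contM (@cont_cst R R a) (@cont_id R). Qed.

(** The atoms are the continuity facts present in the context: a proof that calls
    [cont] first introduces those that it needs. *)
Ltac cont_step := match goal with
  | H : continuous ?f |- continuous ?f => exact: H
  | |- continuous (fun x => x) => exact: cont_id
  | |- continuous (fun x => fst x) => exact: cont_fst
  | |- continuous (fun x => snd x) => exact: cont_snd
  | |- continuous (@GRing.opp _) => exact: cont_opp
  | |- continuous (GRing.add _) => exact: cont_addl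
  | |- continuous (GRing.mul _) => exact: cont_mull
  | |- continuous (pair _) => exact: cont_pairl
  | |- continuous fst => exact: cont_fst
  | |- continuous snd => exact: cont_snd
  | |- continuous (fun _ => ?a) => exact: cont_cst
  | |- continuous (fun x => _ + _) => apply: contD
  | |- continuous (fun x => - _) => apply: contN
  | |- continuous (fun x => _ * _) => apply: contM
  | |- continuous (fun x => _ ^+ _) => apply: contX
  | |- continuous (fun x => `| _ |) => apply: cont_norm
  | |- continuous (fun x => Num.max _ _) => apply: cont_max
  | |- continuous (fun x => Num.min _ _) => apply: cont_min
  | |- continuous (fun x => (_, _)) => apply: cont_pair
  | |- continuous (fun x => fst _) => apply: (cont_comp (@cont_fst _ _))
  | |- continuous (fun x => snd _) => apply: (cont_comp (@cont_snd _ _))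
  | H : continuous ?f |- continuous (fun x => ?f _) => apply: (cont_comp H)
  end.
Ltac cont := repeat cont_step.

(** * Derivatives and oriented integrals on the line *)

Section Integral.
Context {R : realType}.
Notation mu := (@lebesgue_measure R).
Implicit Types (f g F G : R -> R) (a b c x y : R).

Lemma der_cst (k x : R) : is_derive x (1 : R) (fun _ : R => k) 0.
Proof. exact: (is_derive_cst k x 1). Qed.

Lemma der_id x : is_derive x (1 : R) (fun t : R => t) 1.
Proof. exact: (is_derive_id x 1). Qed.

Lemma derB F G (l k x : R) : is_derive x (1 : R) F l -> is_derive x (1 : R) G k ->
  is_derive x (1 : R) (fun t => F t - G t) (l - k).
Proof. by move=> dF dG; exact: is_deriveB. Qed.

Lemma derD F G (l k x : R) : is_derive x (1 : R) F l -> is_derive x (1 : R) G k ->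
  is_derive x (1 : R) (fun t => F t + G t) (l + k).
Proof. by move=> dF dG; exact: is_deriveD. Qed.

Lemma derZ F (c l x : R) : is_derive x (1 : R) F l ->
  is_derive x (1 : R) (fun t => c * F t) (c * l).
Proof. by move=> dF; exact: is_deriveZ. Qed.

Lemma derM F G (l k x : R) : is_derive x (1 : R) F l -> is_derive x (1 : R) G k ->
  is_derive x (1 : R) (fun t => F t * G t) (F x * k + G x * l).
Proof. by move=> dF dG; exact: is_deriveM. Qed.

Lemma der_comp F G (l k x : R) : is_derive (G x) (1 : R) F l ->
  is_derive x (1 : R) G k -> is_derive x (1 : R) (fun t => F (G t)) (l * k).
Proof. by move=> dF dG; exact: is_derive1_comp. Qed.

Lemma der_affine (k l x : R) : is_derive x (1 : R) (fun t => l + t * k) k.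
Proof.
have -> : (fun t => l + t * k) = (fun t => l + k * t).
  by apply/funext => t; rewrite mulrC.
by have := derD (der_cst l x) (derZ k (der_id x)); rewrite mulr1 add0r.
Qed.

Lemma der_cont F (dF : R -> R) :
  (forall x, is_derive x (1 : R) F (dF x)) -> continuous F.
Proof.
move=> dFE x; have [d _] := dFE x.
exact/differentiable_continuous/derivable1_diffP.
Qed.

Lemma cont_integrable f a b : continuous f -> mu.-integrable `[a, b] (EFin \o f).
Proof.
move=> cf; apply: continuous_compact_integrable; first exact: segment_compact.
exact: continuous_subspaceT.
Qed.

Lemma oc_integrable f a b : continuous f -> mu.-integrable `]a, b] (EFin \o f).
Proof.
move=> cf; apply: integrableS (cont_integrable a b cf) => //.
exact: subset_itv_oc_cc.
Qed.

Definition prim f x : R :=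
  if 0 <= x then \int[mu]_(t in `[0, x]) f t else - \int[mu]_(t in `[x, 0]) f t.

Lemma primE f a x : continuous f -> a <= 0 -> a <= x ->
  prim f x = \int[mu]_(t in `[a, x]) f t - \int[mu]_(t in `[a, 0]) f t.
Proof.
move=> cf a0 ax; rewrite /prim; case: ifPn => [x0|]; last rewrite -ltNge => /ltW x0.
  rewrite Rintegral_itvB ?bnd_simp//; last exact: cont_integrable.
  by rewrite Rintegral_itv_obnd_cbnd//; apply: oc_integrable.
rewrite -[RHS]opprB Rintegral_itvB ?bnd_simp//; last exact: cont_integrable.
by rewrite Rintegral_itv_obnd_cbnd//; apply: oc_integrable.
Qed.

Lemma is_derive_prim f x : continuous f -> is_derive x 1 (prim f) (f x).
Proof.
move=> cf; pose a := Num.min x 0 - 1.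
have m0 : Num.min x 0 <= 0 by rewrite ge_min lexx orbT.
have mx : Num.min x 0 <= x by rewrite ge_min lexx.
have a0 : a <= 0 by rewrite /a; lra.
have ax : a < x by rewrite /a; lra.
have [//|d e] := @continuous_FTC1_closed R f a x (x + 1) _
  (cont_integrable a (x + 1) cf) ax (cf x); first lra.
have dF : is_derive x 1 (fun y => \int[mu]_(t in `[a, y]) f t - \int[mu]_(t in `[a, 0]) f t) (f x).
  rewrite -e -[X in is_derive _ _ _ X]subr0 derive1E.
  exact: derB (derivableP _) (der_cst _ _).
apply: near_eq_is_derive dF; near=> y.
rewrite -primE//; apply: ltW.
by near: y; exact: lt_nbhsr.
Unshelve. all: by end_near. Qed.

(** As a difference of values of one antiderivative, the integral needs no
    condition [a <= b], and splitting or reversing the interval is arithmetic. *)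
Definition oint f a b : R := prim f b - prim f a.

Lemma oint_Rintegral f a b : continuous f -> a <= b ->
  \int[mu]_(t in `[a, b]) f t = oint f a b.
Proof.
move=> cf ab; rewrite /oint; pose m := Num.min a 0.
have ma : m <= a by rewrite /m ge_min lexx.
have m0 : m <= 0 by rewrite /m ge_min lexx orbT.
rewrite !(@primE f m)//; last by rewrite (le_trans ma).
rewrite opprB addrA subrK.
rewrite Rintegral_itvB ?bnd_simp//; last exact: cont_integrable.
by rewrite Rintegral_itv_obnd_cbnd//; apply: oc_integrable.
Qed.

Lemma zero_der_cst F a b : a <= b ->
  (forall x, a <= x <= b -> is_derive x (1 : R) F 0) -> F b = F a.
Proof.
move=> ab dF.
have [|| c _] := @MVT_segment R F (fun=> 0) a b ab.
- by move=> x; rewrite in_itv/= => /andP[ax xb]; apply: dF; rewrite !ltW.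
- apply: continuous_in_subspaceT => x; rewrite inE/= in_itv/= => xab.
  by have [d _] := dF x xab; exact/differentiable_continuous/derivable1_diffP.
by rewrite mul0r => /eqP; rewrite subr_eq0 => /eqP.
Qed.

Lemma FTC f F a b : continuous f -> a <= b ->
  (forall x, a <= x <= b -> is_derive x (1 : R) F (f x)) -> oint f a b = F b - F a.
Proof.
move=> cf ab dF.
have := @zero_der_cst (fun x => prim f x - F x) a b ab.
suff: forall x, a <= x <= b -> is_derive x (1 : R) (fun x => prim f x - F x) 0.
  by move=> h /(_ h); rewrite /oint => e; lra.
move=> x xab; rewrite -(subrr (f x)); exact: derB (is_derive_prim _ cf) (dF _ xab).
Qed.

Lemma FTCT f F a b : continuous f ->
  (forall x, is_derive x (1 : R) F (f x)) -> oint f a b = F b - F a.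
Proof.
move=> cf dF; case: (leP a b) => [ab|/ltW ba]; first exact: FTC.
have := @FTC f F b a cf ba (fun x _ => dF x); rewrite /oint; lra.
Qed.

Lemma congr_oint f g a b : f =1 g -> oint f a b = oint g a b.
Proof. by move=> /funext ->. Qed.

Lemma ointaa f a : oint f a a = 0. Proof. exact: subrr. Qed.

Lemma ointN f a b : oint f b a = - oint f a b. Proof. by rewrite /oint opprB. Qed.

Lemma oint_cat f a b c : oint f a b + oint f b c = oint f a c.
Proof. rewrite /oint; lra. Qed.

Lemma is_derive_oint f a x : continuous f -> is_derive x (1:R) (oint f a) (f x).
Proof.
move=> cf; rewrite -[f x]subr0; exact: derB (is_derive_prim _ cf) (der_cst _ _).
Qed.

Lemma oint_cst k a b : oint (fun=> k) a b = k * (b - a).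
Proof.
rewrite (FTCT _ _ (@cont_cst _ _ k) (der_affine k 0)); lra.
Qed.

Lemma ointD f g a b : continuous f -> continuous g ->
  oint (fun x => f x + g x) a b = oint f a b + oint g a b.
Proof.
move=> cf cg; rewrite (FTCT _ _ (contD cf cg) (F := fun x => prim f x + prim g x)
  (fun x => derD (is_derive_prim x cf) (is_derive_prim x cg))).
rewrite /oint; lra.
Qed.

Lemma ointZ k f a b : continuous f -> oint (fun x => k * f x) a b = k * oint f a b.
Proof.
move=> cf; rewrite (FTCT _ _ (contM (@cont_cst _ _ k) cf) (F := fun x => k * prim f x)
  (fun x => derZ k (is_derive_prim x cf))).
rewrite /oint; lra.
Qed.

Lemma ointB f g a b : continuous f -> continuous g ->
  oint (fun x => f x - g x) a b = oint f a b - oint g a b.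
Proof.
move=> cf cg; have -> : (fun x => f x - g x) = (fun x => f x + (-1) * g x).
  by apply/funext => x; lra.
rewrite ointD// ?ointZ//; first lra.
by apply: contM => //; exact: cont_cst.
Qed.

Lemma le_oint f g a b : continuous f -> continuous g -> a <= b ->
  (forall x, a <= x <= b -> f x <= g x) -> oint f a b <= oint g a b.
Proof.
move=> cf cg ab fg; rewrite -!oint_Rintegral//.
apply: le_Rintegral => //; try exact: cont_integrable.
Qed.

Lemma eq_oint f g a b : (forall x, a <= x <= b -> f x = g x) ->
  continuous f -> continuous g -> a <= b -> oint f a b = oint g a b.
Proof.
move=> fg cf cg ab; apply/eqP; rewrite eq_le !le_oint// => x xab; by rewrite fg.
Qed.

Lemma oint_ge0 f a b : continuous f -> a <= b ->
  (forall x, a <= x <= b -> 0 <= f x) -> 0 <= oint f a b.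
Proof.
move=> cf ab f0; have := oint_cst 0 a b; rewrite mul0r => <-.
by apply: le_oint => //; exact: cont_cst.
Qed.

Lemma oint_bound f M a b : continuous f -> a <= b ->
  (forall x, a <= x <= b -> `|f x| <= M) -> `|oint f a b| <= M * (b - a).
Proof.
move=> cf ab fM; rewrite ler_norml -mulNr -!oint_cst; apply/andP; split;
  apply: le_oint => //; try exact: cont_cst;
  by move=> x /fM; rewrite ler_norml => /andP[].
Qed.

Lemma oint_eq0 f a b : continuous f ->
  (forall x, a <= x <= b -> f x = 0) -> a <= b -> oint f a b = 0.
Proof.
move=> cf f0 ab; rewrite (@eq_oint f (fun=> 0)) ?oint_cst ?mul0r//; exact: cont_cst.
Qed.

(** Laws proved in the open fluid domain reach the bed and the surface through
    this lemma. *)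
Lemma cont_ext_closed f a b : continuous f -> a < b ->
  (forall x, a < x < b -> f x = 0) -> forall x, a <= x <= b -> f x = 0.
Proof.
move=> cf ab H x xab; apply/eqP; apply/negPn/negP => fx0.
have fx : 0 < `|f x| by rewrite normr_gt0.
have cn := cont_norm cf.
have : \forall z \near x, 0 < `|f z| by exact: (cn x _ (lt_nbhsr fx)).
move=> /nbhs_ballP[e /= e0 he].
pose lo := Num.max a (x - e / 2); pose hi := Num.min b (x + e / 2).
have lohi : lo < hi.
  rewrite /lo /hi lt_min !gt_max; case/andP: xab => ? ?.
  apply/andP; split; apply/andP; split; lra.
pose z := (lo + hi) / 2.
have zlo : lo < z by rewrite /z; lra.
have zhi : z < hi by rewrite /z; lra.
move: zlo zhi; rewrite /lo /hi gt_max lt_min => /andP[? ?] /andP[? ?].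
have : 0 < `|f z| by apply: he; rewrite /ball/= ltr_norml; apply/andP; split; lra.
by rewrite H ?normr0 ?ltxx//; apply/andP; split.
Qed.

Lemma oint_zero_fun f a b : continuous f -> a < b ->
  (forall x, a <= x <= b -> oint f a x = 0) -> forall x, a <= x <= b -> f x = 0.
Proof.
move=> cf ab i0; apply: cont_ext_closed => // x /andP[ax xb].
have [_ <-] := is_derive_oint a x cf.
have E : \near x, oint f a x = cst 0 x.
  near=> y; apply: i0; apply/andP; split; apply: ltW; near: y.
    exact: lt_nbhsr.
  exact: lt_nbhsl.
by rewrite (near_eq_derive _ E) ?derive_cst// oner_neq0.
Unshelve. all: by end_near. Qed.

Lemma oint_ge0_eq0 f a b : continuous f -> a < b ->
  (forall x, a <= x <= b -> 0 <= f x) -> oint f a b = 0 ->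
  forall x, a <= x <= b -> f x = 0.
Proof.
move=> cf ab f0 i0.
have i0' : forall x, a <= x <= b -> oint f a x = 0.
  move=> x /andP[ax xb]; apply/eqP; rewrite eq_le; apply/andP; split.
    rewrite -i0 -(oint_cat f a x b) lerDl; apply: oint_ge0 => // y /andP[xy yb].
    by apply: f0; rewrite yb (le_trans ax).
  apply: oint_ge0 => // y /andP[xy yb].
  by apply: f0; rewrite xy (le_trans yb).
exact: oint_zero_fun i0'.
Qed.

Lemma oint_subst f (g dg : R -> R) a b : continuous f -> continuous dg ->
  (forall x, is_derive x (1 : R) g (dg x)) ->
  oint (fun x => f (g x) * dg x) a b = oint f (g a) (g b).
Proof.
move=> cf cdg dgE; have cg := der_cont dgE.
rewrite (FTCT _ _ (contM (cont_comp cf cg) cdg) (F := fun x => prim f (g x))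
  (fun x => der_comp (is_derive_prim _ cf) (dgE x)))//.
Qed.

(** Moving the end points into the integrand reduces the continuity of integrals
    with variable end points to that of integrals over a fixed interval. *)
Lemma oint_affine f a b : continuous f ->
  oint f a b = (b - a) * oint (fun t => f (a + t * (b - a))) 0 1.
Proof.
move=> cf; rewrite -ointZ; last by cont.
have := @oint_subst f (fun t => a + t * (b - a)) (fun=> b - a) 0 1 cf
  (@cont_cst _ _ _) (der_affine (b - a) a).
rewrite mul0r addr0 mul1r (_ : a + (b - a) = b); last lra.
by move=> <-; congr oint; apply/funext => t; rewrite mulrC.
Qed.

Lemma oint_shift f a b h : continuous f ->
  oint (fun t => f (t + h)) a b = oint f (a + h) (b + h).
Proof.
move=> cf.
have := @oint_subst f (fun t => h + t * 1) (fun=> 1) a b cf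
  (@cont_cst _ _ _) (der_affine 1 h).
rewrite !mulr1 ![h + _]addrC => <-.
by congr oint; apply/funext => t; rewrite !mulr1 addrC.
Qed.

Section Parametric.
Context {T : topologicalType}.

Lemma tube (f : T * R -> R) a b (t0 : T) (e : R) : continuous f -> 0 < e ->
  \forall t \near t0, forall y, a <= y <= b -> `|f (t, y) - f (t0, y)| < e.
Proof.
move=> cf e0.
have /compact_near_coveringP K : compact `[a, b]%classic by exact: segment_compact.
have H : nbhs t0 (fun t => `[a, b]%classic `<=` (fun y => `|f (t, y) - f (t0, y)| < e)).
  apply: K => y _.
  have e2 : 0 < e / 2 by lra.
  have /cvgrPdist_lt/(_ _ e2) := cf (t0, y).
  move=> [[/= A B] [A1 B1] AB].
  exists (B, A) => // -[y' t] [/= By At].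
  have h1 := AB (t, y') (conj At By).
  have h2 := AB (t0, y') (conj (nbhs_singleton A1) By).
  move: h1 h2 => /=; set u := f (t0, y); set v := f (t, y'); set w := f (t0, y').
  rewrite !ltr_norml => /andP[? ?] /andP[? ?]; apply/andP; split; lra.
by apply: filterS H => t H y yab; apply: H; rewrite /= in_itv.
Qed.

Lemma cont_oint_fix (f : T * R -> R) a b : continuous f ->
  continuous (fun t => oint (fun y => f (t, y)) a b).
Proof.
move=> cf.
have cft t : continuous (fun y => f (t, y)) by cont.
suff H : forall a b, a <= b -> continuous (fun t => oint (fun y => f (t, y)) a b).
  case: (leP a b) => [|/ltW] ab; first exact: H.
  by under eq_fun do rewrite ointN; apply: contN; exact: H.
move=> {a b} a b ab t0; apply/cvgrPdist_le => e e0.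
have e1 : 0 < e / (b - a + 1) by apply: divr_gt0 => //; lra.
apply: filterS (tube a b t0 cf e1) => t Ht.
rewrite -ointB//.
apply: le_trans (@oint_bound _ (e / (b - a + 1)) a b _ ab _) _.
- by apply: contD => //; exact: contN.
- by move=> x xab; rewrite distrC; apply: ltW; exact: Ht.
- by rewrite mulrAC ler_pdivrMr; [nra|lra].
Qed.

Lemma cont_oint (f : T -> R -> R) (a b : T -> R) :
  continuous (fun z : T * R => f z.1 z.2) -> continuous a -> continuous b ->
  continuous (fun t => oint (f t) (a t) (b t)).
Proof.
move=> cf ca cb.
have cft t : continuous (f t).
  exact: (cont_comp (g := (fun y => (t, y))) cf (cont_pair (@cont_cst _ _ _) (@cont_id _))).
pose F z : R := f z.1 (a z.1 + z.2 * (b z.1 - a z.1)).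
have cF : continuous F.
  apply: (cont_comp (g := fun z : T * R => (z.1, a z.1 + z.2 * (b z.1 - a z.1))) cf).
  by cont.
have -> : (fun t => oint (f t) (a t) (b t)) =
    (fun t => (b t - a t) * oint (fun s => F (t, s)) 0 1).
  by apply/funext => t; rewrite [LHS]oint_affine.
by apply: contM; [cont|exact: cont_oint_fix].
Qed.

End Parametric.

(** As functions of [b], both sides vanish at [b = a] and have the same
    derivative: the difference quotient of the right side averages [f] over the
    segment from [x] to [z], which is continuous in [z]. *)
Lemma oint_swap (f : R -> R -> R) a b c d :
  continuous (fun z : R * R => f z.1 z.2) ->
  oint (fun x => oint (f x) c d) a b = oint (fun y => oint (f^~ y) a b) c d.
Proof.
move=> cf; pose f' := fun z : R * R => f z.1 z.2.
have cf1 x : continuous (f x).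
  exact: (cont_comp (g := (fun y => (x, y))) cf (cont_pair (@cont_cst _ _ _) (@cont_id _))).
have cf2 y : continuous (f^~ y).
  exact: (cont_comp (g := (fun x => (x, y))) cf (cont_pair (@cont_id _) (@cont_cst _ _ _))).
have cI x y : continuous (fun t => oint (f t) x y).
  by apply: cont_oint => //; exact: cont_cst.
have cI2 x : continuous (fun y => oint (f^~ y) a x).
  apply: cont_oint; try exact: cont_cst.
  by apply: (cont_comp (g := (fun z : R * R => (z.2, z.1))) cf); cont.
suff dI x : is_derive x (1 : R) (fun t => oint (fun y => oint (f^~ y) a t) c d) (oint (f x) c d).
  rewrite (FTCT _ _ (cI c d) dI) [X in _ - X](_ : _ = 0) ?subr0//.
  by under eq_fun do rewrite ointaa; rewrite oint_cst mul0r.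
apply/is_derive1_caratheodory.
have cJ : continuous (fun z : (R * R) * R => f (x + z.2 * (z.1.1 - x)) z.1.2).
  apply: (cont_comp (g := (fun z : (R * R) * R => (x + z.2 * (z.1.1 - x), z.1.2))) cf).
  by cont.
have cK : continuous (fun z : R * R => oint (fun t => f (x + t * (z.1 - x)) z.2) 0 1).
  by apply: cont_oint => //; exact: cont_cst.
exists (fun z => oint (fun y => oint (fun t => f (x + t * (z - x)) y) 0 1) c d).
have cKz z : continuous (fun y => oint (fun t => f (x + t * (z - x)) y) 0 1).
  exact: (cont_comp (g := (fun y => (z, y))) cK (cont_pair (@cont_cst _ _ _) (@cont_id _))).
split.
- move=> z; rewrite -ointB// mulrC -ointZ//; congr oint; apply/funext => y.
  rewrite -(oint_cat _ a x z) addrAC subrr add0r.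
  by rewrite oint_affine.
- by move: x {cJ cKz} cK => x cK; apply: cont_oint; try exact: cont_cst.
- under eq_fun do under eq_fun do rewrite subrr mulr0 addr0.
  by congr oint; apply/funext => y; rewrite oint_cst subr0 mulr1.
Qed.

End Integral.

(** * Functions on the plane: chain rule, measurability, Fubini *)

Section Plane.
Context {R : realType}.
Notation mu := (@lebesgue_measure R).
Notation RR := (measurableTypeR R * measurableTypeR R)%type.
Implicit Types (F : R -> R) (f k : R * R -> R).

Lemma der_epsP F (l x : R) : is_derive x (1 : R) F l <->
  forall e, 0 < e -> \forall z \near x, `|F z - F x - l * (z - x)| <= e * `|z - x|.
Proof.
split=> [/is_derive1_caratheodory[g [Fg cg <-]] e e0|H].
  have /cvgrPdist_le/(_ _ e0) := cg; apply: filterS => z.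
  by rewrite Fg -mulrBl normrM distrC => /ler_wpM2r; apply.
apply/is_derive1_caratheodory.
pose g z := if z == x then l else (F z - F x) / (z - x).
exists g; split; last by rewrite /g eqxx.
  move=> z; rewrite /g; case: eqVneq => [->|zx]; first by rewrite !subrr mulr0.
  by rewrite divfK// subr_eq0.
apply/cvgrPdist_le => e e0; apply: filterS (H e e0) => z Hz.
rewrite {1}/g eqxx /g distrC; case: eqVneq => [_|zx]; first by rewrite subrr normr0 ltW.
have z0 : 0 < `|z - x| by rewrite normr_gt0 subr_eq0.
by rewrite -(ler_pM2r z0) -normrM mulrBl divfK// subr_eq0.
Qed.

Lemma MVT_dist F (dF : R -> R) (x y : R) :
  (forall z, `|z - x| <= `|y - x| -> is_derive z (1 : R) F (dF z)) ->
  exists2 z, `|z - x| <= `|y - x| & F y - F x = dF z * (y - x).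
Proof.
move=> dFE.
have H a b : a <= b -> `|a - x| <= `|y - x| -> `|b - x| <= `|y - x| ->
    exists2 z, `|z - x| <= `|y - x| & F b - F a = dF z * (b - a).
  move=> ab ha hb.
  have hz z : z \in `[a, b] -> `|z - x| <= `|y - x|.
    rewrite in_itv/= => /andP[az zb].
    by move: ha hb; rewrite !ler_norml => /andP[? ?] /andP[? ?]; apply/andP; split; lra.
  have [|| z zab ->] := @MVT_segment R F dF a b ab.
  - by move=> z zab; apply/dFE/hz; exact: subset_itv_oo_cc.
  - apply: continuous_in_subspaceT => z; rewrite inE => /hz /dFE[d _].
    exact/differentiable_continuous/derivable1_diffP.
  - by exists z => //; exact: hz.
have [xy|/ltW yx] := leP x y; first by apply: H => //; rewrite subrr normr0.
have [|z hz E] := H y x yx (lexx _); first by rewrite subrr normr0.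
exists z => //; lra.
Qed.

(** The increment is split along the two legs of an L-shaped path, with the mean
    value theorem on each leg; continuity at the starting point [p] then allows the
    partial derivatives to be replaced by their values at [p]. *)
Lemma der_chain f (f1 f2 : R * R -> R) (c1 c2 : R -> R) (t l1 l2 : R) :
  let p := (c1 t, c2 t) in
  (\forall q \near p, is_derive q.1 (1 : R) (fun x => f (x, q.2)) (f1 q) /\
                      is_derive q.2 (1 : R) (fun y => f (q.1, y)) (f2 q)) ->
  {for p, continuous f1} -> {for p, continuous f2} ->
  is_derive t (1 : R) c1 l1 -> is_derive t (1 : R) c2 l2 ->
  is_derive t (1 : R) (fun s => f (c1 s, c2 s)) (f1 p * l1 + f2 p * l2).
Proof.
move=> p df cf1 cf2 d1 d2; apply/der_epsP => e e0.
pose K := `|l1| + `|l2| + 2 + `|f1 p| + `|f2 p|.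
have K0 : 0 < K.
  rewrite /K; move: (normr_ge0 l1) (normr_ge0 l2) (normr_ge0 (f1 p)) (normr_ge0 (f2 p)); lra.
pose d := Num.min 1 (e / K).
have d0 : 0 < d by rewrite /d lt_min ltr01 divr_gt0.
have d1' : d <= 1 by rewrite /d ge_min lexx.
have dK : d * K <= e by rewrite -ler_pdivlMr// /d ge_min lexx orbT.
have /cvgrPdist_le/(_ _ d0) n1 := cf1.
have /cvgrPdist_le/(_ _ d0) n2 := cf2.
have /nbhs_ballP[r /= r0 Hr] :=
  @filterI _ _ (nbhs_filter p) _ _ df (@filterI _ _ (nbhs_filter p) _ _ n1 n2).
have /der_epsP/(_ _ d0) m1 := d1; have /der_epsP/(_ _ d0) m2 := d2.
have cc1 : {for t, continuous c1} by case: d1 => /derivable1_diffP/differentiable_continuous.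
have cc2 : {for t, continuous c2} by case: d2 => /derivable1_diffP/differentiable_continuous.
have /cvgrPdist_lt/(_ _ r0) b1 := cc1; have /cvgrPdist_lt/(_ _ r0) b2 := cc2.
near=> s.
have B1 : `|c1 t - c1 s| < r by near: s.
have B2 : `|c2 t - c2 s| < r by near: s.
have M1 : `|c1 s - c1 t - l1 * (s - t)| <= d * `|s - t| by near: s.
have M2 : `|c2 s - c2 t - l2 * (s - t)| <= d * `|s - t| by near: s.
have inB x y : `|x - c1 t| <= `|c1 s - c1 t| -> `|y - c2 t| <= `|c2 s - c2 t| -> ball p r (x, y).
  by move=> hx hy; split; rewrite /ball/= distrC; [apply: le_lt_trans hx _|apply: le_lt_trans hy _]; rewrite distrC.
have [z1 hz1 E1] := @MVT_dist (fun x => f (x, c2 t)) (fun x => f1 (x, c2 t)) (c1 t) (c1 s)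
  (fun z hz => (Hr _ (inB _ (c2 t) hz ltac:(by rewrite subrr normr0))).1.1).
have [z2 hz2 E2] := @MVT_dist (fun y => f (c1 s, y)) (fun y => f2 (c1 s, y)) (c2 t) (c2 s)
  (fun z hz => (Hr _ (inB (c1 s) _ (lexx _) hz)).1.2).
have N1 : `|f1 p - f1 (z1, c2 t)| <= d.
  by apply: (Hr _ (inB _ (c2 t) hz1 _)).2.1; rewrite subrr normr0.
have N2 : `|f2 p - f2 (c1 s, z2)| <= d.
  by apply: (Hr _ (inB (c1 s) _ (lexx _) hz2)).2.2.
have -> : f (c1 s, c2 s) - f (c1 t, c2 t) - (f1 p * l1 + f2 p * l2) * (s - t) =
  - (f1 p - f1 (z1, c2 t)) * (c1 s - c1 t) + f1 p * (c1 s - c1 t - l1 * (s - t)) +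
  (- (f2 p - f2 (c1 s, z2)) * (c2 s - c2 t) + f2 p * (c2 s - c2 t - l2 * (s - t))).
  by move: E1 E2; set A := f (c1 s, c2 s); set B := f (c1 s, c2 t); set C := f (c1 t, c2 t); lra.
have T (c l k q : R) : `|k - q| <= d -> `|c - l * (s - t)| <= d * `|s - t| ->
    `|- (k - q) * c + k * (c - l * (s - t))| <= d * (`|l| + 1 + `|k|) * `|s - t|.
  move=> kq cl; apply: le_trans (ler_normD _ _) _; rewrite !normrM normrN.
  have C : `|c| <= (`|l| + 1) * `|s - t|.
    rewrite -(subrK (l * (s - t)) c); apply: le_trans (ler_normD _ _) _.
    rewrite normrM mulrDl addrC lerD2l mul1r; apply: le_trans cl _.
    by rewrite ler_piMl.
  have := ler_pM (normr_ge0 _) (normr_ge0 _) kq C.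
  have := ler_wpM2l (normr_ge0 k) cl; lra.
apply: le_trans (ler_normD _ _) _.
apply: le_trans (lerD (T _ _ _ _ N1 M1) (T _ _ _ _ N2 M2)) _.
rewrite -mulrDl ler_wpM2r//; apply: le_trans dK; rewrite -mulrDr ler_wpM2l ?(ltW d0)// /K; lra.
Unshelve. all: by end_near. Qed.

(** The product sigma-algebra is generated by rectangles, so that countability
    has to be used: an open set is a union of squares with rational centres. *)
Lemma open_measurable2 (A : set (R * R)) : open A -> measurable (A : set RR).
Proof.
move=> oA.
pose B (n : nat) (q1 q2 : rat) : set (R * R) :=
  ball (ratr q1 : R) n.+1%:R^-1 `*` ball (ratr q2 : R) n.+1%:R^-1.
pose C n q1 q2 := if `[< B n q1 q2 `<=` A >] then B n q1 q2 else set0.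
have -> : A = \bigcup_n \bigcup_q1 \bigcup_q2 C n q1 q2.
  apply/seteqP; split=> [p Ap|p [n _ [q1 _ [q2 _]]]]; last first.
    by rewrite /C; case: asboolP => // BA /BA.
  have /nbhs_ballP[e /= e0 He] : nbhs p A by exact: open_nbhs_nbhs.
  have [n n2] : exists n : nat, n.+1%:R^-1 < e / 2 :> R.
    have e2 : 0 < e / 2 by lra.
    have := near_infty_natSinv_lt (PosNum e2) => -[n _ /(_ n)]/=.
    by move=> /(_ (leqnn _)) ?; exists n.
  have rr (x : R) : exists q : rat, `|x - ratr q| < n.+1%:R^-1 :> R.
    have n0 : 0 < n.+1%:R^-1 :> R by [].
    move: (n.+1%:R^-1 : R) n0 => i i0.
    have [||z [/= hq [q _ qz]]] := @dense_rat R `]x - i, x + i[%classic.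
    - by exists x; rewrite /= in_itv/=; apply/andP; split; lra.
    - exact: interval_open.
    exists q; move: hq; rewrite -qz in_itv/= ltr_norml => /andP[? ?]; apply/andP; split; lra.
  have [q1 h1] := rr p.1; have [q2 h2] := rr p.2.
  exists n => //; exists q1 => //; exists q2 => //; rewrite /C asboolT; last first.
    have T (a b c : R) : `|a - b| < n.+1%:R^-1 -> `|b - c| < n.+1%:R^-1 -> `|a - c| < e.
      move: (n.+1%:R^-1 : R) n2 => i i2.
      by rewrite !ltr_norml => /andP[? ?] /andP[? ?]; apply/andP; split; lra.
    by move=> [x y] [/= hx hy]; apply: He; split; [exact: T h1 hx|exact: T h2 hy].
  by split; rewrite /= /ball/= distrC.
apply: bigcup_measurable => n _.
apply: bigcupT_measurable_rat => q1; apply: bigcupT_measurable_rat => q2.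
rewrite /C; case: asboolP => // _; apply: measurableX; exact: measurable_ball.
Qed.

Lemma cont_measurable f : continuous f -> measurable_fun [set: RR] f.
Proof.
move=> /continuousP cf; apply: (measurability _ (RGenOpens.measurableE R)).
move=> _ [_ [a [b ->] <-]]; rewrite setTI; apply: open_measurable2.
exact/cf/interval_open.
Qed.

Definition box (N : R) : set (R * R) := `[- N, N]%classic `*` `[- N, N]%classic.

Lemma boxP N p : box N p <-> `|p.1| <= N /\ `|p.2| <= N.
Proof. by rewrite /box /= !in_itv/= !ler_norml. Qed.

Lemma measurable_box N : measurable (box N : set RR).
Proof. exact: measurableX. Qed.

Lemma box_fin N : (leb2 (box N) < +oo)%E.
Proof.
rewrite /leb2 product_measure1E// lte_mul_pinfty// ?ge0_fin_numE//=;
  by rewrite lebesgue_measure_itv/=; case: ifP => _; rewrite ltry.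
Qed.

Lemma compact_box N : compact (box N).
Proof. by apply: compact_setX; exact: segment_compact. Qed.

Lemma cont_bounded (K : set (R * R)) f : compact K -> continuous f ->
  exists2 M, 0 < M & forall p, K p -> `|f p| <= M.
Proof.
move=> cK cf.
have [M [Mr HM]] : bounded_set (f @` K).
  by apply: compact_bounded; apply: continuous_compact => //; exact: continuous_subspaceT.
exists (`|M| + 1); first by rewrite ltr_wpDl.
move=> p Kp; apply: (HM (`|M| + 1)); last by exists p.
by rewrite (le_lt_trans (ler_norm M))// ltrDl.
Qed.

Lemma cont_integrable_box N f : continuous f -> leb2.-integrable (box N) (EFin \o f).
Proof.
move=> cf; apply: measurable_bounded_integrable; [exact: measurable_box|exact: box_fin|..].
  by apply: measurable_funTS; exact: cont_measurable.
have [M M0 HM] := cont_bounded (@compact_box N) cf.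
by exists M; split; [exact: num_real|move=> x Mx p Bp; apply: le_trans (HM p Bp) (ltW Mx)].
Qed.

Lemma cont_integrable_supp N f : continuous f -> (forall p, ~ box N p -> f p = 0) ->
  leb2.-integrable setT (EFin \o f).
Proof.
move=> cf f0; have := cont_integrable_box N cf; rewrite integrable_mkcond; last exact: measurable_box.
rewrite (_ : _ \_ _ = EFin \o f)//; apply/funext => p; rewrite patchE.
by case: ifPn => // /negP; rewrite inE => /f0 /= ->.
Qed.

Lemma Rintegral_itv_supp (g : R -> R) a b : a <= b -> continuous g ->
  (forall x, ~ (a <= x <= b) -> g x = 0) -> \int[mu]_x g x = oint g a b.
Proof.
move=> ab cg g0; rewrite -oint_Rintegral// [RHS]Rintegral_mkcond.
apply: eq_Rintegral => x _; rewrite patchE.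
by case: ifPn => // /negP; rewrite inE/= in_itv/= => /g0.
Qed.

Lemma Rintegral_oint (g : R -> R) (N : R) : 0 <= N -> continuous g ->
  (forall x, ~ `|x| <= N -> g x = 0) -> \int[mu]_x g x = oint g (- N) N.
Proof.
move=> N0 cg g0; apply: Rintegral_itv_supp => //; first by lra.
by move=> x h; apply: g0; rewrite ler_norml.
Qed.

Lemma fubini_oint N f : 0 <= N -> continuous f -> (forall p, ~ box N p -> f p = 0) ->
  \int[leb2]_p f p = oint (fun x => oint (fun y => f (x, y)) (- N) N) (- N) N.
Proof.
move=> N0 cf f0; rewrite /Rintegral -integral12_prod_meas1; last exact: cont_integrable_supp f0.
have inner x : (\int[mu]_y (f (x, y))%:E = (oint (fun y => f (x, y)) (- N) N)%:E)%E.
  rewrite -Rintegral_oint//; [|by cont|].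
    rewrite /Rintegral fineK//; apply: integrable_fin_num => //.
    have cfx : continuous (fun y => f (x, y)) by cont.
    have := cont_integrable (- N) N cfx; rewrite [X in X -> _]integrable_mkcond//.
    rewrite (_ : _ \_ _ = EFin \o (fun y => f (x, y)))//; apply/funext => y; rewrite patchE.
    by case: ifPn => // /negP; rewrite inE/= in_itv/= -ler_norml => h /=; rewrite f0// => /boxP[].
  by move=> y h; rewrite f0// => /boxP[].
rewrite -[RHS]Rintegral_oint//.
- by rewrite /Rintegral; congr fine; apply: eq_integral => x _; exact: inner.
- by apply: cont_oint; cont.
- move=> x h; apply: oint_eq0; [by cont| |lra].
  by move=> y _; apply: f0 => /boxP[].
Qed.

Lemma oint_supp (g : R -> R) a b A B : a <= b -> A <= a -> b <= B -> continuous g ->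
  (forall x, ~ (a <= x <= b) -> g x = 0) -> oint g A B = oint g a b.
Proof.
move=> ab Aa bB cg g0; rewrite -(Rintegral_itv_supp ab cg g0).
rewrite -(@Rintegral_itv_supp g A B)//; first by rewrite (le_trans Aa) ?(le_trans ab).
move=> x h; apply: g0 => /andP[ax xb]; apply: h.
by rewrite (le_trans Aa ax) (le_trans xb bB).
Qed.

Lemma fubini_strip N a b f : 0 <= N -> a <= b -> continuous f ->
  (forall p, ~ box N p -> f p = 0) -> (forall p, ~ (a <= p.1 <= b) -> f p = 0) ->
  \int[leb2]_p f p = oint (fun x => oint (fun y => f (x, y)) (- N) N) a b.
Proof.
move=> N0 ab cf f0 fab; rewrite (fubini_oint N0 cf f0).
have cI : continuous (fun x => oint (fun y => f (x, y)) (- N) N) by apply: cont_oint; cont.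
have zero x : (forall y, f (x, y) = 0) -> oint (fun y => f (x, y)) (- N) N = 0.
  by move=> fx; apply: oint_eq0 => [|y _|]; [cont|exact: fx|lra].
rewrite -(@Rintegral_itv_supp _ (- N) N)//; [|lra|].
  by apply: Rintegral_itv_supp => // x h; apply: zero => y; apply: fab.
by move=> x h; apply: zero => y; apply: f0 => /boxP[/= h1 _]; apply: h; rewrite -ler_norml.
Qed.

End Plane.

Lemma eq_eps {R : realType} (x y C : R) :
  (forall e, 0 < e -> `|x - y| <= C * e) -> x = y.
Proof.
move=> H; apply/eqP; rewrite -subr_eq0 -normr_le0; apply/ler_addgt0Pr => e e0.
rewrite add0r; have C1 : 0 < `|C| + 1 by rewrite ltr_wpDl.
apply: le_trans (H (e / (`|C| + 1)) _) _; first exact: divr_gt0.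
rewrite mulrCA ler_piMr ?(ltW e0)// ler_pdivrMr// mul1r.
by rewrite (le_trans (ler_norm C))// lerDl.
Qed.

(** * Translations, averages and test functions *)

Section Compact.
Context {R : realType}.
Implicit Types (K D : set (R * R)) (f k : R * R -> R) (b : bool).

Lemma compact_closed2 K : compact K -> closed K.
Proof. by apply: compact_closed; exact: norm_hausdorff. Qed.

Lemma compact_measurable2 K :
  compact K -> measurable (K : set (measurableTypeR R * measurableTypeR R)).
Proof.
move=> /compact_closed2/closed_openC/open_measurable2/measurableC.
by rewrite setCK.
Qed.

Lemma compact_sub_box K : compact K -> exists2 N : R, 0 <= N & K `<=` box N.
Proof.
move=> cK.
have [M1 M10 H1] := cont_bounded cK (@cont_fst R R).
have [M2 M20 H2] := cont_bounded cK (@cont_snd R R).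
exists (Num.max M1 M2); first by rewrite le_max ltW.
by move=> p Kp; apply/boxP; rewrite !le_max H1// H2// orbT.
Qed.

(** The closed [r]-neighbourhood of [K] for the sup norm. It contains the supports
    of all translates by at most [r] of functions supported in [K]. *)
Definition thick K (r : R) : set (R * R) := [set p | exists2 q, K q & box r (p.1 - q.1, p.2 - q.2)].

Lemma sub_thick K r : 0 <= r -> K `<=` thick K r.
Proof. by move=> r0 p Kp; exists p => //; apply/boxP; rewrite /= !subrr normr0. Qed.

Lemma compact_thick K r : compact K -> compact (thick K r).
Proof.
move=> cK; have -> : thick K r = (fun z => (z.1.1 + z.2.1, z.1.2 + z.2.2)) @` (K `*` box r).
  apply/seteqP; split => [p [q Kq hq]|_ [[q z] [/= Kq hz] <-]].
    exists (q, (p.1 - q.1, p.2 - q.2)) => //=.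
    by case: p {hq} => x y /=; congr pair; lra.
  exists q => //=; rewrite (_ : (_, _) = z)//; case: z {hz} => x y /=; congr pair; lra.
apply: continuous_compact; first by apply: continuous_subspaceT; cont.
by apply: compact_setX => //; exact: compact_box.
Qed.

Lemma thick_sub K D : compact K -> open D -> K `<=` D ->
  exists2 r, 0 < r & thick K r `<=` D.
Proof.
move=> /compact_near_coveringP cK oD KD.
have H : nbhs (0 : R * R) (fun z => K `<=` (fun q => D (q.1 + z.1, q.2 + z.2))).
  apply: (cK _ (nbhs (0 : R * R)) (fun z q => D (q.1 + z.1, q.2 + z.2))) => q Kq.
  have cs : continuous (fun w : (R * R) * (R * R) => (w.1.1 + w.2.1, w.1.2 + w.2.2)).
    by cont.
  have HD : nbhs (q.1 + (0 : R * R).1, q.2 + (0 : R * R).2) D.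
    rewrite /= !addr0 -surjective_pairing.
    by apply: open_nbhs_nbhs; split => //; exact: KD.
  exact: (cs (q, 0) _ HD).
have /nbhs_ballP[e /= e0 He] := H.
exists (e / 2); first lra.
move=> p [q Kq /boxP[/= h1 h2]].
have := He (p.1 - q.1, p.2 - q.2) _ q Kq => /=.
rewrite !subrKC -surjective_pairing; apply.
by split; rewrite /ball/= sub0r normrN; [move: h1|move: h2]; lra.
Qed.

(** The boolean selects the axis, [true] for [x] and [false] for [y], so that one
    argument serves for both partial derivatives. *)
Definition sh b (s : R) (p : R * R) := if b then (p.1 + s, p.2) else (p.1, p.2 + s).

Definition dir b : R * R := if b then (1, 0) else (0, 1).

Lemma sh_cont b : continuous (fun z : (R * R) * R => sh b z.2 z.1).
Proof. by case: b; rewrite /sh; cont. Qed.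

Lemma sh_cont1 b s : continuous (sh b s).
Proof. by case: b; rewrite /sh; cont. Qed.

Lemma shD b s t p : sh b s (sh b t p) = sh b (t + s) p.
Proof. by case: b; rewrite /sh /=; congr pair; rewrite addrA. Qed.

Lemma sh0 b p : sh b 0 p = p.
Proof. by case: b p => -[x y]; rewrite /sh /= addr0. Qed.

Lemma sh_thick K b s p r : `|s| <= r -> K (sh b s p) -> thick K r p.
Proof.
move=> sr Kp; exists (sh b s p) => //; apply/boxP.
case: b {Kp}; rewrite /sh /= ?subrr ?normr0 ?opprD ?addrA ?subrr ?add0r ?normrN;
  by rewrite sr (le_trans (normr_ge0 s)).
Qed.

Lemma unif_sh K b f : compact K -> continuous f -> forall e, 0 < e ->
  exists2 r, 0 < r & forall s p, `|s| <= r -> K p -> `|f (sh b s p) - f p| <= e.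
Proof.
move=> /compact_near_coveringP cK cf e e0.
have H : nbhs (0 : R) (fun s => K `<=` (fun p => `|f (sh b s p) - f p| <= e)).
  apply: (cK _ (nbhs (0 : R)) (fun s p => `|f (sh b s p) - f p| <= e)) => p Kp.
  have cF : continuous (fun z : (R * R) * R => `|f (sh b z.2 z.1) - f z.1|).
    by apply: cont_norm; apply: contD; [exact: cont_comp cf (@sh_cont b)|cont].
  have /cvgrPdist_le/(_ _ e0) := cF (p, 0).
  by apply: filterS => z /=; rewrite sh0 subrr normr0 sub0r normrN normr_id.
have /nbhs_ballP[d /= d0 Hd] := H.
exists (d / 2); first lra.
move=> s p sd Kp; apply: Hd => //; rewrite /ball/= sub0r normrN; lra.
Qed.

(** The mean of [k] over a segment of length [h] parallel to the axis [b]. Its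
    derivative along [b] is a difference quotient of [k] ([Av_der]); averaging
    along both axes thus makes a continuous function [C^1], and plays the role
    of a mollifier. *)
Definition Av b (h : R) k (p : R * R) : R := oint (fun t => k (sh b (t * h) p)) 0 1.

Lemma Av_contt b (h : R) k p : continuous k -> continuous (fun t : R => k (sh b (t * h) p)).
Proof.
move=> ck; apply: cont_comp ck _.
by apply: (cont_comp (g := fun t : R => (p, t * h)) (@sh_cont b)); cont.
Qed.

Lemma Av_cont b h k : continuous k -> continuous (Av b h k).
Proof.
move=> ck; apply: cont_oint; try exact: cont_cst.
apply: cont_comp ck _.
by apply: (cont_comp (g := fun z : (R * R) * R => (z.1, z.2 * h)) (@sh_cont b)); cont.
Qed.

Lemma Av_swap b h h' k : continuous k ->
  Av b h (Av (~~ b) h' k) = Av (~~ b) h' (Av b h k).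
Proof.
move=> ck; apply/funext => p; rewrite /Av.
rewrite (oint_swap (f := fun t s => k (sh (~~ b) (s * h') (sh b (t * h) p)))); last first.
  apply: cont_comp ck _.
  apply: (cont_comp (g := fun z : R * R => (sh b (z.1 * h) p, z.2 * h')) (@sh_cont (~~ b))).
  apply: cont_pair; last by cont.
  by apply: (cont_comp (g := fun z : R * R => (p, z.1 * h)) (@sh_cont b)); cont.
apply: congr_oint => s.
apply: congr_oint => t.
by apply: (congr1 k); rewrite /sh; case: (b).
Qed.

Lemma Av_close b h k1 k2 e : continuous k1 -> continuous k2 ->
  (forall p, `|k1 p - k2 p| <= e) -> forall p, `|Av b h k1 p - Av b h k2 p| <= e.
Proof.
move=> c1 c2 H p; rewrite /Av -ointB; try exact: Av_contt.
rewrite -[leRHS]mulr1 -[X in _ * X](subr0 1); apply: oint_bound => //.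
by apply: contD; [exact: Av_contt|apply: contN; exact: Av_contt].
Qed.

Definition csupp K k := forall p, ~ K p -> k p = 0.

Lemma Av_supp K b h k r : continuous k -> csupp K k -> `|h| <= r -> csupp (thick K r) (Av b h k).
Proof.
move=> ck sk hr p Kp; apply: oint_eq0 => //; first exact: Av_contt.
move=> t /andP[t0 t1]; apply: sk => /(@sh_thick K b (t * h) p r) H; apply/Kp/H.
by rewrite normrM ger0_norm// (le_trans _ hr)// ler_piMl.
Qed.

Lemma Av_unif K b k : compact K -> continuous k -> csupp K k -> forall e, 0 < e ->
  exists2 r, 0 < r & forall h p, `|h| <= r -> `|Av b h k p - k p| <= e.
Proof.
move=> cK ck sk e e0.
have [r r0 Hr] := unif_sh b (@compact_thick K 1 cK) ck e0.
exists (Num.min r 1); first by rewrite lt_min r0 ltr01.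
move=> h p; rewrite le_min => /andP[hr h1].
have -> : k p = oint (fun=> k p) 0 1 by rewrite oint_cst subr0 mulr1.
rewrite -ointB; [|exact: Av_contt|exact: cont_cst].
rewrite -[leRHS]mulr1 -[X in _ * X](subr0 1); apply: oint_bound => //.
  by apply: contD; [exact: Av_contt|exact: cont_cst].
move=> t /andP[t0 t1].
have th : `|t * h| <= `|h| by rewrite normrM ger0_norm// ler_piMl.
have [Kp|Kp] := pselect (thick K 1 p); first by apply: Hr => //; exact: le_trans hr.
rewrite !sk ?subrr ?normr0 ?(ltW e0)// => [Kp'|Kp']; apply: Kp.
  by apply: sub_thick Kp'; rewrite ler01.
by apply: sh_thick Kp'; exact: le_trans h1.
Qed.

Definition pder b f p (l : R) :=
  if b then is_derive p.1 (1 : R) (fun x => f (x, p.2)) l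
  else is_derive p.2 (1 : R) (fun y => f (p.1, y)) l.

Lemma Av_der b h k p : continuous k -> h != 0 ->
  pder b (Av b h k) p (h^-1 * (k (sh b h p) - k p)).
Proof.
move=> ck h0.
have H (F : R -> R) x : continuous F ->
    is_derive x (1 : R) (fun x => oint (fun t => F (x + t * h)) 0 1) (h^-1 * (F (x + h) - F x)).
  move=> cF; have -> : (fun x => oint (fun t => F (x + t * h)) 0 1) =
      (fun x => h^-1 * (prim F (x + h) - prim F x)).
    apply/funext => z; have := oint_affine z (z + h) cF.
    rewrite (_ : z + h - z = h); last lra.
    by move=> E; rewrite -[LHS](mulKf h0) -E.
  apply: derZ; apply: derB (is_derive_prim _ cF).
  rewrite -[F (x + h)]mulr1.
  apply: (der_comp (G := fun z => z + h)); first exact: is_derive_prim.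
  by have := derD (der_id x) (der_cst h x); rewrite addr0.
case: p => x y; have c1 : continuous (fun z => k (z, y)) by cont.
have c2 : continuous (fun z => k (x, z)) by cont.
by case: b; [exact: (H (fun z => k (z, y)) x c1)|exact: (H (fun z => k (x, z)) y c2)].
Qed.

Lemma pderP b f p l : pder b f p l <-> is_derive p (dir b) f l.
Proof.
have E : (fun h : R => h^-1 *: ((f \o shift p) (h *: dir b) - f p)) =
  if b then (fun h : R => h^-1 *: (((fun x => f (x, p.2)) \o shift p.1) (h *: (1 : R)) - f (p.1, p.2)))
  else (fun h : R => h^-1 *: (((fun y => f (p.1, y)) \o shift p.2) (h *: (1 : R)) - f (p.1, p.2))).
  case: b; apply/funext => h; congr (_ *: (_ - _)); rewrite -?surjective_pairing//=;
  by congr f; rewrite /dir /= [RHS]surjective_pairing /= /shift /=; congr pair; rewrite /= ?mulr0 ?scaler0 ?add0r.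
rewrite /pder; case: b E => E; split=> -[d e]; constructor.
- by rewrite /derivable E.
- by rewrite /derive E.
- by move: d; rewrite /derivable E.
- by move: e; rewrite /derive E.
- by rewrite /derivable E.
- by rewrite /derive E.
- by move: d; rewrite /derivable E.
- by move: e; rewrite /derive E.
Qed.

(** The function is recovered by integrating its partial derivatives along an
    L-shaped path, and these integrals depend continuously on the end point. *)
Lemma pder_cont f (df : bool -> R * R -> R) :
  (forall b p, pder b f p (df b p)) -> (forall b, continuous (df b)) -> continuous f.
Proof.
move=> dfE cdf; have c1 := cdf true; have c2 := cdf false.
have -> : f = (fun p => f (0, 0) + oint (fun s => df true (s, 0)) 0 p.1 +
                        oint (fun s => df false (p.1, s)) 0 p.2).
  apply/funext => -[x y] /=.
  rewrite (FTCT 0 x _ (F := fun s => f (s, 0)) (fun s => dfE true (s, 0))); last by cont.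
  rewrite (FTCT 0 y _ (F := fun s => f (x, s)) (fun s => dfE false (x, s))); last by cont.
  lra.
apply: contD; first apply: contD; first exact: cont_cst.
  by apply: cont_oint; cont.
by apply: cont_oint; cont.
Qed.

Lemma pder_line f (df : bool -> R * R -> R) p (w : R * R) :
  (\forall q \near p, forall b, pder b f q (df b q)) ->
  (forall b, {for p, continuous (df b)}) ->
  is_derive p w f (df true p * w.1 + df false p * w.2).
Proof.
move=> dfE cdf.
pose c1 t : R := p.1 + t * w.1; pose c2 t : R := p.2 + t * w.2.
have pE : p = (c1 0, c2 0) by rewrite /c1 /c2 !mul0r !addr0 -surjective_pairing.
have := @der_chain R f (df true) (df false) c1 c2 0 w.1 w.2.
rewrite /= -pE => /(_ _ (cdf true) (cdf false) (der_affine _ _ _) (der_affine _ _ _)) [].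
  by apply: filterS dfE => q dq; split; [exact: (dq true)|exact: (dq false)].
have E : (fun h : R => h^-1 *: ((f \o shift p) (h *: w) - f p)) =
    (fun h : R => h^-1 *: (((fun t => f (c1 t, c2 t)) \o shift 0) (h *: (1 : R)) - f (c1 0, c2 0))).
  apply/funext => h; rewrite -pE; congr (_ *: (_ - _)); rewrite /=; congr f.
  rewrite /c1 /c2 [LHS]surjective_pairing /= addr0; congr pair; rewrite addrC;
  by congr (_ + _); rewrite -[X in X = _]/(h * _) [h *: 1]mulr1.
by move=> d e; constructor; [rewrite /derivable E|rewrite /derive E].
Qed.

(** By the chain rule, continuous partial derivatives yield continuous derivatives
    in all directions, which is what a test function must have. *)
Lemma pder_test_function D K f (df : bool -> R * R -> R) :
  (forall b p, pder b f p (df b p)) -> (forall b, continuous (df b)) ->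
  compact K -> K `<=` D -> csupp K f ->
  test_function D f /\ forall b, 'D_(dir b) f = df b.
Proof.
move=> dfE cdf cK KD sf.
have d p w : is_derive p w f (df true p * w.1 + df false p * w.2).
  apply: pder_line => [|b]; last exact: cdf.
  by apply: (@filterS _ _ (nbhs_filter p) setT) => [q _ b|]; [exact: dfE|exact: filterT].
have sub : closure [set p | f p != 0] `<=` K.
  have /closure_id KE := compact_closed2 cK.
  rewrite KE; apply: closure_subset => p /= /eqP fp0.
  by apply: contrapT => /sf.
split; [split|] => [p w|w|||b].
- by have [] := d p w.
- have -> : 'D_w f = fun p => df true p * w.1 + df false p * w.2.
    by apply/funext => p; have [_] := d p w.
  have c1 := cdf true; have c2 := cdf false; cont.
- by apply: (subclosed_compact _ cK sub); exact: closed_closure.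
- by move=> p /sub /KD.
apply/funext => p; have [_ ->] := d p (dir b).
by case: b; rewrite /= ?mulr0 ?mulr1 ?addr0 ?add0r.
Qed.

Lemma test_function_pder D f : test_function D f ->
  [/\ forall b p, pder b f p ('D_(dir b) f p), forall b, continuous ('D_(dir b) f),
   continuous f & exists K, [/\ compact K, K `<=` D, csupp K f & forall b, csupp K ('D_(dir b) f)]].
Proof.
move=> [dv cD cS SD].
have dp b p : pder b f p ('D_(dir b) f p) by apply/pderP; exact: derivableP.
split => //.
  exact: (@pder_cont f (fun b => 'D_(dir b) f)).
exists (closure [set p | f p != 0]); split => //.
  by move=> p Np; apply: contrapT => /eqP fp; apply: Np; exact: subset_closure.
move=> b p Np.
have N : nbhs p (~` closure [set p | f p != 0]).
  by apply: open_nbhs_nbhs; split => //; apply: closed_openC; exact: closed_closure.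
rewrite (@near_eq_derive _ _ _ f (cst 0)).
- exact: derive_cst.
- apply: filterS N => q Nq; rewrite /cst; apply: contrapT => fq; apply: Nq; apply: subset_closure; exact/eqP.
Qed.

End Compact.

(** * Pairing locally integrable functions with continuous ones *)

Section Pairing.
Context {R : realType}.
Variable D : set (R * R).
Implicit Types (K : set (R * R)) (f k F : R * R -> R) (b : bool).

Definition L1loc F := forall K, compact K -> K `<=` D -> leb2.-integrable K (EFin \o F).

Definition pairing F k : R := \int[leb2]_p (F p * k p).

Lemma cont_L1loc f : continuous f -> L1loc f.
Proof.
move=> cf K cK _; have [N N0 KN] := compact_sub_box cK.
apply: integrableS (cont_integrable_box N cf) => //.
- exact: measurable_box.
- exact: compact_measurable2.
Qed.

Lemma pairing_integrable K F k : compact K -> K `<=` D -> L1loc F ->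
  continuous k -> csupp K k -> leb2.-integrable setT (EFin \o (fun p => F p * k p)).
Proof.
move=> cK KD LF ck sk; have mK := compact_measurable2 cK.
have : leb2.-integrable K (EFin \o (fun p => F p * k p)).
  have := integrableMl mK (LF K cK KD) (measurable_funTS (cont_measurable ck)) _.
  apply; have [M M0 HM] := cont_bounded cK ck.
  by exists M; split; [exact: num_real|move=> x Mx p Kp; apply: le_trans (HM p Kp) (ltW Mx)].
rewrite [X in X -> _]integrable_mkcond// (_ : _ \_ _ = EFin \o (fun p => F p * k p))//.
apply/funext => p; rewrite patchE; case: ifPn => // /negP; rewrite inE => /sk /= ->.
by rewrite mulr0.
Qed.

Lemma pairing_D K F k : K `<=` D -> csupp K k ->
  \int[leb2]_(p in D) (F p * k p) = pairing F k.
Proof.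
move=> KD sk; rewrite Rintegral_mkcond; apply: eq_Rintegral => p _; rewrite patchE.
case: ifPn => // /negP; rewrite inE => Dp; rewrite sk ?mulr0// => /KD; exact: Dp.
Qed.

Lemma pairingDr K F k1 k2 : compact K -> K `<=` D -> L1loc F ->
  continuous k1 -> csupp K k1 -> continuous k2 -> csupp K k2 ->
  pairing F (fun p => k1 p + k2 p) = pairing F k1 + pairing F k2.
Proof.
move=> cK KD LF c1 s1 c2 s2; rewrite /pairing -RintegralD//; try exact: pairing_integrable s1 || exact: pairing_integrable s2.
by congr Rintegral; apply/funext => p; rewrite mulrDr.
Qed.

Lemma pairingDl K F1 F2 k : compact K -> K `<=` D -> L1loc F1 -> L1loc F2 ->
  continuous k -> csupp K k ->
  pairing (fun p => F1 p + F2 p) k = pairing F1 k + pairing F2 k.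
Proof.
move=> cK KD L1 L2 ck sk; rewrite /pairing -RintegralD//; try exact: pairing_integrable sk.
by congr Rintegral; apply/funext => p; rewrite mulrDl.
Qed.

Lemma pairingZr K F k (c : R) : compact K -> K `<=` D -> L1loc F ->
  continuous k -> csupp K k ->
  pairing F (fun p => c * k p) = c * pairing F k.
Proof.
move=> cK KD LF ck sk; rewrite /pairing -RintegralZl//; last exact: pairing_integrable sk.
by congr Rintegral; apply/funext => p; rewrite mulrCA.
Qed.

Lemma pairing_mul f F k : pairing (fun p => f p * F p) k = pairing F (fun p => f p * k p).
Proof. by congr Rintegral; apply/funext => p; rewrite mulrCA mulrA. Qed.

(** Limits in weak laws are taken in this sense: uniformly, with all supports in
    one compact set. *)
Lemma pairing_close K F : compact K -> K `<=` D -> L1loc F ->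
  exists2 C, 0 <= C & forall k1 k2 e, continuous k1 -> csupp K k1 -> continuous k2 -> csupp K k2 ->
   (forall p, `|k1 p - k2 p| <= e) -> `|pairing F k1 - pairing F k2| <= C * e.
Proof.
move=> cK KD LF; have mK := compact_measurable2 cK.
exists (\int[leb2]_(p in K) `|F p|); first by apply: Rintegral_ge0.
move=> k1 k2 e c1 s1 c2 s2 He.
have i1 := pairing_integrable cK KD LF c1 s1.
have i2 := pairing_integrable cK KD LF c2 s2.
rewrite /pairing -RintegralB//.
have -> : \int[leb2]_p (F p * k1 p - F p * k2 p) = \int[leb2]_(p in K) (F p * k1 p - F p * k2 p).
  rewrite [RHS]Rintegral_mkcond; apply: eq_Rintegral => p _; rewrite patchE.
  by case: ifPn => // /negP; rewrite inE => nK; rewrite s1// s2// !mulr0 subr0.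
have i12 : leb2.-integrable K (EFin \o (fun p => F p * k1 p - F p * k2 p)).
  apply: integrableS (integrableB _ i1 i2) => //.
have iF : leb2.-integrable K (EFin \o (fun p => `|F p|)) by exact: integrable_norm (LF K cK KD).
apply: le_trans (le_normr_Rintegral mK i12) _.
rewrite -RintegralZr//; apply: le_Rintegral => //.
- exact: integrable_norm.
- by have := integrableZr mK e iF; apply: eq_integrable.
- move=> p Kp; rewrite -mulrBr normrM; apply: ler_wpM2l => //.
Qed.

Lemma L1locD F1 F2 : L1loc F1 -> L1loc F2 -> L1loc (fun p => F1 p + F2 p).
Proof.
move=> L1 L2 K cK KD; have mK := compact_measurable2 cK.
by have := integrableD mK (L1 K cK KD) (L2 K cK KD); apply: eq_integrable.
Qed.

Lemma L1locM f F : continuous f -> L1loc F -> L1loc (fun p => f p * F p).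
Proof.
move=> cf LF K cK KD; have mK := compact_measurable2 cK.
have := integrableMr mK (measurable_funTS (cont_measurable cf)) _ (LF K cK KD).
apply; have [M M0 HM] := cont_bounded cK cf.
by exists M; split; [exact: num_real|move=> x Mx p Kp; apply: le_trans (HM p Kp) (ltW Mx)].
Qed.

End Pairing.

Section Quotients.
Context {R : realType}.
Implicit Types (K : set (R * R)) (f k F : R * R -> R) (b : bool).

(** Translation invariance of the plane integral, through iterated integrals over
    a box large enough to contain both supports. *)
Lemma pairing_sh K b f k s : compact K -> continuous f -> continuous k -> csupp K k ->
  pairing f (fun p => k (sh b s p)) = pairing (fun p => f (sh b (- s) p)) k.
Proof.
move=> cK cf ck sk.
have [N N0 KN] := compact_sub_box cK.
pose G p := f (sh b (- s) p) * k p.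
have cG : continuous G by apply: contM => //; exact: cont_comp cf (@sh_cont1 _ b (- s)).
have G0 p : ~ box N p -> G p = 0.
  by move=> Np; rewrite /G sk ?mulr0// => /KN.
pose N' := N + `|s|; have s0 : 0 <= `|s| by [].
have NN' : N <= N' by rewrite /N'; lra.
have [sl sr] : - `|s| <= s /\ s <= `|s| by move: (ler_norm s) (ler_norm (- s)); rewrite normrN; split; lra.
have N'0 : 0 <= N' by lra.
have mono p : box N p -> box N' p.
  by move=> /boxP[h1 h2]; apply/boxP; split; apply: le_trans NN'.
have G0' p : ~ box N' p -> G p = 0 by move=> Np; apply: G0 => /mono.
have E p : f p * k (sh b s p) = G (sh b s p) by rewrite /G shD subrr sh0.
rewrite /pairing -/G; under eq_Rintegral do rewrite E.
have cG2 : continuous (fun p => G (sh b s p)) by exact: cont_comp cG (@sh_cont1 _ b s).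
have GS p : ~ box N' p -> G (sh b s p) = 0.
  move=> Np; apply: G0 => /boxP B; apply: Np; apply/boxP; move: B; rewrite /N' /sh.
  case: (b) => /= -[]; rewrite !ler_norml => /andP[? ?] /andP[? ?];
    by split; apply/andP; split; lra.
rewrite (fubini_oint N'0 cG2 GS) (fubini_oint N'0 cG G0').
have Z (g : R -> R) x y : continuous g -> (forall x, ~ `|x| <= N -> g x = 0) ->
    x <= - N -> N <= y -> oint g x y = \int[lebesgue_measure]_x g x.
  move=> cg g0 xN Ny; apply/esym/Rintegral_itv_supp => //; first lra.
  move=> t h; apply: g0; rewrite ler_norml => /andP[h1 h2].
  by apply: h; rewrite (le_trans xN h1) (le_trans h2 Ny).
have outx (x : R) : ~ `|x| <= N -> oint (fun y => G (x, y)) (- N') N' = 0.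
  by move=> hx; apply: oint_eq0; [cont|move=> y _; apply: G0 => /boxP[]|lra].
rewrite /sh; case: (b) => /=.
  have cI : continuous (fun x => oint (fun y => G (x, y)) (- N') N').
    by apply: cont_oint; cont.
  rewrite (oint_shift (f := fun x => oint (fun y => G (x, y)) (- N') N'))//.
  by rewrite !Z//; rewrite /N'; lra.
apply: congr_oint => x.
have cGx : continuous (fun y => G (x, y)) by cont.
rewrite (oint_shift (f := fun y => G (x, y)))// !Z//; try (rewrite /N'; lra);
  by move=> y hy; apply: G0 => /boxP[].
Qed.

Definition quot b (h : R) f p : R := h^-1 * (f (sh b h p) - f p).

Lemma quot_cont b h f : continuous f -> continuous (quot b h f).
Proof.
move=> cf; apply: contM; first exact: cont_cst.
by apply: contD; [exact: cont_comp cf (@sh_cont1 _ b h)|exact: contN].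
Qed.

Lemma sh_supp K b h r k : csupp K k -> `|h| <= r -> csupp (thick K r) (fun p => k (sh b h p)).
Proof. by move=> sk hr p Np; apply: sk => Kp; apply: Np; exact: sh_thick Kp. Qed.

Lemma thick_supp K r k : 0 <= r -> csupp K k -> csupp (thick K r) k.
Proof. by move=> r0 s p Np; apply: s => /(sub_thick r0). Qed.

Lemma quot_supp K b h r k : csupp K k -> `|h| <= r -> csupp (thick K r) (quot b h k).
Proof.
move=> sk hr p Np; rewrite /quot (sh_supp b sk hr)// (@thick_supp K r) ?subrr ?mulr0//.
exact: le_trans hr.
Qed.

Lemma pairing_quot b h K f k : compact K -> continuous f -> continuous k -> csupp K k ->
  pairing (quot b h f) k = - pairing f (quot b (- h) k).
Proof.
move=> cK cf ck sk.
have cK' := @compact_thick R _ `|h| cK.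
have h0 : 0 <= `|h| by [].
have sk' := thick_supp h0 sk.
have hh : `|- h| <= `|h| by rewrite normrN.
have cs : continuous (fun p => k (sh b (- h) p)) by exact: cont_comp ck (@sh_cont1 _ b (- h)).
have ss := sh_supp b sk hh.
have cfs : continuous (fun p => f (sh b h p)) by exact: cont_comp cf (@sh_cont1 _ b h).
have cZ (c : R) (g : R * R -> R) : continuous g -> continuous (fun p => c * g p).
  by move=> cg; apply: contM => //; exact: cont_cst.
have sZ (c : R) (g : R * R -> R) : csupp (thick K `|h|) g -> csupp (thick K `|h|) (fun p => c * g p).
  by move=> sg p Np; rewrite sg// mulr0.
have L (g : R * R -> R) : continuous g -> L1loc setT g by exact: cont_L1loc.
have E1 : quot b h f = (fun p => h^-1 * f (sh b h p) + (- h^-1) * f p).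
  by apply/funext => p; rewrite /quot mulrBr mulNr.
have E2 : quot b (- h) k = (fun p => (- h)^-1 * k (sh b (- h) p) + h^-1 * k p).
  by apply/funext => p; rewrite /quot mulrBr invrN !mulNr opprK.
have ZT := @subsetT _ (thick K `|h|); have KT := @subsetT _ K.
have E3 (c : R) (g : R * R -> R) : continuous g -> pairing (fun p => c * g p) k = c * pairing g k.
  by move=> cg; rewrite pairing_mul (pairingZr _ cK KT (L _ cg) ck sk).
rewrite E1 (pairingDl cK KT (L _ (cZ _ _ cfs)) (L _ (cZ _ _ cf)) ck sk).
rewrite E2 (pairingDr cK' ZT (L _ cf) (cZ _ _ cs) (sZ _ _ ss) (cZ _ _ ck) (sZ _ _ sk')).
rewrite (pairingZr _ cK' ZT (L _ cf) cs ss) (pairingZr _ cK' ZT (L _ cf) ck sk').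
rewrite (@pairing_sh K b f k (- h))// opprK !E3// invrN.
by move: (pairing _ _) (pairing f k) => x y; lra.
Qed.

End Quotients.

(** * Weak derivatives of continuous functions *)

Section Weak.
Context {R : realType}.
Variables (D : set (R * R)) (oD : open D).
Implicit Types (K : set (R * R)) (f k F : R * R -> R) (b : bool).
Notation L1loc := (L1loc D).

Definition wder b f F := forall phi, test_function D phi ->
  pairing f ('D_(dir b) phi) = - pairing F phi.

(** A difference quotient of [f] is the average of its weak derivative. As [k] is
    merely continuous, [Av b (- h) k] need not be a test function; averaging once
    more over a length [s] along the other axis makes it one, and [s] tends to [0]. *)
Lemma weak_quotient b f F : continuous f -> L1loc F -> wder b f F ->
  forall K, compact K -> K `<=` D -> exists2 r, 0 < r & forall h k, h != 0 -> `|h| <= r ->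
  continuous k -> csupp K k ->
  pairing (quot b h f) k = pairing F (Av b (- h) k).
Proof.
move=> cf LF wf K cK KD.
have [r r0 Hr] := thick_sub cK oD KD.
have cK1 := @compact_thick R _ (r / 2) cK.
have cK2 := @compact_thick R _ (r / 2) cK1.
have K2D : thick (thick K (r / 2)) (r / 2) `<=` D.
  move=> p [q [q' Kq' /boxP/= [h1 h2]] /boxP/= [h3 h4]]; apply: Hr; exists q' => //.
  apply/boxP => /=; move: h1 h2 h3 h4; rewrite !ler_norml.
  by move=> /andP[? ?] /andP[? ?] /andP[? ?] /andP[? ?]; split; apply/andP; split; lra.
have r2 : 0 <= r / 2 by lra.
set K2 := thick (thick K (r / 2)) (r / 2) in cK2 K2D *.
have K1K2 : thick K (r / 2) `<=` K2 by exact: sub_thick.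
exists (r / 2); first lra.
move=> h k h0 hr ck sk.
have h'0 : - h != 0 by rewrite oppr_eq0.
have hr' : `|- h| <= r / 2 by rewrite normrN.
have sup2 k' : csupp (thick K (r / 2)) k' -> csupp K2 k'.
  by move=> s p Np; apply: s => /K1K2.
pose q := quot b (- h).
have cq k' : continuous k' -> continuous (q k') by exact: quot_cont.
have sq K' k' : csupp K' k' -> csupp (thick K' (r / 2)) (q k').
  by move=> s; exact: quot_supp.
rewrite (pairing_quot b h cK cf ck sk) -/q.
have sA k' K' : continuous k' -> csupp K' k' -> csupp (thick K' (r / 2)) (Av b (- h) k').
  by move=> c' s'; exact: Av_supp s' hr'.
have cA k' : continuous k' -> continuous (Av b (- h) k') by exact: Av_cont.
have [C1 C10 H1] := pairing_close cK2 K2D (cont_L1loc cf).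
have [C2 C20 H2] := pairing_close cK2 K2D LF.
have sqk := sq _ _ sk; have cqk := cq _ ck.
have sAk := sA _ _ ck sk; have cAk := cA _ ck.
apply: (@eq_eps _ _ _ (C1 + C2)) => e e0.
have [r1 r10 U1] := Av_unif (~~ b) cK1 cqk sqk e0.
have [r3 r30 U2] := Av_unif (~~ b) cK1 cAk sAk e0.
pose s := Num.min (r / 2) (Num.min r1 r3).
have s0 : 0 < s by rewrite /s !lt_min r10 r30 andbT; lra.
have ss : `|s| = s by rewrite gtr0_norm.
have sr : `|s| <= r / 2 by rewrite ss /s ge_min lexx.
have sr1 : `|s| <= r1 by rewrite ss /s !ge_min lexx !orbT.
have sr3 : `|s| <= r3 by rewrite ss /s !ge_min lexx !orbT.
have cM : continuous (Av (~~ b) s k) by exact: Av_cont.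
have sM : csupp (thick K (r / 2)) (Av (~~ b) s k) by exact: Av_supp sk sr.
pose T := Av b (- h) (Av (~~ b) s k).
pose dT b' := if b' == b then q (Av (~~ b) s k)
  else (fun p => s^-1 * (Av b (- h) k (sh (~~ b) s p) - Av b (- h) k p)).
have [tT DT] : test_function D T /\ forall b', 'D_(dir b') T = dT b'.
  apply: (@pder_test_function _ D K2) => //.
  - move=> b' p; rewrite /dT; case: eqP => [->|/eqP bb]; first exact: Av_der.
    have -> : b' = ~~ b by case: b b' bb {q cq sq sA cA sqk cqk sAk cAk U1 U2 cM sM T dT wf} => -[].
    rewrite /T Av_swap//; apply: Av_der => //; by rewrite gt_eqF.
  - move=> b'; rewrite /dT; case: ifP => _; first exact: cq.
    apply: contM; first exact: cont_cst.
    by apply: contD; [exact: cont_comp cAk (@sh_cont1 _ (~~ b) s)|exact: contN].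
  - exact: sA.
have wT := wf T tT; rewrite DT /dT eqxx in wT.
have qA : q (Av (~~ b) s k) = Av (~~ b) s (q k).
  apply/funext => p; rewrite /q /quot /Av -ointB; [|exact: Av_contt|exact: Av_contt].
  rewrite -ointZ; last by apply: contD; [|apply: contN]; exact: Av_contt.
  apply: congr_oint => t.
  by rewrite /sh; case: (b).
have A1 : `|pairing f (q (Av (~~ b) s k)) - pairing f (q k)| <= C1 * e.
  apply: H1 => //; [exact: cq|by apply: sq|exact: sup2|].
  by move=> p; rewrite qA; apply: U1.
have A2 : `|pairing F T - pairing F (Av b (- h) k)| <= C2 * e.
  apply: H2 => //; [exact: cA|exact: sA|exact: sup2|].
  by move=> p; rewrite /T Av_swap//; apply: U2.
have -> : - pairing f (q k) - pairing F (Av b (- h) k) =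
  (pairing f (q (Av (~~ b) s k)) - pairing f (q k)) + (pairing F T - pairing F (Av b (- h) k)).
  rewrite wT; move: (pairing F T) (pairing f (q k)) (pairing F _) => x y z; lra.
by apply: le_trans (ler_normD _ _) _; rewrite mulrDl; exact: lerD.
Qed.

End Weak.

Lemma quotient_error_split {R : realType} (x1 x2 x3 x4 x5 y : R) : y = - (x2 + x3) ->
  x1 - - (x4 + x5) = - (y - x1) - (x2 - x4) - (x3 - x5).
Proof. lra. Qed.

Lemma triangle3 {R : realType} (x y z A B C : R) :
  `|x| <= A -> `|y| <= B -> `|z| <= C -> `|- x - y - z| <= A + B + C.
Proof.
by rewrite !ler_norml => /andP[? ?] /andP[? ?] /andP[? ?]; apply/andP; split; lra.
Qed.

Section Product.
Context {R : realType}.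
Variables (D : set (R * R)) (oD : open D).
Implicit Types (K : set (R * R)) (f g k F G : R * R -> R) (b : bool).

Notation L1loc := (L1loc D).
Notation wder := (wder D).

Lemma wderD b f g F G : continuous f -> continuous g -> L1loc F -> L1loc G ->
  wder b f F -> wder b g G -> wder b (fun p => f p + g p) (fun p => F p + G p).
Proof.
move=> cf cg LF LG wf wg phi tphi.
have [_ cd cphi [K [cK KD sphi sd]]] := test_function_pder tphi.
rewrite (pairingDl cK KD (cont_L1loc cf) (cont_L1loc cg) (cd b) (sd b)).
rewrite (pairingDl cK KD LF LG cphi sphi) wf// wg//; lra.
Qed.

Lemma test_function_mul f phi (df : bool -> R * R -> R) : test_function D phi ->
  (forall b p, pder b f p (df b p)) -> (forall b, continuous (df b)) ->
  test_function D (fun p => f p * phi p) /\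
  forall b, 'D_(dir b) (fun p => f p * phi p) = (fun p => f p * 'D_(dir b) phi p + phi p * df b p).
Proof.
move=> tphi dfE cdf.
have [dphi cd cphi [K' [cK KD sphi sd]]] := test_function_pder tphi.
have cf := pder_cont dfE cdf.
apply: (@pder_test_function _ D K' _ (fun b p => f p * 'D_(dir b) phi p + phi p * df b p)) => //.
- by move=> [] p; have := dfE _ p; have := dphi _ p; rewrite /pder => d1 d2;
    [have := derM (d2 true) (d1 true)|have := derM (d2 false) (d1 false)]; rewrite -!surjective_pairing.
- by move=> b; have := cd b; have := cdf b => ? ?; cont.
- by move=> p Np; rewrite sphi// mulr0.
Qed.

Lemma Av_oint b (h : R) k p : continuous k ->
  h * Av b h k p = oint (fun s => k (sh b s p)) 0 h.
Proof.
move=> ck.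
have cl : continuous (fun s => k (sh b s p)).
  apply: (cont_comp ck).
  by apply: (cont_comp (g := fun s : R => (p, s)) (@sh_cont R b)); cont.
rewrite (oint_affine 0 h cl) subr0; congr (_ * _).
by apply: congr_oint => t; rewrite add0r.
Qed.

(** A difference quotient of a test function is the average of its derivative. *)
Lemma sh_quotient_unif b phi : test_function D phi -> forall e, 0 < e ->
  exists2 r, 0 < r & forall h p, h != 0 -> `|h| <= r ->
   `|h^-1 * (phi (sh b h p) - phi p) - 'D_(dir b) phi p| <= e.
Proof.
move=> tphi e e0; have [dphi cd cphi [K [cK KD sphi sd]]] := test_function_pder tphi.
have [r r0 Hr] := Av_unif b cK (cd b) (sd b) e0.
exists r => // h p h0 hr; have := Hr h p hr.
suff -> : Av b h ('D_(dir b) phi) p = h^-1 * (phi (sh b h p) - phi p) by [].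
have cl : continuous (fun s => 'D_(dir b) phi (sh b s p)).
  apply: (cont_comp (cd b)).
  by apply: (cont_comp (g := fun s : R => (p, s)) (@sh_cont R b)); cont.
have dl s : is_derive s (1 : R) (fun s => phi (sh b s p)) ('D_(dir b) phi (sh b s p)).
  have := dphi b (sh b s p); case: (b); rewrite /pder /sh /= => d; rewrite -[X in is_derive _ _ _ X]mulr1.
    apply: (der_comp (F := fun x => phi (x, p.2)) (G := fun s => p.1 + s)) => //.
    by have := derD (der_cst p.1 s) (der_id s); rewrite add0r.
  apply: (der_comp (F := fun x => phi (p.1, x)) (G := fun s => p.2 + s)) => //.
  by have := derD (der_cst p.2 s) (der_id s); rewrite add0r.
rewrite -[LHS](mulKf h0); congr (_ * _).
by rewrite Av_oint// (FTCT 0 h cl dl) sh0.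
Qed.

(** The derivative is a uniform limit of difference quotients, whose integrals
    vanish by translation invariance. *)
Lemma pairing1_der b phi : test_function D phi -> pairing (fun=> 1) ('D_(dir b) phi) = 0.
Proof.
move=> tphi; have [dphi cd cphi [K [cK KD sphi sd]]] := test_function_pder tphi.
have c1 : continuous (fun _ : R * R => 1 : R) by exact: cont_cst.
have [r1 r10 Hr1] := thick_sub cK oD KD.
have cK1 := @compact_thick R _ r1 cK.
have KK1 : K `<=` thick K r1 by apply: sub_thick; exact: ltW.
have sub1 k : csupp K k -> csupp (thick K r1) k by move=> s p Np; apply: s => /KK1.
have [C C0 HC] := pairing_close cK1 Hr1 (cont_L1loc c1).
apply: (@eq_eps _ _ _ C) => e e0.
have [r r0 Hr] := sh_quotient_unif b tphi e0.
pose h := Num.min r r1; have h0 : 0 < h by rewrite lt_min r0 r10.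
have hr : `|h| <= r by rewrite gtr0_norm// ge_min lexx.
have hr1 : `|h| <= r1 by rewrite gtr0_norm// ge_min lexx orbT.
have cs : continuous (fun p => phi (sh b h p)) by exact: cont_comp cphi (@sh_cont1 _ b h).
have ss : csupp (thick K r1) (fun p => phi (sh b h p)).
  by move=> p Np; apply: sphi => Kp; apply: Np; exact: sh_thick Kp.
pose q p := h^-1 * (phi (sh b h p) + - phi p).
have cN : continuous (fun p => - phi p) by exact: contN.
have sN : csupp (thick K r1) (fun p => - phi p) by move=> p Np; rewrite (sub1 _ sphi)// oppr0.
have q0 : pairing (fun=> 1) q = 0.
  rewrite /q (pairingZr _ cK1 Hr1 (cont_L1loc c1)).
  - rewrite (pairingDr cK1 Hr1 (cont_L1loc c1) cs ss cN sN).
    rewrite (@pairing_sh _ K b _ phi h)//.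
    have -> : (fun p => - phi p) = (fun p => (-1) * phi p) by apply/funext => p; lra.
    rewrite (pairingZr _ cK1 Hr1 (cont_L1loc c1) cphi (sub1 _ sphi)); lra.
  - exact: contD.
  - by move=> p Np; rewrite ss// sN// addr0.
rewrite -[X in _ - X]q0 distrC; apply: HC.
- by apply: contM; [exact: cont_cst|exact: contD].
- by move=> p Np; rewrite /q ss// sN// addr0 mulr0.
- exact: cd.
- exact: sub1 (sd b).
- by move=> p; apply: Hr => //; rewrite gt_eqF.
Qed.

(** The product of a [C^1] function and a test function is a test function, the
    derivative of which has zero integral. *)
Lemma wder_C1 b f (df : bool -> R * R -> R) :
  (forall b p, pder b f p (df b p)) -> (forall b, continuous (df b)) -> wder b f (df b).
Proof.
move=> dfE cdf phi tphi; have cf := pder_cont dfE cdf.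
have [t E] := test_function_mul tphi dfE cdf.
have [dphi cd cphi [K [cK KD sphi sd]]] := test_function_pder tphi.
have c1 : continuous (fun _ : R * R => 1 : R) by exact: cont_cst.
have cdb := cd b; have cdfb := cdf b.
have k1c : continuous (fun p => f p * 'D_(dir b) phi p) by cont.
have k2c : continuous (fun p => phi p * df b p) by cont.
have k1s : csupp K (fun p => f p * 'D_(dir b) phi p) by move=> p Np; rewrite sd// mulr0.
have k2s : csupp K (fun p => phi p * df b p) by move=> p Np; rewrite sphi// mul0r.
have := pairing1_der b t; rewrite E (pairingDr cK KD (cont_L1loc c1) k1c k1s k2c k2s).
have -> : pairing f ('D_(dir b) phi) = pairing (fun=> 1) (fun p => f p * 'D_(dir b) phi p).
  by congr Rintegral; apply/funext => p; rewrite mul1r.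
have -> : pairing (df b) phi = pairing (fun=> 1) (fun p => phi p * df b p).
  by congr Rintegral; apply/funext => p; rewrite mul1r mulrC.
by move: (pairing _ _) (pairing _ _) => x y; lra.
Qed.

(** The difference quotient of [f g] obeys the discrete product rule. By
    [weak_quotient] the quotients of [f] and of [g] become averages acting on the
    test side, where everything converges uniformly as [h] tends to [0]: the
    weak derivatives themselves are never approximated. *)
Lemma wderM b f g F G : continuous f -> continuous g -> L1loc F -> L1loc G ->
  wder b f F -> wder b g G ->
  wder b (fun p => f p * g p) (fun p => g p * F p + f p * G p).
Proof.
move=> cf cg LF LG wf wg phi tphi.
have [dphi cd cphi [K [cK KD sphi sd]]] := test_function_pder tphi.
have [r1 r10 Hr1] := thick_sub cK oD KD.
have cK1 := @compact_thick R _ r1 cK.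
have r1' := ltW r10.
have sub1 k := @thick_supp R K r1 k r1'.
have cdb := cd b; have sdb := sd b.
have cfg : continuous (fun p => f p * g p) by cont.
have cgp : continuous (fun p => g p * phi p) by cont.
have sgp : csupp K (fun p => g p * phi p) by move=> p Np; rewrite sphi// mulr0.
have cfp : continuous (fun p => f p * phi p) by cont.
have sfp : csupp K (fun p => f p * phi p) by move=> p Np; rewrite sphi// mulr0.
rewrite (pairingDl cK KD (L1locM cg LF) (L1locM cf LG) cphi sphi).
rewrite (pairing_mul g F) (pairing_mul f G).
have [Cfg Cfg0 Hfg] := pairing_close cK1 Hr1 (cont_L1loc cfg).
have [CF CF0 HF] := pairing_close cK1 Hr1 LF.
have [CG CG0 HG] := pairing_close cK1 Hr1 LG.
have [rf rf0 Qf] := weak_quotient oD cf LF wf cK KD.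
have [rg rg0 Qg] := weak_quotient oD cg LG wg cK KD.
have [M M0 HM] := cont_bounded cK cphi.
have HM' p : `|phi p| <= M.
  by have [/HM//|/sphi ->] := pselect (K p); rewrite normr0 ltW.
apply: (@eq_eps _ _ _ (Cfg + CF + CG * (M + 1))) => e e0.
have [r2 r20 H2] := sh_quotient_unif b tphi e0.
have [r3 r30 H3] := Av_unif b cK cgp sgp e0.
have [r4 r40 H4] := Av_unif b cK cfp sfp e0.
have [r5 r50 H5] := unif_sh b cK cf e0.
have [h h0 [hr1 hrf hrg hr2 [hr3 hr4 hr5]]] : exists2 h, 0 < h &
    [/\ h <= r1, h <= rf, h <= rg, h <= r2 & [/\ h <= r3, h <= r4 & h <= r5]].
  exists (Num.min r1 (Num.min rf (Num.min rg (Num.min r2 (Num.min r3 (Num.min r4 r5)))))).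
    by rewrite !lt_min r10 rf0 rg0 r20 r30 r40 r50.
  by rewrite !ge_min !lexx !orbT.
have hn0 : h != 0 by rewrite gt_eqF.
have hN0 : - h != 0 by rewrite oppr_eq0.
have hh : `|h| = h by rewrite gtr0_norm.
have hN : `|- h| = h by rewrite normrN.
have cqp : continuous (quot b (- h) phi) by exact: quot_cont.
have sqp : csupp (thick K r1) (quot b (- h) phi) by apply: quot_supp => //; rewrite hN.
have cfs : continuous (fun p => f (sh b h p)) by exact: cont_comp cf (@sh_cont1 _ b h).
have cfsp : continuous (fun p => f (sh b h p) * phi p) by cont.
have sfsp : csupp K (fun p => f (sh b h p) * phi p) by move=> p Np; rewrite sphi// mulr0.
have cqf : continuous (quot b h f) by exact: quot_cont.
have cqg : continuous (quot b h g) by exact: quot_cont.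
have main : pairing (fun p => f p * g p) (quot b (- h) phi) =
   - (pairing F (Av b (- h) (fun p => g p * phi p)) +
      pairing G (Av b (- h) (fun p => f (sh b h p) * phi p))).
  rewrite -[LHS]opprK -(pairing_quot b h cK cfg cphi sphi); congr (- _).
  have -> : quot b h (fun p => f p * g p) =
      (fun p => g p * quot b h f p + f (sh b h p) * quot b h g p).
    by apply/funext => p; rewrite /quot; ring.
  have c1 : continuous (fun p => g p * quot b h f p) by cont.
  have c2 : continuous (fun p => f (sh b h p) * quot b h g p) by cont.
  rewrite (pairingDl cK KD (cont_L1loc c1) (cont_L1loc c2) cphi sphi).
  rewrite (pairing_mul g (quot b h f)) (pairing_mul (fun p => f (sh b h p)) (quot b h g)).
  by rewrite Qf ?hh// Qg ?hh.
have B1 : `|pairing (fun p => f p * g p) (quot b (- h) phi) -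
            pairing (fun p => f p * g p) ('D_(dir b) phi)| <= Cfg * e.
  apply: Hfg => //; [exact: sub1|].
  by move=> p; apply: H2; rewrite ?hN.
have sA k : continuous k -> csupp K k -> csupp (thick K r1) (Av b (- h) k).
  by move=> ck sk; apply: Av_supp => //; rewrite hN.
have cA k : continuous k -> continuous (Av b (- h) k) by exact: Av_cont.
have B2 : `|pairing F (Av b (- h) (fun p => g p * phi p)) - pairing F (fun p => g p * phi p)| <= CF * e.
  apply: HF => //; [exact: cA|exact: sA|exact: sub1|].
  by move=> p; apply: H3; rewrite hN.
have B3 : `|pairing G (Av b (- h) (fun p => f (sh b h p) * phi p)) - pairing G (fun p => f p * phi p)|
    <= CG * (M * e + e).
  apply: HG => //; [exact: cA|exact: sA|exact: sub1|].
  move=> p; rewrite -(subrKA (Av b (- h) (fun p => f p * phi p) p)).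
  apply: le_trans (ler_normD _ _) _; apply: lerD; last by apply: H4; rewrite hN.
  apply: Av_close => // q; rewrite -mulrBl normrM mulrC.
  have [Kq|/sphi ->] := pselect (K q); last by rewrite normr0 mul0r mulr_ge0// ltW.
  by apply: ler_pM => //; apply: H5 => //; rewrite hh.
rewrite (quotient_error_split _ _ _ main).
apply: le_trans (triangle3 B1 B2 B3) _.
by rewrite !mulrDl -mulrA [(M + 1) * e]mulrDl mul1r.
Qed.

End Product.

(** * From weak laws to fluxes through rectangles *)

Section Rectangle.
Context {R : realType}.
Implicit Types (K L w : R -> R) (a b c d x y : R).

Definition bump a b (w dw : R -> R) := [/\ forall x, is_derive x (1 : R) w (dw x),
  continuous dw & forall x, ~ (a <= x <= b) -> w x = 0].

Lemma bump_cont a b w dw : bump a b w dw -> continuous w.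
Proof. by case=> H _ _; exact: der_cont H. Qed.

Lemma bump_end a b w dw : a < b -> bump a b w dw -> w a = 0 /\ w b = 0.
Proof.
move=> ab B; have cw := bump_cont B; case: B => _ _ w0.
have Ha x : a - 1 < x < a -> w x = 0.
  by move=> /andP[_ xa]; apply: w0 => /andP[ax _]; move: (lt_le_trans xa ax); rewrite ltxx.
have Hb x : b < x < b + 1 -> w x = 0.
  by move=> /andP[bx _]; apply: w0 => /andP[_ xb]; move: (lt_le_trans bx xb); rewrite ltxx.
have a1 : a - 1 < a by lra.
have b1 : b < b + 1 by lra.
by split; [apply: (cont_ext_closed cw a1 Ha)|apply: (cont_ext_closed cw b1 Hb)]; apply/andP; split; lra.
Qed.

Lemma bump_der0 a b w dw x : bump a b w dw -> ~ (a <= x <= b) -> dw x = 0.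
Proof.
move=> [dwE _ w0] h.
have near0 : \near x, cst 0 x = w x.
  have [xa|ax] := ltP x a.
    near=> y; rewrite w0// => /andP[ay _].
    have : y < a by near: y; exact: lt_nbhsl.
    by rewrite ltNge ay.
  have bx : b < x by rewrite ltNge; apply/negP => xb; apply: h; rewrite ax.
  near=> y; rewrite w0// => /andP[_ yb].
  have : b < y by near: y; exact: lt_nbhsr.
  by rewrite ltNge yb.
have d0 : is_derive x (1 : R) (cst 0 : R -> R) 0 by exact: der_cst.
by have [_ <-] := dwE x; have [_ ->] := near_eq_is_derive near0 d0.
Unshelve. all: by end_near. Qed.

(** With [W = K - int L] the hypothesis says that [int W w' = 0] for all [w]. Take
    [w' = q (W - u)], where [q > 0] inside the interval and [u] is the mean of [W]
    for the weight [q]: then [w] vanishes at both ends, and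
    [int q (W - u)^2 = int W w' - u int w' = 0] forces [W = u]. *)
Lemma du_Bois_Reymond K L a b : a < b -> continuous K -> continuous L ->
  (forall w dw, bump a b w dw -> oint (fun x => K x * dw x + L x * w x) a b = 0) ->
  forall x, a <= x <= b -> K x - K a = oint L a x.
Proof.
move=> ab cK cL H.
pose P := oint L a; have dP x : is_derive x (1 : R) P (L x) by exact: is_derive_oint.
have cP : continuous P by exact: der_cont dP.
pose W x := K x - P x; have cW : continuous W by apply: contD => //; exact: contN.
pose w x : R := Num.max 0 ((x - a) * (b - x)).
have cw : continuous w by rewrite /w; cont.
have w0 x : 0 <= w x by rewrite /w le_max lexx.
have wpos x : a < x < b -> 0 < w x.
  by move=> /andP[ax xb]; rewrite /w lt_max mulr_gt0 ?orbT// subr_gt0.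
have wout x : ~ (a < x < b) -> w x = 0.
  move=> h; rewrite /w; apply/max_idPl; have [xa|ax] := leP x a.
    by apply: mulr_le0_ge0; lra.
  have [xb|bx] := ltP x b; first by exfalso; apply: h; rewrite ax.
  by apply: mulr_ge0_le0; lra.
pose m := (a + b) / 2; have am : a < m < b by apply/andP; split; rewrite /m; lra.
have Iw : 0 < oint w a b.
  rewrite lt_neqAle (oint_ge0 cw (ltW ab) (fun x _ => w0 x)) andbT; apply/eqP => /esym I0.
  have := @oint_ge0_eq0 _ w a b cw ab (fun x _ => w0 x) I0 m.
  move=> wm; move: (wpos m am); rewrite wm ?ltxx//.
  by case/andP: am => ? ?; rewrite !ltW.
pose u := oint (fun x => w x * W x) a b / oint w a b.
pose dX x := w x * (W x - u).
have cdX : continuous dX by rewrite /dX; cont.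
pose X := oint dX a.
have dXE x : is_derive x (1 : R) X (dX x) by exact: is_derive_oint.
have cX : continuous X by exact: der_cont dXE.
have IdX : oint dX a b = 0.
  have -> : dX = (fun x => w x * W x - u * w x) by apply/funext => x; rewrite /dX; ring.
  rewrite ointB ?ointZ//; [|by cont|by cont].
  by rewrite /u divfK ?subrr// gt_eqF.
have BX : bump a b X dX.
  split => // x h; rewrite /X.
  have [xa|ax] := ltP x a.
    rewrite ointN (@oint_eq0 _ dX x a) ?oppr0 ?ltW// => y /andP[xy ya].
    by rewrite /dX wout ?mul0r// => /andP[/lt_le_trans/(_ ya)]; rewrite ltxx.
  have bx : b < x by rewrite ltNge; apply/negP => xb; apply: h; rewrite ax.
  rewrite -(oint_cat _ a b x) IdX add0r oint_eq0 ?ltW// => y /andP[by_ yx].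
  by rewrite /dX wout ?mul0r// => /andP[_ /(le_lt_trans by_)]; rewrite ltxx.
have := H X dX BX.
have -> : (fun x => K x * dX x + L x * X x) = (fun x => W x * dX x + (P x * dX x + X x * L x)).
  by apply/funext => x; rewrite /W; ring.
have cPX : continuous (fun x => P x * dX x + X x * L x) by cont.
rewrite ointD//; last by cont.
rewrite (@FTCT _ _ _ a b cPX (fun x => derM (dP x) (dXE x))).
have [Xa Xb] := bump_end ab BX; rewrite Xa Xb !mulr0 subrr addr0 => IW.
have I2 : oint (fun x => w x * (W x - u) ^+ 2) a b = 0.
  have -> : (fun x => w x * (W x - u) ^+ 2) = (fun x => W x * dX x - u * dX x).
    by apply/funext => x; rewrite /dX; ring.
  by rewrite ointB ?ointZ//; [rewrite IW IdX mulr0 subr0|cont|cont].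
have Z x : a < x < b -> W x - u = 0.
  move=> xab; have cc : continuous (fun x => w x * (W x - u) ^+ 2) by cont.
  have := oint_ge0_eq0 cc ab (fun x _ => mulr_ge0 (w0 x) (sqr_ge0 _)) I2.
  have xab' : a <= x <= b by case/andP: xab => ? ?; rewrite !ltW.
  move=> /(_ x xab')/eqP; rewrite mulf_eq0 (gt_eqF (wpos x xab))/= sqrf_eq0.
  by move=> /eqP.
have cWu : continuous (fun x => W x - u) by cont.
have Z' := cont_ext_closed cWu ab Z.
move=> x xab; have := Z' x xab; have := Z' a; rewrite lexx ltW// => /(_ isT).
rewrite /W /P ointaa; lra.
Qed.

(** For a fixed [z], du Bois-Reymond in [x] turns the weak law into an identity
    between integrals against [z] and [z']; du Bois-Reymond in [y] removes [z]. *)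
Lemma rectangle_flux (g1 g2 : R * R -> R) a b c d : a < b -> c < d ->
  continuous g1 -> continuous g2 ->
  (forall w dw z dz, bump a b w dw -> bump c d z dz ->
    oint (fun x => oint (fun y => g1 (x, y) * (dw x * z y) + g2 (x, y) * (w x * dz y)) c d) a b = 0) ->
  forall x y, a <= x <= b -> c <= y <= d ->
  oint (fun t => g1 (x, t) - g1 (a, t)) c y + oint (fun s => g2 (s, y) - g2 (s, c)) a x = 0.
Proof.
move=> ab cd c1 c2 H x y xab ycd.
have cs1 x' : continuous (fun y => g1 (x', y)) by cont.
have cs2 x' : continuous (fun y => g2 (x', y)) by cont.
have cs3 y' : continuous (fun x => g2 (x, y')) by cont.
pose J t := oint (fun s => g2 (s, t)) a x.
have cJ : continuous J by apply: cont_oint; cont.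
have step1 z dz : bump c d z dz ->
    oint (fun y => (g1 (x, y) - g1 (a, y)) * z y) c d = oint (fun y => J y * dz y) c d.
  move=> Bz; have cz := bump_cont Bz; have cdz : continuous dz by case: Bz.
  pose K x := oint (fun y => g1 (x, y) * z y) c d.
  pose L x := oint (fun y => g2 (x, y) * dz y) c d.
  have cK : continuous K by apply: cont_oint; cont.
  have cL : continuous L by apply: cont_oint; cont.
  have := @du_Bois_Reymond K L a b ab cK cL _ x xab.
  rewrite /K /L => D.
  transitivity (oint (fun x => L x) a x).
    rewrite -D.
      rewrite -ointB; [|by cont|by cont].
      by apply: congr_oint => t; rewrite mulrBl.
    move=> w dw Bw; rewrite -[RHS](H w dw z dz Bw Bz); apply: congr_oint => t.
    rewrite [X in X + _]mulrC [X in _ + X]mulrC -!ointZ; [|by cont|by cont].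
    rewrite -ointD; [|by cont|by cont].
    by apply: congr_oint => s; ring.
  rewrite /L (oint_swap (f := fun x y => g2 (x, y) * dz y)); last first.
    by apply: contM; [apply: (cont_comp (g := fun z => (z.1, z.2)) c2)|]; cont.
  apply: congr_oint => t; rewrite /J mulrC -ointZ//.
  by apply: congr_oint => s; rewrite mulrC.
have cJN : continuous (fun y => - J y) by exact: contN.
have cG : continuous (fun y => g1 (x, y) - g1 (a, y)) by cont.
have := @du_Bois_Reymond (fun y => - J y) (fun y => g1 (x, y) - g1 (a, y)) c d cd cJN cG _ y ycd.
move=> D; rewrite -D.
  rewrite ointB// /J; lra.
move=> z dz Bz; have cz := bump_cont Bz; have cdz : continuous dz by case: (Bz).
rewrite ointD; [|by cont|by cont].
rewrite (step1 z dz Bz) -ointD; [|by cont|by cont].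
by apply: oint_eq0; [cont|move=> t _; ring|exact: ltW].
Qed.

End Rectangle.

(** * Local Hoelder and Lebesgue classes on the fluid domain *)

Section LocalClasses.
Context {R : realType}.
Implicit Types (D O : set (R * R)) (f F : R * R -> R) (b : bool).

Lemma closure_setI_open D O : open O -> closure D `&` O `<=` closure (D `&` O).
Proof.
move=> oO p [cp Op] B Bp.
have [q [Dq [Bq Oq]]] : D `&` (B `&` O) !=set0.
  by apply: cp; apply: filterI => //; exact: open_nbhs_nbhs.
by exists q.
Qed.

Definition obox (N : R) : set (R * R) := [set p | `|p.1| < N /\ `|p.2| < N].

Lemma obox_open N : open (obox N).
Proof.
have c1 : continuous (fun p : R * R => `|p.1|) by cont.
have c2 : continuous (fun p : R * R => `|p.2|) by cont.
have -> : obox N = (fun p : R * R => `|p.1|) @^-1` `]-oo, N[ `&` (fun p : R * R => `|p.2|) @^-1` `]-oo, N[.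
  by apply/seteqP; split=> p /=; rewrite !in_itv.
apply: openI; apply: open_comp; try exact: interval_open; by move=> p _; first [exact: c1|exact: c2].
Qed.

Lemma compact_closure_obox D N : compact (closure (D `&` obox N)).
Proof.
apply: subclosed_compact (@compact_box R N) _; first exact: closed_closure.
have /closure_id -> := compact_closed2 (@compact_box R N).
by apply: closure_subset => p [_ [h1 h2]]; apply/boxP; rewrite !ltW.
Qed.

Lemma loc_obox (X : set (R * R) -> (R * R -> R) -> Prop) D f N : open D ->
  loc_closure X D f -> X (D `&` obox N) f.
Proof.
move=> oD; apply; [exact: openI oD (@obox_open N)|exact: compact_closure_obox|].
by apply: closure_subset => p [].
Qed.

Lemma powR_small (C alpha e : R) : 0 < alpha -> 0 < e ->
  exists2 s, 0 < s & forall t, 0 <= t -> t < s -> C * t `^ alpha <= e.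
Proof.
move=> a0 e0; pose C1 := `|C| + 1; have C10 : 0 < C1 by rewrite ltr_wpDl.
pose s := (e / C1) `^ alpha^-1.
have s0 : 0 < s by apply: powR_gt0; exact: divr_gt0.
exists s => // t t0 ts.
apply: le_trans (_ : C1 * t `^ alpha <= _).
  by rewrite ler_wpM2r ?powR_ge0// /C1 (le_trans (ler_norm C))// lerDl.
rewrite -ler_pdivlMl// mulrC.
apply: le_trans (_ : s `^ alpha <= _).
  by apply: ge0_ler_powR; rewrite ?nnegrE ?(ltW a0) ?(ltW s0) ?(ltW ts).
by rewrite -powRrM mulVf ?gt_eqF// powRr1// ltW// divr_gt0.
Qed.

Lemma holder_cont (T : topologicalType) (V : normedModType R) (alpha : R) (A : set V)
    (cl : T -> V) (f : V -> R) : 0 < alpha -> continuous cl -> (forall t, A (cl t)) ->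
  holder_on alpha A f -> continuous (fun t => f (cl t)).
Proof.
move=> a0 ccl Acl [_ [C HC]] p; apply/cvgrPdist_le => e e0.
have [s s0 Hs] := powR_small C a0 e0.
have /cvgrPdist_lt/(_ _ s0) := ccl p; apply: filterS => q h.
by apply: le_trans (HC _ _ (Acl p) (Acl q)) _; exact: Hs.
Qed.

(** The Hoelder bound is available on the closures of bounded open parts of [D];
    the closure of one such part contains all points of [closure D] near a given one. *)
Lemma Ca_loc_cont D (alpha : R) (cl : R * R -> R * R) f : open D -> 0 < alpha ->
  continuous cl -> (forall p, closure D (cl p)) -> Ca_loc alpha D f ->
  continuous (fun p => f (cl p)).
Proof.
move=> oD a0 ccl clD Hf p; set N := `|(cl p).1| + `|(cl p).2| + 1.
have [_ [C HC]] := loc_obox N oD Hf.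
have inN q : obox N (cl q) -> closure (D `&` obox N) (cl q).
  by move=> h; apply: closure_setI_open; [exact: obox_open|split].
have oN : obox N (cl p).
  by split; rewrite /N; move: (normr_ge0 (cl p).1) (normr_ge0 (cl p).2) => ? ?; lra.
have near1 : \forall q \near p, obox N (cl q).
  exact: (ccl p _ (open_nbhs_nbhs (conj (@obox_open N) oN))).
apply/cvgrPdist_le => e e0.
have [s s0 Hs] := powR_small C a0 e0.
have /cvgrPdist_lt/(_ _ s0) near2 := ccl p.
near=> q.
have h1 : obox N (cl q) by near: q.
have h2 : `|cl p - cl q| < s by near: q.
by apply: le_trans (HC _ _ (inN _ oN) (inN _ h1)) _; exact: Hs.
Unshelve. all: by end_near. Qed.

Lemma Lr_loc_L1loc D (r : R) F : open D -> 1 <= r -> Lr_loc r D F -> L1loc D F.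
Proof.
move=> oD r1 HF K cK KD.
have [N N0 KN] := compact_sub_box cK.
have LF := loc_obox (N + 1) oD HF.
have KD' : K `<=` D `&` obox (N + 1).
  move=> p Kp; split; first exact: KD.
  by have /boxP[h1 h2] := KN _ Kp; split; lra.
set D' := D `&` obox (N + 1) in LF KD'.
have mK := compact_measurable2 cK.
have mF : measurable_fun setT (F \_ D').
  by move: LF; rewrite /Lr2 inE => /andP[]; rewrite inE.
have iF := Lfun_integrable (ltac:(by rewrite ?lee_fin) : (1 <= r)%R) LF.
have iFK := integrableS (@measurableT _ _) mK (@subsetT _ K) iF.
have i1K : leb2.-integrable K (fun _ => 1%E).
  have := @cont_integrable_box R N (fun=> 1) (@cont_cst _ _ _).
  by apply: integrableS => //; exact: measurable_box.
have iS := integrableD mK i1K iFK.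
have : leb2.-integrable K (EFin \o (F \_ D')).
  apply: le_integrable iS => //.
    by apply/measurable_EFinP; exact: measurable_funTS.
  move=> p Kp /=; rewrite lee_fin [leRHS]ger0_norm ?addr_ge0 ?powR_ge0//.
  set t := (F \_ D') p; have [t1|t1] := leP `|t| 1.
    by rewrite (le_trans t1)// lerDl powR_ge0.
  have : `|t| `^ 1 <= `|t| `^ r by apply: ler_powR => //; exact: ltW.
  rewrite powRr1//; lra.
apply: eq_integrable => // p; rewrite inE => Kp /=; rewrite patchE.
by case: ifPn => // /negP; rewrite inE => h; exfalso; apply: h; exact: KD'.
Qed.

End LocalClasses.

Lemma ae_mono {R : realType} (A B : R * R -> Prop) :
  {ae leb2, forall p, A p} -> (forall p, A p -> B p) -> {ae leb2, forall p, B p}.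
Proof.
move=> [N [mN N0 sN]] AB; exists N; split => // p /= nB.
by apply: sN => /= Ap; apply: nB; exact: AB.
Qed.

(** * Conservation laws of the Euler equations *)

Section Conservation.
Context {R : realType}.
Variables (D : set (R * R)) (oD : open D).
Implicit Types (f g F G : R * R -> R) (b : bool).

(** Continuity of [f] together with local integrability of its derivative [F]
    makes this class stable under products. *)
Definition sobolev b f F := [/\ continuous f, L1loc D F & wder D b f F].

Lemma sobolevD b f g F G : sobolev b f F -> sobolev b g G ->
  sobolev b (fun p => f p + g p) (fun p => F p + G p).
Proof. by move=> [cf LF wf] [cg LG wg]; split; [cont|exact: L1locD|exact: wderD]. Qed.

Lemma sobolevM b f g F G : sobolev b f F -> sobolev b g G ->
  sobolev b (fun p => f p * g p) (fun p => g p * F p + f p * G p).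
Proof.
move=> [cf LF wf] [cg LG wg]; split; [cont|by apply: L1locD; exact: L1locM|exact: wderM].
Qed.

Lemma sobolev_C1 b f (df : bool -> R * R -> R) :
  (forall b p, pder b f p (df b p)) -> (forall b, continuous (df b)) -> sobolev b f (df b).
Proof.
move=> dfE cdf; split; [exact: pder_cont dfE cdf|exact: cont_L1loc|exact: wder_C1].
Qed.

Lemma sobolev_cst b (k : R) : sobolev b (fun=> k) (fun=> 0).
Proof.
apply: (@sobolev_C1 b (fun=> k) (fun _ _ => 0)) => [b' p|b']; last exact: cont_cst.
by case: b'; exact: der_cst.
Qed.

Lemma sobolev_snd b : sobolev b snd (fun=> (~~ b)%:R).
Proof.
apply: (@sobolev_C1 b snd (fun b _ => (~~ b)%:R)) => [b' p|b']; last exact: cont_cst.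
by case: b'; [exact: der_cst|exact: der_id].
Qed.

Lemma sobolevN b f F : sobolev b f F -> sobolev b (fun p => - f p) (fun p => - F p).
Proof.
move=> Sf; have := sobolevM (sobolev_cst b (-1)) Sf.
have -> : (fun p => -1 * f p) = (fun p => - f p) by apply/funext => p; rewrite mulN1r.
suff -> : (fun p => f p * 0 + -1 * F p) = (fun p => - F p) by [].
by apply/funext => p; rewrite mulr0 add0r mulN1r.
Qed.

Lemma pairing_ae0 K F phi : compact K -> K `<=` D -> L1loc D F -> continuous phi -> csupp K phi ->
  {ae leb2, forall p, D p -> F p = 0} -> pairing F phi = 0.
Proof.
move=> cK KD LF cphi sphi ae0.
have iF := pairing_integrable cK KD LF cphi sphi.
rewrite /pairing /Rintegral (@ae_eq_integral _ _ _ leb2 setT (cst 0%E))//.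
- by rewrite integral0.
- exact: measurable_int iF.
- apply: ae_mono ae0 _ => p Fp _ /=.
  have [Kp|/sphi ->] := pselect (K p); last by rewrite mulr0.
  by rewrite Fp ?mul0r//; exact: KD.
Qed.

(** [f1_x + f2_y = 0] in the sense of distributions. *)
Definition conserved f1 f2 := forall phi, test_function D phi ->
  pairing f1 ('D_(dir true) phi) + pairing f2 ('D_(dir false) phi) = 0.

Lemma sobolev_conserved f1 f2 F1 F2 : sobolev true f1 F1 -> sobolev false f2 F2 ->
  {ae leb2, forall p, D p -> F1 p + F2 p = 0} -> conserved f1 f2.
Proof.
move=> [c1 L1 w1] [c2 L2 w2] ae0 phi tphi.
have [_ _ cphi [K [cK KD sphi _]]] := test_function_pder tphi.
rewrite w1// w2// -opprD -(pairingDl cK KD L1 L2 cphi sphi).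
by rewrite (pairing_ae0 cK KD (L1locD L1 L2) cphi sphi ae0) oppr0.
Qed.

(** Test functions see only the values on [D], so that [f] may be replaced by a
    continuous function on the plane which agrees with it on [D]. *)
Lemma weak_deriv_wder b f F fb : weak_deriv2 D (dir b) f F -> (forall p, D p -> fb p = f p) ->
  wder D b fb F.
Proof.
move=> wf fbE phi tphi.
have [_ _ cphi [K [cK KD sphi sd]]] := test_function_pder tphi.
rewrite -(pairing_D F KD sphi) -(pairing_D fb KD (sd b)) -wf//.
by apply: eq_Rintegral => p; rewrite inE => /fbE ->.
Qed.

End Conservation.

Section Laws.
Context {R : realType}.
Variables (D : set (R * R)) (oD : open D).

(** In this order: incompressibility, the vertical momentum equation, and the
    transport of the Bernoulli function [G] by the flow. The last one holds since
    the Euler equations give [a G_x = v G_y], while [(a, - v)] is divergence free. *)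
Lemma euler_laws (g c : R) (u v P ux uy vx vy Px Py : R * R -> R) :
  let a p := c - u p in
  let Q p := P p + g * p.2 in
  let G p := Q p + 2^-1 * (a p * a p + v p * v p) in
  sobolev D true u ux -> sobolev D false u uy ->
  sobolev D true v vx -> sobolev D false v vy ->
  sobolev D true P Px -> sobolev D false P Py ->
  {ae leb2, forall p, D p ->
    [/\ (u p - c) * ux p + v p * uy p = - Px p,
        (u p - c) * vx p + v p * vy p = - Py p - g & ux p + vy p = 0]} ->
  [/\ conserved D a (fun p => - v p),
      conserved D (fun p => a p * v p) (fun p => - (v p * v p + Q p)) &
      conserved D (fun p => a p * G p) (fun p => - (v p * G p))].
Proof.
move=> a Q G Sux Suy Svx Svy SPx SPy ae.
have Sa b F : sobolev D b u F -> sobolev D b a (fun p => 0 + - F p).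
  by move=> /(sobolevN oD); exact: sobolevD (sobolev_cst oD b c).
have SQ b F : sobolev D b P F -> sobolev D b Q (fun p => F p + (p.2 * 0 + g * (~~ b)%:R)).
  by move=> SP; exact: sobolevD SP (sobolevM oD (sobolev_cst oD b g) (sobolev_snd oD b)).
have Sax := Sa _ _ Sux; have Say := Sa _ _ Suy.
have SQx := SQ _ _ SPx; have SQy := SQ _ _ SPy.
have SG b A B C : sobolev D b a A -> sobolev D b v B -> sobolev D b Q C ->
    sobolev D b G (fun p => C p + ((a p * a p + v p * v p) * 0 +
      2^-1 * ((a p * A p + a p * A p) + (v p * B p + v p * B p)))).
  move=> SA SB SC; have S1 := sobolevM oD SA SA; have S2 := sobolevM oD SB SB.
  exact: (sobolevD SC (sobolevM oD (sobolev_cst oD b 2^-1) (sobolevD S1 S2))).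
have SGx := SG _ _ _ _ Sax Svx SQx; have SGy := SG _ _ _ _ Say Svy SQy.
split.
- apply: (sobolev_conserved Sax (sobolevN oD Svy)).
  apply: ae_mono ae _ => p H Dp; have [_ _ e] := H Dp; lra.
- apply: (sobolev_conserved (sobolevM oD Sax Svx) (sobolevN oD (sobolevD (sobolevM oD Svy Svy) SQy))).
  apply: ae_mono ae _ => p H Dp; have [e1 e2 e3] := H Dp; rewrite /a /=.
  have -> : ux p = - vy p by lra.
  have -> : Py p = - ((u p - c) * vx p + v p * vy p) - g by lra.
  ring.
- apply: (sobolev_conserved (sobolevM oD Sax SGx) (sobolevN oD (sobolevM oD Svy SGy))).
  apply: ae_mono ae _ => p H Dp; have [e1 e2 e3] := H Dp; rewrite /a /=.
  have -> : Py p = - ((u p - c) * vx p + v p * vy p) - g by lra.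
  have -> : Px p = - ((u p - c) * ux p + v p * uy p) by lra.
  have -> : ux p = - vy p by lra.
  by field.
Qed.

End Laws.

(** * The fluid domain *)

Section Fluid.
Context {R : realType}.
Variables (d : R) (eta : R -> R).
Hypotheses (ceta : continuous eta) (deta : forall x, - d < eta x).

(** The vertical projection onto the closed fluid domain. Composition with it
    extends functions continuously from that domain to the whole plane. *)
Definition clamp (p : R * R) : R * R := (p.1, Num.max (- d) (Num.min p.2 (eta p.1))).

Lemma clamp_cont : continuous clamp.
Proof. by rewrite /clamp; cont. Qed.

Lemma clamp_id p : - d <= p.2 <= eta p.1 -> clamp p = p.
Proof.
case: p => x y /= /andP[h1 h2]; rewrite /clamp /=; congr pair.
by rewrite (min_idPl h2); exact/max_idPr.
Qed.

Lemma clamp_bnd p : - d <= (clamp p).2 <= eta (clamp p).1.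
Proof.
rewrite /clamp /= le_max lexx/= ge_max ltW//= ge_min lexx orbT//.
Qed.

Lemma fluid_open : open (fluid d eta).
Proof.
have c1 : continuous (fun p : R * R => p.2 + d) by cont.
have c2 : continuous (fun p : R * R => eta p.1 - p.2) by cont.
have -> : fluid d eta = (fun p : R * R => p.2 + d) @^-1` `]0, +oo[ `&` (fun p : R * R => eta p.1 - p.2) @^-1` `]0, +oo[.
  apply/seteqP; split=> p; rewrite /fluid /= !in_itv/= !andbT.
    by move=> /andP[? ?]; split; lra.
  by move=> [? ?]; apply/andP; split; lra.
apply: openI; apply: open_comp; try exact: interval_open; by move=> p _; first [exact: c1|exact: c2].
Qed.

Lemma closure_fluidP p : closure (fluid d eta) p <-> - d <= p.2 <= eta p.1.
Proof.
split=> [|/andP[h1 h2]].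
  have c1 : continuous (fun p : R * R => p.2 + d) by cont.
  have c2 : continuous (fun p : R * R => eta p.1 - p.2) by cont.
  pose A := (fun p : R * R => p.2 + d) @^-1` `[0, +oo[ `&` (fun p : R * R => eta p.1 - p.2) @^-1` `[0, +oo[.
  have cA : closed A.
    apply: closedI; apply: preimage_closed => //; exact: interval_closed.
  have sA : fluid d eta `<=` A.
    by move=> q; rewrite /fluid /A /= !in_itv/= !andbT => /andP[? ?]; split; lra.
  move=> /(closure_subset sA); move/closure_id : cA => <-.
  by rewrite /A /= !in_itv/= !andbT => -[? ?]; apply/andP; split; lra.
(* A boundary point is moved slightly towards the middle of its vertical segment. *)
move=> B /nbhs_ballP[e /= e0 He].
pose m := (eta p.1 - d) / 2; have [m1 m2] : - d < m /\ m < eta p.1.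
  by have := deta p.1; rewrite /m; split; lra.
pose t := Num.min 1 (e / (2 * (`|m - p.2| + 1))).
have T0 : 0 < 2 * (`|m - p.2| + 1) by rewrite mulr_gt0// ltr_wpDl.
have t0 : 0 < t by rewrite lt_min ltr01 divr_gt0.
have t1 : t <= 1 by rewrite ge_min lexx.
have tm : t * `|m - p.2| < e.
  have : t * (2 * (`|m - p.2| + 1)) <= e by rewrite -ler_pdivlMr// ge_min lexx orbT.
  by move: (normr_ge0 (m - p.2)) => ?; nra.
exists (p.1, p.2 + t * (m - p.2)); split.
  by rewrite /fluid /=; apply/andP; split; nra.
apply: He; split; rewrite /ball/= ?subrr ?normr0//.
by rewrite opprD addrA subrr add0r normrN normrM gtr0_norm.
Qed.

End Fluid.

Section RectangleLaw.
Context {R : realType}.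
Variable D : set (R * R).

(** Products [w(x) z(y)] supported in the rectangle are test functions on [D]. *)
Lemma conserved_rectangle (f1 f2 : R * R -> R) (a b c d : R) : a < b -> c < d ->
  continuous f1 -> continuous f2 -> conserved D f1 f2 ->
  (forall x y, a <= x <= b -> c <= y <= d -> D (x, y)) ->
  forall x y, a <= x <= b -> c <= y <= d ->
  oint (fun t => f1 (x, t) - f1 (a, t)) c y + oint (fun s => f2 (s, y) - f2 (s, c)) a x = 0.
Proof.
move=> ab cd c1 c2 cons sub; apply: (rectangle_flux ab cd c1 c2) => w dw z dz Bw Bz.
have cw := bump_cont Bw; have cz := bump_cont Bz.
have [dwE cdw w0] := Bw; have [dzE cdz z0] := Bz.
have dw0 x := bump_der0 (x := x) Bw; have dz0 x := bump_der0 (x := x) Bz.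
pose K : set (R * R) := `[a, b]%classic `*` `[c, d]%classic.
have cK : compact K by apply: compact_setX; exact: segment_compact.
have KD : K `<=` D by move=> [x y] [/= hx hy]; move: hx hy; rewrite !in_itv; exact: sub.
have outK p : ~ K p -> ~ (a <= p.1 <= b) \/ ~ (c <= p.2 <= d).
  move=> nK; have [h1|] := pselect (a <= p.1 <= b); last by left.
  by right => h2; apply: nK; split; rewrite /= in_itv.
pose phi (p : R * R) := w p.1 * z p.2.
pose dphi (b : bool) (p : R * R) := if b then dw p.1 * z p.2 else w p.1 * dz p.2.
have [tphi dE] : test_function D phi /\ forall b, 'D_(dir b) phi = dphi b.
  apply: (@pder_test_function _ D K) => //.
  - move=> [] p; rewrite /pder /phi /dphi.
      have := derM (dwE p.1) (der_cst (z p.2) p.1); rewrite mulr0 add0r mulrC; exact.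
    by have := derM (der_cst (w p.1) p.2) (dzE p.2); rewrite mulr0 addr0.
  - by move=> [] ; rewrite /dphi; cont.
  - by move=> p /outK[/w0|/z0] E; rewrite /phi E ?mul0r ?mulr0.
have := cons phi tphi; rewrite !dE /dphi /=.
pose k p := f1 p * (dw p.1 * z p.2) + f2 p * (w p.1 * dz p.2).
have c1' : continuous (fun p : R * R => dw p.1 * z p.2) by cont.
have c2' : continuous (fun p : R * R => w p.1 * dz p.2) by cont.
have s1 : csupp K (fun p : R * R => dw p.1 * z p.2).
  by move=> p /outK[/dw0|/z0] ->; rewrite ?mul0r ?mulr0.
have s2 : csupp K (fun p : R * R => w p.1 * dz p.2).
  by move=> p /outK[/w0|/dz0] ->; rewrite ?mul0r ?mulr0.
rewrite /pairing -RintegralD//; [|exact: (pairing_integrable cK KD (cont_L1loc c1) c1' s1)|exact: (pairing_integrable cK KD (cont_L1loc c2) c2' s2)].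
have [N N0 KN] := compact_sub_box cK.
have k0 p : ~ K p -> k p = 0.
  by move=> /outK[h|h]; rewrite /k; [rewrite dw0// w0// !mul0r !mulr0 addr0|rewrite z0// dz0// !mulr0 addr0].
have ck : continuous k by rewrite /k; cont.
have kN p : ~ box N p -> k p = 0 by move=> h; apply: k0 => /KN.
have kab p : ~ (a <= p.1 <= b) -> k p = 0.
  by move=> h; apply: k0 => -[/= +  _]; rewrite in_itv.
rewrite (fubini_strip (f := k) N0 (ltW ab) ck kN kab) => <-.
have ck' x : continuous (fun y => k (x, y)) by cont.
have cI A B : continuous (fun x => oint (fun y => k (x, y)) A B) by apply: cont_oint; cont.
apply: eq_oint; [|exact: cI|exact: cI|exact: ltW].
have /KN/boxP[_ Nc] : K (a, c) by split; rewrite /= in_itv/= lexx ltW.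
have /KN/boxP[_ Nd] : K (a, d) by split; rewrite /= in_itv/= lexx ltW.
move: Nc Nd; rewrite /= !ler_norml => /andP[? ?] /andP[? ?].
move=> x xab; rewrite (@oint_supp _ (fun y => k (x, y)) c d (- N) N)//; [exact: ltW|].
by move=> y h; apply: k0 => -[_ /=]; rewrite in_itv.
Qed.

End RectangleLaw.

(** * The stream function and streamline coordinates *)

Section Flow.
Context {R : realType}.
Variables (d delta : R) (eta deta : R -> R) (a v : R * R -> R).
Hypotheses (delta0 : 0 < delta) (etad : forall x, - d < eta x).
Hypotheses (etaE : forall x, is_derive x (1 : R) eta (deta x)) (cdeta : continuous deta).
Hypotheses (ca : continuous a) (cv : continuous v) (a_ge : forall p, delta <= a p).
Hypotheses (bed : forall x, v (x, - d) = 0).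
Hypotheses (surface : forall x, v (x, eta x) + a (x, eta x) * deta x = 0).
Let D := fluid d eta.
Hypothesis (mass : conserved D a (fun p => - v p)).

Let ceta : continuous eta. Proof. exact: der_cont etaE. Qed.
Let oD : open D. Proof. exact: fluid_open. Qed.

Definition psi (p : R * R) : R := oint (fun t => a (p.1, t)) (- d) p.2.

Lemma psi_cont : continuous psi.
Proof. by apply: cont_oint; cont. Qed.

Lemma a_slice x : continuous (fun t => a (x, t)). Proof. by cont. Qed.

Lemma psi_y p : pder false psi p (a p).
Proof.
rewrite /pder /psi /=; have -> : a p = a (p.1, p.2) by rewrite -surjective_pairing.
exact: (@is_derive_oint _ (fun t => a (p.1, t)) (- d) p.2 (@a_slice _)).
Qed.

Lemma psi_bed x : psi (x, - d) = 0. Proof. exact: ointaa. Qed.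

Lemma psi_incr x y1 y2 : y1 <= y2 -> delta * (y2 - y1) <= psi (x, y2) - psi (x, y1).
Proof.
move=> y12; rewrite /psi /= -(oint_cat _ (- d) y1 y2) addrAC subrr add0r -oint_cst.
by apply: le_oint => //; [exact: cont_cst|exact: a_slice].
Qed.

Lemma psi_le x y1 y2 : (psi (x, y1) <= psi (x, y2)) = (y1 <= y2).
Proof.
have H u w : u <= w -> psi (x, u) <= psi (x, w).
  by move=> uw; have := psi_incr x uw; have := mulr_ge0 (ltW delta0) (ltac:(lra) : 0 <= w - u); lra.
apply/idP/idP; last exact: H.
move=> h; rewrite leNgt; apply/negP => y21.
have := psi_incr x (ltW y21); have := mulr_gt0 delta0 (ltac:(lra) : 0 < y1 - y2); lra.
Qed.

Lemma psi_lt x y1 y2 : (psi (x, y1) < psi (x, y2)) = (y1 < y2).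
Proof. by rewrite !ltNge psi_le. Qed.

Lemma psi_inj x y1 y2 : psi (x, y1) = psi (x, y2) -> y1 = y2.
Proof. by move=> E; apply/eqP; rewrite eq_le -(psi_le x) -[X in _ && X](psi_le x) E lexx. Qed.

(** Mass conservation in the rectangle below the height [y]; nothing flows through
    the bed. *)
Lemma psi_horizontal x1 x2 y : x1 < x2 -> - d < y -> (forall s, x1 <= s <= x2 -> y < eta s) ->
  psi (x2, y) - psi (x1, y) = oint (fun s => v (s, y)) x1 x2.
Proof.
move=> x12 dy ye.
have cvN : continuous (fun p => - v p) by cont.
have cvs y' : continuous (fun s => v (s, y')) by cont.
have ca1 := @a_slice x1; have ca2 := @a_slice x2.
pose F y1 := oint (fun t => a (x2, t) - a (x1, t)) y1 y + oint (fun s => - v (s, y) - - v (s, y1)) x1 x2.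
have F0 y1 : - d < y1 < y -> F y1 = 0.
  move=> /andP[dy1 y1y].
  apply: (conserved_rectangle x12 y1y ca cvN mass); rewrite ?lexx ?(ltW x12) ?(ltW y1y)//.
  move=> s t /ye ys /andP[y1t ty]; rewrite /D /fluid /=.
  by rewrite (lt_le_trans dy1 y1t) (le_lt_trans ty ys).
have cF : continuous F.
  by apply: contD; apply: cont_oint; cont.
have := cont_ext_closed cF dy F0 (x := - d); rewrite lexx (ltW dy) => /(_ isT).
rewrite /F ointB// -/(psi (x2, y)) -/(psi (x1, y)).
have -> : (fun s => - v (s, y) - - v (s, - d)) = (fun s => -1 * v (s, y)).
  by apply/funext => s; rewrite bed; lra.
rewrite ointZ// /psi /=; lra.
Qed.

Lemma psi_x p : D p -> pder true psi p (v p).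
Proof.
case: p => x0 y; rewrite /D /fluid /pder /= => /andP[dy ye].
have cvy : continuous (fun s => v (s, y)) by cont.
have : \forall s \near x0, y < eta s by exact: (ceta (lt_nbhsr ye)).
move=> /nbhs_ballP[r /= r0 Hr].
have H s : `|s - x0| < r -> y < eta s by move=> h; apply: Hr; rewrite /ball/= distrC.
have E : \forall x \near x0, psi (x0, y) + oint (fun s => v (s, y)) x0 x = psi (x, y).
  apply/nbhs_ballP; exists r => //= x; rewrite /ball/= distrC => xr /=.
  have [xx|xx|xx] := ltgtP x0 x.
  - rewrite -(psi_horizontal xx dy) => [|s]; first by rewrite addrC subrK.
    move=> /andP[s1 s2]; apply: H.
    by move: xr; rewrite !ltr_norml => /andP[? ?]; apply/andP; split; lra.
  - rewrite ointN -(psi_horizontal xx dy) => [|s]; first by rewrite opprB addrC subrK.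
    move=> /andP[s1 s2]; apply: H.
    by move: xr; rewrite !ltr_norml => /andP[? ?]; apply/andP; split; lra.
  - by rewrite -xx ointaa addr0.
apply: near_eq_is_derive E _.
by have := derD (der_cst (psi (x0, y)) x0) (is_derive_oint x0 x0 cvy); rewrite add0r.
Qed.

(** Along [y = eta x - e], which lies in the fluid for small [e > 0], the derivative
    of [psi] is [v + a eta']. Letting [e] tend to [0], this vanishes by the
    kinematic condition: the surface is a streamline. *)
Lemma psi_surface x1 x2 : psi (x1, eta x1) = psi (x2, eta x2).
Proof.
wlog x12 : x1 x2 / x1 < x2.
  by move=> H; have [/H|/H|->] := ltgtP x1 x2.
have [x3 _ Hx3] := EVT_min (ltW x12) (continuous_subspaceT ceta).
pose e0 := eta x3 + d; have e00 : 0 < e0 by rewrite /e0; have := etad x3; lra.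
have dfl x e : x1 <= x <= x2 -> 0 < e < e0 -> D (x, eta x - e).
  move=> xx /andP[e1 e2]; have := Hx3 x; rewrite in_itv/= xx => /(_ isT) h.
  by rewrite /D /fluid /=; apply/andP; split; rewrite /e0 in e2; lra.
pose F e := psi (x2, eta x2 - e) - psi (x1, eta x1 - e) -
  oint (fun x => v (x, eta x - e) + a (x, eta x - e) * deta x) x1 x2.
have cpsi := psi_cont.
have cF : continuous F.
  apply: contD; first by cont.
  by apply: contN; apply: cont_oint; cont.
have F0 e : 0 < e < e0 -> F e = 0.
  move=> ee; apply/eqP; rewrite /F subr_eq0; apply/eqP/esym.
  apply: (@FTC _ _ (fun x => psi (x, eta x - e))); [by cont|exact: ltW|].
  move=> x xx.
  have d2 : is_derive x (1 : R) (fun x => eta x - e) (deta x).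
    by have := derB (etaE x) (der_cst e x); rewrite subr0.
  have nq : \forall q \near (x, eta x - e),
      is_derive q.1 (1 : R) (fun x => psi (x, q.2)) (v q) /\
      is_derive q.2 (1 : R) (fun y => psi (q.1, y)) (a q).
    apply: filterS (open_nbhs_nbhs (conj oD (dfl x e xx ee))) => q Dq.
    by split; [exact: psi_x|exact: psi_y].
  have := der_chain (c1 := fun x => x) (c2 := fun x => eta x - e) nq (@cv (x, eta x - e)) (@ca (x, eta x - e)) (der_id x) d2.
  by rewrite mulr1.
have := cont_ext_closed cF e00 F0 (x := 0); rewrite lexx (ltW e00) => /(_ isT).
rewrite /F !subr0 oint_eq0 ?subr0 ?(ltW x12)//.
- by move=> /eqP; rewrite subr_eq0 => /eqP.
- by cont.
- by move=> x _; rewrite subr0 surface.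
Qed.

Definition mass_flux : R := psi (0, eta 0).

Lemma psi_eta x : psi (x, eta x) = mass_flux. Proof. exact: psi_surface. Qed.

Lemma mass_flux_gt0 : 0 < mass_flux.
Proof. by have := psi_lt 0 (- d) (eta 0); rewrite psi_bed etad. Qed.

Lemma psi_surj x p : exists y, psi (x, y) = p.
Proof.
pose r := `|p| / delta; have r0 : 0 <= r by rewrite divr_ge0// ltW.
have dr : delta * r = `|p| by rewrite /r mulrC divfK// gt_eqF.
have lo : psi (x, - d - r) <= p.
  have := psi_incr x (ltac:(lra) : - d - r <= - d); rewrite psi_bed.
  have -> : - d - (- d - r) = r by lra.
  by rewrite dr; move: (ler_norm (- p)); rewrite normrN; lra.
have hi : p <= psi (x, - d + r).
  have := psi_incr x (ltac:(lra) : - d <= - d + r); rewrite psi_bed.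
  have -> : - d + r - - d = r by lra.
  by rewrite dr; move: (ler_norm p); lra.
have cps := psi_cont; have cs : continuous (fun y => psi (x, y)) by cont.
have ab : - d - r <= - d + r by lra.
have mm : Num.min (psi (x, - d - r)) (psi (x, - d + r)) <= p <=
    Num.max (psi (x, - d - r)) (psi (x, - d + r)).
  by apply/andP; split; [rewrite ge_min lo|rewrite le_max hi orbT].
have [y _ yE] := IVT ab (continuous_subspaceT cs) mm.
by exists y.
Qed.

(** The height over [q.1] of the streamline labelled [q.2]. Such a height always
    exists ([psi_surj]), so that the default value [0] is never taken. *)
Definition height (q : R * R) : R := xget 0 [set y | psi (q.1, y) = q.2].

Lemma psi_height q : psi (q.1, height q) = q.2.
Proof.
rewrite /height; case: xgetP => [y -> //|H].
by have [y Hy] := psi_surj q.1 q.2; have := H y.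
Qed.

Lemma height_psi x y : height (x, psi (x, y)) = y.
Proof.
exact: psi_inj (psi_height (x, psi (x, y))).
Qed.

Lemma height_bed x : height (x, 0) = - d.
Proof. by rewrite -(psi_bed x) height_psi. Qed.

Lemma height_surface x : height (x, mass_flux) = eta x.
Proof. by rewrite -(psi_eta x) height_psi. Qed.

Lemma height_le x p1 p2 : (height (x, p1) <= height (x, p2)) = (p1 <= p2).
Proof. by rewrite -(psi_le x) (psi_height (x, p1)) (psi_height (x, p2)). Qed.

Lemma height_dist x y1 y2 : delta * `|y1 - y2| <= `|psi (x, y1) - psi (x, y2)|.
Proof.
wlog y21 : y1 y2 / y2 <= y1.
  move=> H; have [/H//|/ltW/H] := leP y2 y1.
  by rewrite distrC [X in _ <= X]distrC.
have h := psi_incr x y21; rewrite ger0_norm ?subr_ge0// (le_trans h)// ler_norm//.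
Qed.

Lemma height_cont : continuous height.
Proof.
move=> q0; apply/cvgrPdist_le => e e0.
have cg : continuous (fun q : R * R => q.2 - psi (q.1, height q0)) by have cps := psi_cont; cont.
have de : 0 < delta * e by exact: mulr_gt0.
have /cvgrPdist_le/(_ _ de) := cg q0.
apply: filterS => q; rewrite psi_height subrr sub0r normrN => h.
rewrite -(ler_pM2l delta0) (le_trans (height_dist q.1 _ _))//.
by rewrite psi_height distrC.
Qed.

(** The inverse of [(x, y) |-> (x, psi (x, y))], which sends streamline labels to
    points of the fluid. *)
Definition flow (q : R * R) : R * R := (q.1, height q).

Lemma flow_cont : continuous flow.
Proof. by have ch := height_cont; rewrite /flow; cont. Qed.

Lemma flow_psi p : flow (p.1, psi p) = p.
Proof. by case: p => x y; rewrite /flow /= height_psi. Qed.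

Lemma psi_flow q : psi (flow q) = q.2. Proof. exact: psi_height. Qed.

Lemma psi_fluid p : 0 < psi p < mass_flux -> D p.
Proof.
case: p => x y /andP[]; rewrite -[X in X < _](psi_bed x) -(psi_eta x) !psi_lt.
by rewrite /D /fluid /= => -> ->.
Qed.

(** Change of variables from the height to the stream function. *)
Lemma oint_psi (F : R -> R) x y1 y2 : continuous F ->
  oint (fun y => F (psi (x, y)) * a (x, y)) y1 y2 = oint F (psi (x, y1)) (psi (x, y2)).
Proof.
move=> cF.
exact: (@oint_subst _ F (fun y => psi (x, y)) (fun y => a (x, y)) y1 y2 cF (@a_slice _) (fun y => psi_y (x, y))).
Qed.

Lemma a_neq0 p : a p != 0.
Proof. by rewrite gt_eqF// (lt_le_trans delta0). Qed.

(** The test function [w(x) z(psi)] has gradient [(w' z + w z' v, w z' a)]. The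
    change of variables from [y] to [psi] divides by [a], and the weak law for
    [(f1, f2)] becomes the weak law for [(f1 / a, f1 v / a + f2)] in the labels,
    although [flow] itself is only known to be continuous. *)
Lemma conserved_strip f1 f2 x1 x2 p1 p2 : continuous f1 -> continuous f2 -> conserved D f1 f2 ->
  x1 < x2 -> 0 < p1 -> p1 < p2 -> p2 < mass_flux ->
  let g1 q := f1 (flow q) / a (flow q) in
  let g2 q := f1 (flow q) * v (flow q) / a (flow q) + f2 (flow q) in
  oint (fun t => g1 (x2, t) - g1 (x1, t)) p1 p2 + oint (fun s => g2 (s, p2) - g2 (s, p1)) x1 x2 = 0.
Proof.
move=> c1 c2 cons x12 p10 p12 p2m g1 g2.
have cpsi := psi_cont; have cfl := flow_cont.
have cai : continuous (fun p => (a p)^-1) by apply: contV => //; exact: a_neq0.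
have caf : continuous (fun q => (a (flow q))^-1) by exact: cont_comp cai cfl.
have cg1 : continuous g1 by rewrite /g1; cont.
have cg2 : continuous g2 by rewrite /g2; cont.
refine (@rectangle_flux _ g1 g2 x1 x2 p1 p2 x12 p12 cg1 cg2 _ x2 p2 _ _);
  rewrite ?lexx ?(ltW x12) ?(ltW p12)//.
move=> w dw z dz Bw Bz.
have cw := bump_cont Bw; have cz := bump_cont Bz.
have [dwE cdw w0] := Bw; have [dzE cdz z0] := Bz.
have dw0 x := bump_der0 (x := x) Bw; have dz0 x := bump_der0 (x := x) Bz.
pose K := flow @` (`[x1, x2]%classic `*` `[p1, p2]%classic).
have cK : compact K.
  apply: continuous_compact; first exact: continuous_subspaceT.
  by apply: compact_setX; exact: segment_compact.
have KD : K `<=` D.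
  move=> y [q [_ /=]]; rewrite in_itv/= => /andP[h1 h2] <-.
  by apply: psi_fluid; rewrite psi_flow (lt_le_trans p10 h1) (le_lt_trans h2 p2m).
have outK p : ~ K p -> ~ (x1 <= p.1 <= x2) \/ ~ (p1 <= psi p <= p2).
  move=> nK; have [h1|] := pselect (x1 <= p.1 <= x2); last by left.
  right => h2; apply: nK; exists (p.1, psi p); last exact: flow_psi.
  by split; rewrite /= in_itv.
pose phi p := w p.1 * z (psi p).
pose dphi (b : bool) p := if b then dw p.1 * z (psi p) + w p.1 * (dz (psi p) * v p)
  else w p.1 * (dz (psi p) * a p).
have [tphi dE] : test_function D phi /\ forall b, 'D_(dir b) phi = dphi b.
  apply: (@pder_test_function _ D K) => //.
  - move=> [] p; rewrite /pder /phi /dphi; last first.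
      have dzp : is_derive p.2 (1 : R) (fun y => z (psi (p.1, y))) (dz (psi p) * a p).
        apply: der_comp (psi_y p); rewrite -surjective_pairing; exact: dzE.
      by have := derM (der_cst (w p.1) p.2) dzp; rewrite mulr0 addr0.
    have dzp : is_derive p.1 (1 : R) (fun x => z (psi (x, p.2))) (dz (psi p) * v p).
      have [/psi_fluid Dp|nD] := pselect (0 < psi p < mass_flux).
        apply: der_comp (psi_x Dp); rewrite -surjective_pairing; exact: dzE.
      have out : ~ (p1 <= psi p <= p2).
        by move=> /andP[h1 h2]; apply: nD; rewrite (lt_le_trans p10 h1) (le_lt_trans h2 p2m).
      rewrite dz0// mul0r.
      have cs : continuous (fun x => psi (x, p.2)) by cont.
      have near0 : \forall x \near p.1, (fun=> 0) x = z (psi (x, p.2)).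
        have [lo|hi] := ltP (psi p) p1.
          have : \forall x \near p.1, psi (x, p.2) < p1.
            by apply: (cs p.1 _ (lt_nbhsl _)); rewrite -surjective_pairing.
          by apply: filterS => x h; rewrite z0// => /andP[/(lt_le_trans h)]; rewrite ltxx.
        have h2 : p2 < psi p by rewrite ltNge; apply/negP => h; apply: out; rewrite hi.
        have : \forall x \near p.1, p2 < psi (x, p.2).
          by apply: (cs p.1 _ (lt_nbhsr _)); rewrite -surjective_pairing.
        by apply: filterS => x h; rewrite z0// => /andP[_ /(lt_le_trans h)]; rewrite ltxx.
      exact: near_eq_is_derive near0 (der_cst 0 p.1).
    have := derM (dwE p.1) dzp; rewrite -surjective_pairing addrC mulrC; exact.
  - by move=> []; rewrite /dphi; cont.
  - by move=> p /outK[/w0|/z0] E; rewrite /phi E ?mul0r ?mulr0.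
pose kt := dphi true; pose kf := dphi false.
have ckt : continuous kt by rewrite /kt /dphi; cont.
have ckf : continuous kf by rewrite /kf /dphi; cont.
have skt : csupp K kt.
  by move=> p /outK[h|h]; rewrite /kt /dphi; [rewrite dw0// w0//|rewrite z0// dz0//]; rewrite ?mul0r ?mulr0 ?mul0r ?mulr0 addr0.
have skf : csupp K kf.
  by move=> p /outK[h|h]; rewrite /kf /dphi; [rewrite w0//|rewrite dz0//]; rewrite ?mul0r ?mulr0.
have E0 : pairing f1 kt + pairing f2 kf = 0.
  by rewrite /kt /kf -(dE true) -(dE false); exact: (cons phi tphi).
move: E0; rewrite /pairing -RintegralD//; [|exact: (pairing_integrable cK KD (cont_L1loc c1) ckt skt)|exact: (pairing_integrable cK KD (cont_L1loc c2) ckf skf)].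
pose k p := f1 p * kt p + f2 p * kf p.
have [N N0 KN] := compact_sub_box cK.
have k0 p : ~ K p -> k p = 0 by move=> h; rewrite /k skt// skf// !mulr0 addr0.
have ck : continuous k by rewrite /k; cont.
have kN p : ~ box N p -> k p = 0 by move=> h; apply: k0 => /KN.
have kx p : ~ (x1 <= p.1 <= x2) -> k p = 0.
  by move=> h; rewrite /k /kt /kf /dphi dw0// w0// !mul0r addr0 !mulr0 addr0.
rewrite (fubini_strip (f := k) N0 (ltW x12) ck kN kx) => <-.
pose F x p := g1 (x, p) * (dw x * z p) + g2 (x, p) * (w x * dz p).
have cF x : continuous (F x) by rewrite /F; cont.
apply: eq_oint; [|by apply: cont_oint; rewrite /F; cont|by apply: cont_oint; cont|exact: ltW].
move=> x xx; rewrite -/(F x).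
have KK p : p1 <= p <= p2 -> K (x, height (x, p)).
  by move=> pp; exists (x, p) => //; split; rewrite /= in_itv.
have /KK/KN/boxP[_ /= N1] : p1 <= p1 <= p2 by rewrite lexx ltW.
have /KK/KN/boxP[_ /= N2] : p1 <= p2 <= p2 by rewrite lexx ltW.
move: N1 N2; rewrite !ler_norml => /andP[N1 _] /andP[_ N2].
have P1 : psi (x, - N) <= p1 by rewrite -[p1](psi_height (x, p1)) psi_le.
have P2 : p2 <= psi (x, N) by rewrite -[p2](psi_height (x, p2)) psi_le.
rewrite -(oint_supp (ltW p12) P1 P2 (cF x)); last first.
  by move=> p h; rewrite /F z0// dz0// !mulr0 addr0.
rewrite -oint_psi//; apply: congr_oint => y.
rewrite /F /g1 /g2 (flow_psi (x, y)) /k /kt /kf /dphi /=.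
have := a_neq0 (x, y); move: (a (x, y)) (f1 (x, y)) (f2 (x, y)) (v (x, y)) => A f f' V A0.
by field.
Qed.

(** For the fluxes [(a G, - v G)], the second flux in streamline labels is zero and
    the first one is [G]. *)
Lemma streamline_invariant G : continuous G ->
  conserved D (fun p => a p * G p) (fun p => - (v p * G p)) ->
  forall x1 x2 p, 0 <= p <= mass_flux -> G (flow (x1, p)) = G (flow (x2, p)).
Proof.
move=> cG cons x1 x2.
wlog x12 : x1 x2 / x1 < x2.
  by move=> H p hp; have [/H->|/H->|->] := ltgtP x1 x2.
have cfl := flow_cont.
have c1 : continuous (fun p => a p * G p) by cont.
have c2 : continuous (fun p => - (v p * G p)) by cont.
have cd : continuous (fun p => G (flow (x2, p)) - G (flow (x1, p))) by cont.
suff H : forall p, 0 < p < mass_flux -> G (flow (x2, p)) - G (flow (x1, p)) = 0.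
  move=> p hp; have := cont_ext_closed cd mass_flux_gt0 H hp; lra.
move=> p /andP[p0 pm].
pose p1 := p / 2; have p10 : 0 < p1 by rewrite /p1; lra.
have p1p : p1 < p by rewrite /p1; lra.
apply: (oint_zero_fun cd p1p _ (x := p)); last by rewrite lexx ltW.
move=> t; rewrite le_eqVlt => /andP[/orP[/eqP <- _|p1t tp]]; first exact: ointaa.
have := conserved_strip c1 c2 cons x12 p10 p1t (le_lt_trans tp pm); cbv beta zeta.
rewrite [X in _ + X]oint_eq0 ?(ltW x12)//.
- rewrite addr0 => <-; apply: congr_oint => s.
  by rewrite ![a _ * G _]mulrC !mulfK ?a_neq0.
- have cinv q : continuous (fun s : R => (a (flow (s, q)))^-1).
    by apply: contV => [s|]; [exact: a_neq0|cont].
  by have ct := cinv t; have cp := cinv p1; cont.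
- move=> s _.
  have E q : a q * G q * v q / a q - v q * G q = 0.
    by have := a_neq0 q; move: (a q) (G q) (v q) => A B C A0; field.
  by rewrite !E subrr.
Qed.

(** For the vertical momentum, the fluxes in streamline labels are [v] and [- Q]. *)
Lemma pressure_balance Q : continuous Q ->
  conserved D (fun p => a p * v p) (fun p => - (v p * v p + Q p)) ->
  forall x1 x2 p, x1 < x2 -> 0 <= p <= mass_flux ->
  oint (fun s => Q (flow (s, mass_flux)) - Q (flow (s, p))) x1 x2 =
  oint (fun t => v (flow (x2, t)) - v (flow (x1, t))) p mass_flux.
Proof.
move=> cQ cons x1 x2 p x12 pm.
have cfl := flow_cont; have m0 := mass_flux_gt0; set m := mass_flux in pm m0 *.
have c1 : continuous (fun p => a p * v p) by cont.
have c2 : continuous (fun p => - (v p * v p + Q p)) by cont.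
pose F q p := oint (fun s => Q (flow (s, q)) - Q (flow (s, p))) x1 x2 -
  oint (fun t => v (flow (x2, t)) - v (flow (x1, t))) p q.
have inner q p' : 0 < p' -> p' < q -> q < m -> F q p' = 0.
  move=> p0 pq qm; have := conserved_strip c1 c2 cons x12 p0 pq qm; cbv beta zeta.
  have E1 q' : a q' * v q' / a q' = v q' by rewrite mulrC mulKf ?a_neq0.
  have E2 q' : a q' * v q' * v q' / a q' - (v q' * v q' + Q q') = - Q q'.
    by have := a_neq0 q'; move: (a q') (Q q') (v q') => A B C A0; field.
  under [X in oint X p' q + _]eq_fun do rewrite !E1.
  under [X in _ + oint X x1 x2]eq_fun do rewrite !E2.
  have -> : (fun s => - Q (flow (s, q)) - - Q (flow (s, p'))) =
      (fun s => -1 * (Q (flow (s, q)) - Q (flow (s, p')))) by apply/funext => s; ring.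
  rewrite ointZ /F; [lra|by cont].
have cFq p' : continuous (F^~ p').
  by apply: contD; [apply: cont_oint; cont|apply: contN; apply: cont_oint; cont].
have cFp q : continuous (F q).
  by apply: contD; [apply: cont_oint; cont|apply: contN; apply: cont_oint; cont].
have atm p' : 0 < p' < m -> F m p' = 0.
  move=> /andP[p0 pm']; apply: (cont_ext_closed (cFq p') pm' _ (x := m)).
    by move=> q /andP[pq qm]; exact: inner.
  by rewrite lexx ltW.
have := cont_ext_closed (cFp m) m0 atm pm; rewrite /F; lra.
Qed.

End Flow.

(** * The integral inequality *)

Section Core.
Context {R : realType}.

(** The convex function [z |-> z^(-1/2)] lies above its tangent at [t^2]; here
    [z = s^2]. *)
Lemma cubic_convexity (s t : R) : 0 < s -> 0 < t ->
  (t ^+ 3)^-1 * ((t ^+ 2 - s ^+ 2) / 2) <= s^-1 - t^-1.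
Proof.
move=> s0 t0; rewrite -subr_ge0.
have -> : s^-1 - t^-1 - (t ^+ 3)^-1 * ((t ^+ 2 - s ^+ 2) / 2) =
    (t - s) ^+ 2 * (s + 2 * t) / (2 * s * t ^+ 3).
  by field; rewrite !gt_eqF.
apply: divr_ge0; first by apply: mulr_ge0; [exact: sqr_ge0|lra].
by apply: mulr_ge0; [lra|apply: exprn_ge0; exact: ltW].
Qed.

Variables (g d m delta : R) (A eta : R -> R) (a v Q : R * R -> R).
Hypotheses (g0 : 0 < g) (m0 : 0 < m) (delta0 : 0 < delta).
Hypotheses (cA : continuous A) (ceta : continuous eta).
Hypotheses (ca : continuous a) (cv : continuous v) (cQ : continuous Q).
Hypotheses (a_ge : forall q, delta <= a q) (A_ge : forall p, delta <= A p).
Hypothesis (bernoulli : forall x1 x2 p, 0 <= p <= m ->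
  Q (x1, p) + 2^-1 * (a (x1, p) * a (x1, p) + v (x1, p) * v (x1, p)) =
  Q (x2, p) + 2^-1 * (a (x2, p) * a (x2, p) + v (x2, p) * v (x2, p))).
Hypothesis (balance : forall x1 x2 p, x1 < x2 -> 0 <= p <= m ->
  oint (fun s => Q (s, m) - Q (s, p)) x1 x2 = oint (fun t => v (x2, t) - v (x1, t)) p m).
Hypothesis (surface : forall x, Q (x, m) = g * eta x).
Hypothesis (depth : forall x, oint (fun p => (a (x, p))^-1) 0 m = eta x + d).
Hypothesis (depth0 : oint (fun p => (A p)^-1) 0 m = d).
Hypothesis (a_lim : forall p, 0 <= p <= m -> forall e, 0 < e ->
  exists M, forall x, M <= x -> `|a (x, p) - A p| <= e).
Hypothesis (v_lim : forall e, 0 < e -> exists M, forall x, M <= `|x| ->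
  forall p, 0 <= p <= m -> `|v (x, p)| <= e).
Hypothesis (eta_lim : forall e, 0 < e -> exists M, forall x, M <= x -> `|eta x| <= e).

Let a0 q : a q != 0. Proof. by rewrite gt_eqF// (lt_le_trans delta0). Qed.
Let A0 p : A p != 0. Proof. by rewrite gt_eqF// (lt_le_trans delta0). Qed.

(** By Bernoulli the two sides differ by a constant [b] along the streamline. Over
    a unit interval of large [x], the mean of [Q] on it is close to the mean of
    [g eta] on the surface, by the vertical momentum balance. Both this and the
    right side tend to [0], so that [b = 0]. *)
Lemma pressure_formula x p : 0 <= p <= m ->
  Q (x, p) = 2^-1 * (A p ^+ 2 - a (x, p) ^+ 2 - v (x, p) ^+ 2).
Proof.
move=> pm.
pose b := Q (0, p) + 2^-1 * (a (0, p) * a (0, p) + v (0, p) * v (0, p)) - 2^-1 * A p ^+ 2.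
have QE s : Q (s, p) = b + 2^-1 * (A p ^+ 2 - a (s, p) ^+ 2 - v (s, p) ^+ 2).
  have := bernoulli s 0 pm; rewrite /b !expr2.
  move: (Q (s, p)) (Q (0, p)) (a (s, p)) (a (0, p)) (v (s, p)) (v (0, p)) (A p).
  move=> q1 q2 a1 a2 v1 v2 A1 E.
  have -> : q1 = q2 + 2^-1 * (a2 * a2 + v2 * v2) - 2^-1 * (a1 * a1 + v1 * v1) by rewrite -E addrK.
  by field.
suff b0 : b = 0 by rewrite QE b0 add0r.
pose C := A p + 1 + g + 2 * m.
have Ap0 : 0 < A p by rewrite (lt_le_trans delta0).
have C0 : 0 < C by rewrite /C !addr_gt0 ?mulr_gt0.
have small e : 0 < e -> e <= 1 -> `|b| <= C * e.
  move=> e0 e1.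
  have [M1 H1] := a_lim pm e0; have [M2 H2] := v_lim e0; have [M3 H3] := eta_lim e0.
  pose X := Num.max (`|M1| + `|M2| + `|M3|) 0.
  have X0 : 0 <= X by rewrite le_max lexx orbT.
  have XM : `|M1| + `|M2| + `|M3| <= X by rewrite le_max lexx.
  move: (ler_norm M1) (ler_norm M2) (ler_norm M3) (normr_ge0 M1) (normr_ge0 M2) (normr_ge0 M3) => n1 n2 n3 n4 n5 n6.
  have hv s t : X <= s -> 0 <= t <= m -> `|v (s, t)| <= e.
    by move=> Xs tm; apply: H2 => //; rewrite ger0_norm; lra.
  have X1 : X < X + 1 by lra.
  have bal := balance X1 pm.
  have cQs t : continuous (fun s => Q (s, t)) by cont.
  have cvs s : continuous (fun t => v (s, t)) by cont.
  have rhs : `|oint (fun t => v (X + 1, t) - v (X, t)) p m| <= 2 * e * m.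
    case/andP: (pm) => p0 pm'.
    apply: le_trans (@oint_bound _ _ (2 * e) p m _ pm' _) _.
    - by have c1 := cvs (X + 1); have c2 := cvs X; cont.
    - move=> t /andP[pt tm]; have tt : 0 <= t <= m by rewrite tm (le_trans p0).
      have := hv _ _ (lexx X) tt; have := hv _ _ (ltW X1) tt.
      by rewrite !ler_norml => /andP[? ?] /andP[? ?]; apply/andP; split; lra.
    - by nra.
  have lhs : `|oint (fun s => b + (Q (s, m) - Q (s, p))) X (X + 1)| <= (A p + 1 + g) * e.
    have -> : (A p + 1 + g) * e = (A p + 1 + g) * e * (X + 1 - X) by ring.
    apply: oint_bound (ltW X1) _; first by have c1 := cQs m; have c2 := cQs p; cont.
    move=> s /andP[Xs _]; rewrite QE surface.
    have hvs := hv s p Xs pm.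
    have has : `|a (s, p) - A p| <= e by apply: H1; lra.
    have hes : `|eta s| <= e by apply: H3; lra.
    move: hvs has hes (a_ge (s, p)); set w := v (s, p); set z := a (s, p); set y := eta s.
    rewrite !ler_norml => /andP[w1 w2] /andP[z1 z2] /andP[y1 y2] zd.
    have Z : - (2 * A p + 1) * e <= A p ^+ 2 - z ^+ 2 <= (2 * A p + 1) * e.
      have -> : A p ^+ 2 - z ^+ 2 = (A p - z) * (A p + z) by ring.
      by apply/andP; split; nra.
    have W : 0 <= w ^+ 2 <= e by rewrite sqr_ge0/=; nra.
    have Y : - (g * e) <= g * y <= g * e.
      by rewrite -mulrN !ler_pM2l// y1 y2.
    move: Z W Y => /andP[? ?] /andP[? ?] /andP[? ?].
    by apply/andP; split; lra.
  have cb : continuous (fun _ : R => b) by exact: cont_cst.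
  have cd : continuous (fun s => Q (s, m) - Q (s, p)) by have c1 := cQs m; have c2 := cQs p; cont.
  move: lhs; rewrite ointD// oint_cst bal addrAC subrr add0r mulr1.
  move: rhs; set I := oint _ p m; rewrite /C !ler_norml => /andP[? ?] /andP[? ?].
  by apply/andP; split; nra.
apply: (@eq_eps _ _ _ C) => e e0; rewrite subr0.
have [e1|/ltW e1] := leP e 1; first exact: small.
by apply: le_trans (small 1 ltr01 (lexx 1)) _; rewrite mulr1; nra.
Qed.

(** In terms of the height this is the integral of [A^-2], because [dp = A dy]
    ([kappa_profile]); for a solitary wave it is [1 / (g F^2)]. *)
Definition kappa : R := oint (fun p => (A p ^+ 3)^-1) 0 m.

Let cA3 : continuous (fun p => (A p ^+ 3)^-1).
Proof. by apply: contV => [p|]; [rewrite expf_neq0|cont]. Qed.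

Let A3_gt0 p : 0 < (A p ^+ 3)^-1.
Proof. by rewrite invr_gt0 exprn_gt0// (lt_le_trans delta0). Qed.

Definition kinetic (q : R * R) : R := (A q.2 ^+ 3)^-1 * (2^-1 * v q ^+ 2).

Let ckin : continuous kinetic.
Proof.
have c : continuous (fun q : R * R => (A q.2 ^+ 3)^-1) by exact: (cont_comp cA3 (@cont_snd _ _)).
by rewrite /kinetic; cont.
Qed.

Let kin_ge0 q : 0 <= kinetic q.
Proof. by rewrite /kinetic mulr_ge0 ?(ltW (A3_gt0 _))// mulr_ge0 ?sqr_ge0// invr_ge0. Qed.

Definition energy (M : R) : R := oint (fun x => oint (fun p => kinetic (x, p)) 0 m) (- M) M.

(** Multiply the pressure balance by [A^-3] and integrate it over the streamlines,
    then compare with the convexity inequality integrated over [- M <= x <= M]. *)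
Lemma truncated_inequality M e : 0 < M ->
  (forall p, 0 <= p <= m -> `|v (M, p)| <= e /\ `|v (- M, p)| <= e) ->
  energy M - kappa * (2 * e * m) <= (1 - g * kappa) * oint eta (- M) M.
Proof.
move=> M0 ve; have MM : - M < M by lra.
have cQs t : continuous (fun s => Q (s, t)) by cont.
have cvs s : continuous (fun t => v (s, t)) by cont.
have cai x : continuous (fun p => (a (x, p))^-1) by apply: contV => [p|]; [exact: a0|cont].
have cAi : continuous (fun p => (A p)^-1) by apply: contV => [p|].
have cks x : continuous (fun p => kinetic (x, p)) by cont.
set N := oint eta (- M) M.
(* Compare the streamline [p] with the surface, where [Q = g eta]. *)
have work p : 0 <= p <= m -> g * N - 2 * e * m <= oint (fun s => Q (s, p)) (- M) M.
  move=> pm; have := balance MM pm.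
  have cgm := cQs m; have cgp := cQs p.
  rewrite ointB// (_ : (fun s => Q (s, m)) = (fun s => g * eta s)); last exact/funext.
  rewrite ointZ// -/N => E.
  have : `|oint (fun t => v (M, t) - v (- M, t)) p m| <= 2 * e * m.
    case/andP: (pm) => p0 pm'.
    apply: le_trans (@oint_bound _ _ (2 * e) p m _ pm' _) _.
    - by have c1 := cvs M; have c2 := cvs (- M); cont.
    - move=> t /andP[pt tm]; have [] := ve t; first by rewrite tm (le_trans p0).
      by rewrite !ler_norml => /andP[? ?] /andP[? ?]; apply/andP; split; lra.
    - have := ve p pm; move=> [/(le_trans (normr_ge0 _)) e0 _]; nra.
  rewrite -E ler_norml => /andP[? ?]; lra.
have low : (g * N - 2 * e * m) * kappa <=
    oint (fun p => (A p ^+ 3)^-1 * oint (fun s => Q (s, p)) (- M) M) 0 m.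
  have cI : continuous (fun p => oint (fun s => Q (s, p)) (- M) M) by apply: cont_oint; cont.
  rewrite /kappa -ointZ//; apply: le_oint; [by cont|by cont|exact: ltW|].
  by move=> p /work h; rewrite mulrC ler_pM2l.
have swap : oint (fun p => (A p ^+ 3)^-1 * oint (fun s => Q (s, p)) (- M) M) 0 m =
    oint (fun s => oint (fun p => (A p ^+ 3)^-1 * Q (s, p)) 0 m) (- M) M.
  rewrite (oint_swap (f := fun s p => (A p ^+ 3)^-1 * Q (s, p))); last first.
    have c : continuous (fun z : R * R => (A z.2 ^+ 3)^-1) by exact: (cont_comp cA3 (@cont_snd _ _)).
    by apply: contM => //; apply: (cont_comp (g := fun z => (z.1, z.2)) cQ); cont.
  by apply: congr_oint => p; rewrite ointZ.
have up s : oint (fun p => (A p ^+ 3)^-1 * Q (s, p)) 0 m <= eta s - oint (fun p => kinetic (s, p)) 0 m.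
  have cas := cai s; have ckss := cks s; have cQp : continuous (fun p => Q (s, p)) by cont.
  have -> : eta s = oint (fun p => (a (s, p))^-1 - (A p)^-1) 0 m.
    by rewrite ointB// depth depth0; lra.
  rewrite -ointB//; last by cont.
  apply: le_oint; [by cont|by cont|exact: ltW|].
  move=> p pm; rewrite (pressure_formula s pm) /kinetic /=.
  have := cubic_convexity (lt_le_trans delta0 (a_ge (s, p))) (lt_le_trans delta0 (A_ge p)).
  move: (A p ^+ 3)^-1 (a (s, p))^-1 (A p)^-1 => k3 k1 k2; lra.
have cK : continuous (fun s => oint (fun p => kinetic (s, p)) 0 m) by apply: cont_oint; cont.
have up2 : oint (fun s => oint (fun p => (A p ^+ 3)^-1 * Q (s, p)) 0 m) (- M) M <= N - energy M.
  rewrite /N /energy -ointB//; apply: le_oint; [|by cont|exact: ltW|by move=> s _; exact: up].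
  apply: cont_oint; [|exact: cont_cst|exact: cont_cst].
  have c : continuous (fun z : R * R => (A z.2 ^+ 3)^-1) by exact: (cont_comp cA3 (@cont_snd _ _)).
  by apply: contM => //; apply: (cont_comp (g := fun z => (z.1, z.2)) cQ); cont.
by move: low up2; rewrite swap; move: (oint _ (- M) M) (energy M) kappa => i E k; lra.
Qed.

Lemma kappa_gt0 : 0 < kappa.
Proof.
have k0 : 0 <= kappa by apply: oint_ge0 => // [|p _]; [exact: ltW|exact: ltW].
rewrite lt_neqAle k0 andbT; apply/eqP => /esym z.
have := oint_ge0_eq0 cA3 m0 (fun p _ => ltW (A3_gt0 p)) z (x := 0).
by rewrite lexx (ltW m0) => /(_ isT)/eqP; rewrite (gt_eqF (A3_gt0 0)).
Qed.

Lemma energy_mono M1 M2 : 0 <= M1 -> M1 <= M2 -> energy M1 <= energy M2.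
Proof.
move=> M10 M12; rewrite /energy; set f := fun x => _.
have cf : continuous f by rewrite /f; apply: cont_oint; cont.
have f0 x : 0 <= f x by apply: oint_ge0 => [||p _]; [cont|exact: ltW|exact: kin_ge0].
rewrite -(oint_cat f (- M2) (- M1) M2) -(oint_cat f (- M1) M1 M2).
have := @oint_ge0 _ f (- M2) (- M1) cf _ (fun x _ => f0 x).
have := @oint_ge0 _ f M1 M2 cf M12 (fun x _ => f0 x).
by move=> h1 /(_ ltac:(lra)) h2; lra.
Qed.

Lemma energy_gt0 x0 p0 : 0 <= p0 <= m -> v (x0, p0) != 0 -> 0 < energy (`|x0| + 1).
Proof.
move=> pm v0; set M := `|x0| + 1.
have M0 : 0 < M by rewrite /M ltr_wpDl.
pose f x := oint (fun p => kinetic (x, p)) 0 m.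
have cf : continuous f by apply: cont_oint; cont.
have cks : continuous (fun p => kinetic (x0, p)) by cont.
have f0 x : 0 <= f x by apply: oint_ge0 => [||p _]; [cont|exact: ltW|exact: kin_ge0].
have MM : - M < M by lra.
rewrite lt_neqAle (oint_ge0 cf (ltW MM) (fun x _ => f0 x)) andbT; apply/eqP => /esym z.
have xM : - M <= x0 <= M by rewrite -ler_norml /M lerDl.
have := oint_ge0_eq0 cf MM (fun x _ => f0 x) z xM.
move=> /(oint_ge0_eq0 cks m0 (fun p _ => kin_ge0 _))/(_ p0 pm)/eqP.
by rewrite /kinetic expr2 !mulf_eq0 (gt_eqF (A3_gt0 _)) invr_eq0 pnatr_eq0 (negPf v0).
Qed.

(** The energy grows with [M] and is positive as soon as the point where [v] is
    nonzero lies within reach; [e] makes the boundary term half that energy. *)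
Lemma elevation_gap x0 p0 : 0 <= p0 <= m -> v (x0, p0) != 0 ->
  exists M, 0 < M /\ 0 < (1 - g * kappa) * oint eta (- M) M.
Proof.
move=> pm v0; have E0 := energy_gt0 pm v0; set M0 := `|x0| + 1 in E0.
have M00 : 0 < M0 by rewrite /M0 ltr_wpDl.
have k0 := kappa_gt0.
have C0 : 0 < kappa * 2 * m by rewrite !mulr_gt0.
pose e := energy M0 / (2 * (kappa * 2 * m)).
have e0 : 0 < e by rewrite divr_gt0// mulr_gt0.
have [M1 H1] := v_lim e0.
pose M := Num.max M0 M1; have MM0 : M0 <= M by rewrite le_max lexx.
have MM1 : M1 <= M by rewrite le_max lexx orbT.
have Mpos : 0 < M by exact: lt_le_trans MM0.
exists M; split => //.
have := @truncated_inequality M e Mpos.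
have ve p : 0 <= p <= m -> `|v (M, p)| <= e /\ `|v (- M, p)| <= e.
  by move=> hp; split; apply: H1 => //; rewrite ?normrN gtr0_norm.
move=> /(_ ve); apply: lt_le_trans.
have -> : kappa * (2 * e * m) = energy M0 / 2.
  by rewrite /e; field; rewrite !gt_eqF.
by have := energy_mono (ltW M00) MM0; lra.
Qed.

End Core.

(** * The far field in streamline coordinates *)

Section Streamlines.
Context {R : realType}.
Variables (g d delta : R) (eta deta Abar : R -> R) (a v Q : R * R -> R).
Hypotheses (g0 : 0 < g) (d0 : 0 < d) (delta0 : 0 < delta) (etad : forall x, - d < eta x).
Hypotheses (etaE : forall x, is_derive x (1 : R) eta (deta x)) (cdeta : continuous deta).
Hypotheses (ca : continuous a) (cv : continuous v) (cQ : continuous Q).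
Hypotheses (cAbar : continuous Abar).
Hypotheses (a_ge : forall p, delta <= a p) (Abar_ge : forall y, delta <= Abar y).
Hypotheses (bed : forall x, v (x, - d) = 0).
Hypotheses (kinematic : forall x, v (x, eta x) + a (x, eta x) * deta x = 0).
Hypotheses (dynamic : forall x, Q (x, eta x) = g * eta x).
Let D := fluid d eta.
Let G p := Q p + 2^-1 * (a p * a p + v p * v p).
Hypothesis (mass : conserved D a (fun p => - v p)).
Hypothesis (momentum : conserved D (fun p => a p * v p) (fun p => - (v p * v p + Q p))).
Hypothesis (energy_law : conserved D (fun p => a p * G p) (fun p => - (v p * G p))).
Hypothesis (a_asym : forall e, 0 < e -> exists M, forall x, M <= x ->
  forall y, - d <= y <= eta x -> `|a (x, y) - Abar y| <= e).
Hypothesis (v_asym : forall e, 0 < e -> exists M, forall x, M <= `|x| ->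
  forall y, - d <= y <= eta x -> `|v (x, y)| <= e).
Hypothesis (eta_asym : forall e, 0 < e -> exists M, forall x, M <= x -> `|eta x| <= e).

Let ceta : continuous eta. Proof. exact: der_cont etaE. Qed.

(* The shear flow at infinity is described by the same stream function and
   height, for a relative speed independent of [x]. *)
Let ab (q : R * R) : R := Abar q.2.
Let cab : continuous ab. Proof. exact: cont_comp cAbar (@cont_snd _ _). Qed.
Let ab_ge q : delta <= ab q. Proof. exact: Abar_ge. Qed.

Let m := mass_flux d eta a.
Let Psi y := psi d ab (0, y).
Let H p := height d ab (0, p).
Let F := flow d a.

Let m0 : 0 < m. Proof. exact: mass_flux_gt0 a_ge. Qed.

Let Psi_cont : continuous Psi.
Proof. by have c := @psi_cont _ d _ cab; rewrite /Psi; cont. Qed.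

Let H_cont : continuous H.
Proof. by have c := @height_cont _ d _ _ delta0 cab ab_ge; rewrite /H; cont. Qed.

Let F_cont : continuous F. Proof. exact: flow_cont a_ge. Qed.

Let Psi_H p : Psi (H p) = p.
Proof. exact: (@psi_height _ d _ _ delta0 cab ab_ge (0, p)). Qed.

Let H_Psi y : H (Psi y) = y.
Proof. exact: (@height_psi _ d _ _ delta0 cab ab_ge 0 y). Qed.

Let Psi_dist y1 y2 : delta * `|y1 - y2| <= `|Psi y1 - Psi y2|.
Proof. exact: (@height_dist _ d _ _ cab ab_ge 0 y1 y2). Qed.

Let height_itv x p : 0 <= p <= m -> - d <= height d a (x, p) <= eta x.
Proof.
move=> /andP[p0 pm].
rewrite -(height_bed d delta0 ca a_ge x).
rewrite -[X in _ && (_ <= X)](@height_surface _ d delta eta deta a v)//.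
by rewrite !(height_le _ delta0 ca a_ge) p0.
Qed.

Lemma eventually2 (P1 P2 : R -> Prop) :
  (exists M, forall x, M <= x -> P1 x) -> (exists M, forall x, M <= x -> P2 x) ->
  exists M, forall x, M <= x -> P1 x /\ P2 x.
Proof.
move=> [M1 H1] [M2 H2]; exists (Num.max M1 M2) => x.
by rewrite ge_max => /andP[h1 h2]; split; [apply: H1|apply: H2].
Qed.

Lemma psi_asym e : 0 < e -> exists M, forall x, M <= x ->
  forall y, - d <= y <= eta x -> `|psi d a (x, y) - Psi y| <= e.
Proof.
move=> e0; have d1 : 0 < 1 + d by move: d0; lra.
have e1 : 0 < e / (1 + d) by exact: divr_gt0.
have [M HM] := eventually2 (a_asym e1) (eta_asym ltr01).
exists M => x /HM[h1 h2] y /andP[y1 y2].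
have c1 : continuous (fun t => a (x, t)) by cont.
have c2 : continuous (fun t => ab (0, t)) by cont.
rewrite /psi /= -ointB//.
apply: le_trans (@oint_bound _ _ (e / (1 + d)) _ _ _ y1 _) _; first by cont.
  by move=> t /andP[t1 t2]; apply: h1; rewrite t1 (le_trans t2).
move: h2; rewrite ler_norml => /andP[_ h2].
rewrite mulrAC ler_pdivrMr// ler_pM2l//; lra.
Qed.

(** The flux through a vertical section is independent of the section, and near
    infinity it is close to that of the shear flow. *)
Lemma flux_eq : m = Psi 0.
Proof.
apply: (@eq_eps _ _ _ 2) => e e0.
have /cvgrPdist_le/(_ _ e0)/nbhs_ballP[r /= r0 Hr] := @Psi_cont 0.
have r2 : 0 < r / 2 by lra.
have [M HM] := eventually2 (psi_asym e0) (eta_asym r2).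
have [h1 h2] := HM M (lexx M).
have := h1 (eta M); rewrite lexx ltW// => /(_ isT).
rewrite (@psi_eta _ d eta deta a v)// -/m => k1.
have k2 : `|Psi 0 - Psi (eta M)| <= e by apply: Hr; rewrite /ball/= sub0r normrN; lra.
move: k1 k2; rewrite !ler_norml => /andP[? ?] /andP[? ?]; apply/andP; split; lra.
Qed.

(** The stream function has slope at least [delta] in [y], so that convergence of
    stream functions implies convergence of heights. *)
Lemma height_asym p e : 0 <= p <= m -> 0 < e ->
  exists M, forall x, M <= x -> `|height d a (x, p) - H p| <= e.
Proof.
move=> pm e0; have de : 0 < delta * e by exact: mulr_gt0.
have [M HM] := psi_asym de; exists M => x /HM h.
have := h _ (height_itv x pm).
have -> : psi d a (x, height d a (x, p)) = p by exact: (psi_height _ delta0 ca a_ge (x, p)).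
rewrite -{1}(Psi_H p) distrC => k.
by rewrite -(ler_pM2l delta0); exact: le_trans (Psi_dist _ _) k.
Qed.

Lemma a_flow_asym p : 0 <= p <= m -> forall e, 0 < e ->
  exists M, forall x, M <= x -> `|a (F (x, p)) - Abar (H p)| <= e.
Proof.
move=> pm e e0; have e2 : 0 < e / 2 by lra.
have /cvgrPdist_le/(_ _ e2)/nbhs_ballP[r /= r0 Hr] := @cAbar (H p).
have r2 : 0 < r / 2 by lra.
have [M HM] := eventually2 (height_asym pm r2) (a_asym e2).
exists M => x /HM[h1 h2].
have k1 := h2 _ (height_itv x pm).
have k2 : `|Abar (H p) - Abar (height d a (x, p))| <= e / 2.
  by apply: Hr; rewrite /ball/= distrC; lra.
rewrite /F /flow /=.
move: k1 k2; rewrite !ler_norml => /andP[? ?] /andP[? ?]; apply/andP; split; lra.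
Qed.

Let ab0 y : Abar y != 0. Proof. by rewrite gt_eqF// (lt_le_trans delta0). Qed.
Let a0 q : a q != 0. Proof. by rewrite gt_eqF// (lt_le_trans delta0). Qed.

Lemma depth_flow x : oint (fun p => (a (F (x, p)))^-1) 0 m = eta x + d.
Proof.
have cf : continuous (fun p => (a (F (x, p)))^-1) by apply: contV => [p|]; [exact: a0|cont].
have := @oint_psi _ d a ca _ x (- d) (eta x) cf.
rewrite psi_bed (@psi_eta _ d eta deta a v)// -/m => <-.
transitivity (oint (fun=> 1 : R) (- d) (eta x)); last by rewrite oint_cst; lra.
apply: congr_oint => y.
have -> : F (x, psi d a (x, y)) = (x, y) by exact: (flow_psi _ delta0 ca a_ge (x, y)).
by rewrite mulVf.
Qed.

Lemma profile_oint (f : R -> R) : continuous f ->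
  oint (fun p => f (H p)) 0 m = oint (fun y => f y * Abar y) (- d) 0.
Proof.
move=> cf; have cfH : continuous (fun p => f (H p)) by cont.
have := @oint_psi _ d ab cab _ 0 (- d) 0 cfH.
rewrite psi_bed -/(Psi 0) -flux_eq => <-.
by apply: congr_oint => y; rewrite -/(Psi y) H_Psi.
Qed.

Lemma depth_profile : oint (fun p => (Abar (H p))^-1) 0 m = d.
Proof.
have ci : continuous (fun y => (Abar y)^-1) by apply: contV.
rewrite (profile_oint ci); transitivity (oint (fun=> 1 : R) (- d) 0); last by rewrite oint_cst; lra.
by apply: congr_oint => y; rewrite mulVf.
Qed.

Lemma kappa_profile : kappa m (fun p => Abar (H p)) = oint (fun y => (Abar y ^+ 2)^-1) (- d) 0.
Proof.
have ci : continuous (fun y => (Abar y ^+ 3)^-1).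
  by apply: contV => [y|]; [rewrite expf_neq0|cont].
rewrite /kappa (profile_oint ci); apply: congr_oint => y.
by rewrite exprS invfM mulrAC mulVf// mul1r.
Qed.

Lemma wave_gap q : - d <= q.2 <= eta q.1 -> v q != 0 ->
  exists M, 0 < M /\ 0 < (1 - g * oint (fun y => (Abar y ^+ 2)^-1) (- d) 0) * oint eta (- M) M.
Proof.
move=> qD vq; rewrite -kappa_profile.
have cG : continuous G by rewrite /G; cont.
have cAH : continuous (fun p => Abar (H p)) by cont.
have caF : continuous (fun q => a (F q)) by cont.
have cvF : continuous (fun q => v (F q)) by cont.
have cQF : continuous (fun q => Q (F q)) by cont.
pose x0 := q.1; pose p0 := psi d a q.
have qE : F (x0, p0) = q by exact: (flow_psi _ delta0 ca a_ge q).
have p0m : 0 <= p0 <= m.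
  case/andP: qD => q1 q2; rewrite /p0 [q]surjective_pairing.
  rewrite -{1}(psi_bed d a q.1) /m -(@psi_eta _ d eta deta a v _ _ _ _ _ _ _ _ q.1)//.
  by rewrite !(psi_le _ delta0 ca a_ge) q1.
apply: (@elevation_gap _ g d m delta (fun p => Abar (H p)) eta (fun q => a (F q))
  (fun q => v (F q)) (fun q => Q (F q)) g0 m0 delta0 cAH ceta caF cvF cQF
  (fun q => a_ge (F q)) (fun p => Abar_ge (H p)) _ _ _ depth_flow depth_profile a_flow_asym
  _ eta_asym x0 p0 p0m); last by rewrite qE.
- move=> x1 x2 p pm.
  exact: (@streamline_invariant _ d delta eta deta a v delta0 etad etaE cdeta ca cv a_ge bed kinematic mass G cG energy_law x1 x2 p pm).
- move=> x1 x2 p x12 pm.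
  exact: (@pressure_balance _ d delta eta deta a v delta0 etad etaE cdeta ca cv a_ge bed kinematic mass Q cQ momentum x1 x2 p x12 pm).
- move=> x; rewrite -dynamic; congr Q; rewrite /F /flow /=; congr pair.
  exact: (@height_surface _ d delta eta deta a v delta0 etad etaE cdeta ca cv a_ge bed kinematic mass x).
- move=> e e0; have [M HM] := v_asym e0; exists M => x /HM h p pm.
  by apply: h; exact: height_itv.
Qed.

(** When [v = 0] the kinematic condition makes [eta] constant, hence zero. Mass
    conservation then makes [a] independent of [x], hence equal to its limit. *)
Lemma still_wave : (forall q, - d <= q.2 <= eta q.1 -> v q = 0) ->
  (forall x, eta x = 0) /\ forall x y, - d <= y <= 0 -> a (x, y) = Abar y.
Proof.
move=> v0.
have deta0 x : deta x = 0.
  have := kinematic x; rewrite v0 /= ?lexx ?ltW// add0r => /eqP.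
  by rewrite mulf_eq0 (negPf (a0 _)) => /eqP.
have eta0 x : eta x = 0.
  apply: (@eq_eps _ _ _ 1) => e e0; rewrite subr0 mul1r.
  have [M HM] := eta_asym e0.
  have dz z : is_derive z (1 : R) eta 0 by have := etaE z; rewrite deta0.
  by rewrite (@is_derive_0_is_cst _ eta x M dz); exact: HM.
split => // x y yd.
have same x1 x2 z : - d <= z <= 0 -> a (x2, z) = a (x1, z).
  wlog x12 : x1 x2 / x1 < x2.
    by move=> W hz; have [/W->|/W->|->] := ltgtP x1 x2.
  have dn : - d < 0 by move: d0; lra.
  have c1 : continuous (fun t => a (x1, t)) by cont.
  have c2 : continuous (fun t => a (x2, t)) by cont.
  have cf : continuous (fun t => a (x2, t) - a (x1, t)) by cont.
  have cF2 : continuous (fun t => psi d a (x2, t) - psi d a (x1, t)).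
    by have cp := @psi_cont _ d _ ca; cont.
  have open_case t : - d < t < 0 -> psi d a (x2, t) - psi d a (x1, t) = 0.
    move=> /andP[t1 t2].
    have eta_gt s : x1 <= s <= x2 -> t < eta s by rewrite eta0.
    rewrite (@psi_horizontal _ d eta a v ca cv bed mass x1 x2 t x12 t1 eta_gt).
    apply: oint_eq0; [by cont| |exact: ltW].
    by move=> s _; apply: v0; rewrite /= eta0 !ltW.
  have Z t : - d <= t <= 0 -> oint (fun t => a (x2, t) - a (x1, t)) (- d) t = 0.
    by move=> tt; rewrite ointB//; exact: (cont_ext_closed cF2 dn open_case tt).
  by move=> hz; have := oint_zero_fun cf dn Z hz; lra.
apply: (@eq_eps _ _ _ 1) => e e0; rewrite mul1r.
have [M HM] := a_asym e0.
by rewrite (same M x y yd); apply: HM; rewrite ?lexx// eta0.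
Qed.

End Streamlines.

(** * Solitary waves and the Froude number *)

Lemma unif_bound {R : realType} (D : set (R * R)) (u : R * R -> R) (c : R) :
  (ereal_sup [set (u p)%:E | p in D] < c%:E)%E -> exists2 b, b < c & forall p, D p -> u p <= b.
Proof.
move=> H; have ub p : D p -> ((u p)%:E <= ereal_sup [set (u p)%:E | p in D])%E.
  by move=> Dp; apply: ereal_sup_ubound; exists p.
move: H ub; case: (ereal_sup _) => [s|//|] H ub.
  by exists s => [|p /ub]; rewrite ?lee_fin// -lte_fin.
(* The supremum is [-oo]. *)
exists (c - 1) => [|p /ub]; first by rewrite gtrBl.
by rewrite leNgt ltNyr.
Qed.

Section Wave.
Context {R : realType}.
Variables (g d c alpha r : R) (eta : R -> R) (u v P : R * R -> R) (U : R -> R).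
Hypotheses (g0 : 0 < g) (d0 : 0 < d) (alpha0 : 0 < alpha) (r1 : 1 <= r).
Hypothesis wave : solitary_wave g d c r eta u v P U.
Hypothesis regular : regular_wave d alpha r eta u v P U.
Let D := fluid d eta.
Let cl := clamp d eta.
Let ue p := u (cl p).
Let ve p := v (cl p).
Let Pe p := P (cl p).
Let Ue y := U (Num.max (- d) (Num.min y 0)).
Let a p := c - ue p.
Let Q p := Pe p + g * p.2.

Let etad x : - d < eta x. Proof. exact: sw_depth wave x. Qed.

Let etaE x : is_derive x (1 : R) eta (eta^`()%classic x).
Proof. by have [h _ _] := rw_eta regular; rewrite derive1E; exact: derivableP. Qed.

Let cdeta : continuous (eta^`()%classic : R -> R).
Proof.
have [_ _ h] := rw_eta regular.
exact: (holder_cont alpha0 (@cont_id R) (fun=> I) h).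
Qed.

Let ceta : continuous eta. Proof. exact: der_cont etaE. Qed.
Let oD : open D. Proof. exact: fluid_open. Qed.
Let ccl : continuous cl. Proof. exact: clamp_cont. Qed.
Let closed_cl p : closure D (cl p).
Proof. by apply/closure_fluidP => //; exact: clamp_bnd. Qed.

Let clE x y : - d <= y <= eta x -> cl (x, y) = (x, y).
Proof. by move=> h; apply: clamp_id. Qed.

Let cl_in p : D p -> cl p = p.
Proof. by move=> /andP[h1 h2]; apply: clamp_id; rewrite !ltW. Qed.

Let cue : continuous ue. Proof. by have [_ h] := rw_u regular; exact: Ca_loc_cont h. Qed.
Let cve : continuous ve. Proof. by have [_ h] := rw_v regular; exact: Ca_loc_cont h. Qed.
Let cPe : continuous Pe. Proof. by have [_ h] := rw_P regular; exact: Ca_loc_cont h. Qed.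

Let cUe : continuous Ue.
Proof.
have [_ h] := rw_U regular.
have c1 : continuous (fun y : R => Num.max (- d) (Num.min y 0)) by cont.
have m1 (y : R) : `[- d, 0]%classic (Num.max (- d) (Num.min y 0)).
  rewrite /= in_itv/= le_max lexx/= ge_max ge_min lexx orbT andbT.
  by move: d0; lra.
exact: (holder_cont alpha0 c1 m1 h).
Qed.

(** On [D] the extended functions coincide with [u], [v] and [P]. *)
Lemma wave_laws : [/\ conserved D a (fun p => - ve p),
  conserved D (fun p => a p * ve p) (fun p => - (ve p * ve p + Q p)) &
  conserved D (fun p => a p * (Q p + 2^-1 * (a p * a p + ve p * ve p)))
    (fun p => - (ve p * (Q p + 2^-1 * (a p * a p + ve p * ve p))))].
Proof.
have [ux [uy [vx [vy [Px [Py [[ux1 uy1 ux2 uy2] [vx1 vy1 vx2 vy2] [Px1 Py1 Px2 Py2] ae]]]]]]] := sw_euler wave.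
have S b (f F : R * R -> R) : continuous (fun p => f (cl p)) -> Lr_loc r D F ->
    weak_deriv2 D (dir b) f F -> sobolev D b (fun p => f (cl p)) F.
  move=> cf LF wf; split => //; first exact: Lr_loc_L1loc LF.
  by apply: (weak_deriv_wder wf) => p /cl_in ->.
apply: (@euler_laws _ D oD g c ue ve Pe ux uy vx vy Px Py); try exact: S.
by apply: ae_mono ae _ => p H Dp; rewrite /ue /ve (cl_in Dp); exact: H.
Qed.

Lemma eta_asym e : 0 < e -> exists M, forall x, M <= x -> `|eta x| <= e.
Proof.
move=> e0; have /cvgrPdist_le/(_ _ e0)[M [_ HM]] := sw_eta_pinfty wave.
exists (M + 1) => x Mx; have := HM x (ltac:(lra) : M < x).
by rewrite /= sub0r normrN.
Qed.

Lemma v_asym e : 0 < e -> exists M, forall x, M <= `|x| ->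
  forall y, - d <= y <= eta x -> `|ve (x, y)| <= e.
Proof.
move=> e0.
have [M1 [_ H1]] := sw_v_pinfty wave e0.
have [M2 [_ H2]] := sw_v_ninfty wave e0.
exists (`|M1| + `|M2| + 1) => x xM y yx; rewrite /ve (clE yx).
have cD : closure D (x, y) by apply/closure_fluidP.
have [x0|x0] := leP 0 x.
  have M1x : M1 < x.
    by move: xM (ler_norm M1) (normr_ge0 M2); rewrite (ger0_norm x0); lra.
  by have := H1 x M1x y cD; rewrite subr0 => /ltW.
have M2x : x < M2.
  by move: xM (ler_norm (- M2)) (normr_ge0 M1); rewrite normrN (ltr0_norm x0); lra.
by have := H2 x M2x y cD; rewrite subr0 => /ltW.
Qed.

Lemma a_asym e : 0 < e -> exists M, forall x, M <= x ->
  forall y, - d <= y <= eta x -> `|a (x, y) - (c - Ue y)| <= e.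
Proof.
move=> e0; have [M [_ HM]] := sw_u_pinfty wave e0.
exists (M + 1) => x Mx y yx.
have cD : closure D (x, y) by apply/closure_fluidP.
have := HM x (ltac:(lra) : M < x) y cD.
rewrite /a /ue (clE yx) /Ue.
have -> : Num.max (- d) (Num.min y 0) = Num.min y 0.
  apply/max_idPr; rewrite le_min; case/andP: yx => -> _ /=; move: d0; lra.
by move=> /ltW; rewrite distrC; congr (`|_| <= _); ring.
Qed.

Lemma a_lower b : (forall p, D p -> u p <= b) -> forall p, c - b <= a p.
Proof.
move=> ub.
have cF : closed [set p | ue p <= b].
  have -> : [set p | ue p <= b] = ue @^-1` `]-oo, b] by apply/seteqP; split=> p; rewrite /= in_itv.
  by apply: preimage_closed => //; exact: interval_closed.
have sub : D `<=` [set p | ue p <= b] by move=> p Dp; rewrite /= /ue (cl_in Dp); exact: ub.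
move=> p; have := closure_subset sub (@closed_cl p).
move/closure_id : cF => <- /=; rewrite /ue (_ : cl (cl p) = cl p); last first.
  by apply: clamp_id; exact: clamp_bnd.
rewrite /a /ue; lra.
Qed.

(** The far relative speed is a limit of values of [a]. A height [y] may lie above
    the surface, which is possible only near [y = 0]; it is then replaced by the
    height of the surface. *)
Lemma Ue_upper delta : (forall p, delta <= a p) -> forall y, delta <= c - Ue y.
Proof.
move=> ad.
have cf : continuous (fun y => c - Ue y) by cont.
have low y : - d <= y <= 0 -> delta <= c - Ue y.
  move=> yd; apply/ler_addgt0Pr => e e0.
  have e2 : 0 < e / 2 by lra.
  have /cvgrPdist_le/(_ _ e2)/nbhs_ballP[s /= s0 Hs] := cf y.
  have s2 : 0 < s / 2 by lra.
  have [M1 H1] := a_asym e2; have [M2 H2] := eta_asym s2.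
  pose x := Num.max M1 M2.
  have x1 := H1 x (ltac:(by rewrite le_max lexx)).
  have x2 := H2 x (ltac:(by rewrite le_max lexx orbT)).
  pose z := Num.min y (eta x).
  have zd : - d <= z <= eta x.
    by rewrite /z ge_min lexx orbT andbT le_min; case/andP: yd => -> _ /=; exact: ltW.
  have zy : `|y - z| < s.
    rewrite /z; have [h|h] := leP y (eta x); first by rewrite subrr normr0.
    by move: x2 yd; rewrite !ler_norml ltr_norml => /andP[? ?] /andP[? ?]; apply/andP; split; lra.
  have k1 := x1 z zd; have k2 := Hs z zy; have k3 := ad (x, z).
  by move: k1 k2 => /=; rewrite !ler_norml => /andP[? ?] /andP[? ?]; lra.
move=> y; have := low (Num.max (- d) (Num.min y 0)).
have dn : - d <= 0 by move: d0; lra.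
have yd : - d <= Num.max (- d) (Num.min y 0) <= 0.
  by rewrite le_max lexx/= ge_max ge_min lexx orbT andbT.
move=> /(_ yd); rewrite /Ue; congr (_ <= c - U _).
by case/andP: yd => h1 h2; rewrite (min_idPl h2); exact/max_idPr.
Qed.

Lemma wave_dichotomy b : b < c -> (forall p, D p -> u p <= b) ->
  trivial_wave d eta u v U \/
  exists M, 0 < M /\ 0 < (1 - g * oint (fun y => ((c - Ue y) ^+ 2)^-1) (- d) 0) * oint eta (- M) M.
Proof.
move=> bc ub.
have delta0 : 0 < c - b by rewrite subr_gt0.
have a_ge := a_lower ub; have U_ge := Ue_upper a_ge.
have ca : continuous a by rewrite /a; cont.
have cQ : continuous Q by rewrite /Q; cont.
have cUc : continuous (fun y => c - Ue y) by cont.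
have [L1 L2 L3] := wave_laws.
have bedE x : ve (x, - d) = 0.
  by rewrite /ve clE ?lexx ?ltW//; exact: sw_bed wave x.
have kinE x : ve (x, eta x) + a (x, eta x) * eta^`()%classic x = 0.
  have E := sw_kinematic wave x; rewrite /a /ue /ve clE ?lexx ?ltW// E; ring.
have dynE x : Q (x, eta x) = g * eta x.
  by rewrite /Q /Pe clE ?lexx ?ltW// (sw_dynamic wave x) add0r.
have [[q [qD vq]]|nv] := pselect (exists q : R * R, - d <= q.2 <= eta q.1 /\ ve q != 0).
  right.
  exact: (@wave_gap _ g d (c - b) eta (eta^`()%classic) (fun y => c - Ue y) a ve Q g0 d0 delta0 etad
    etaE cdeta ca cve cQ cUc a_ge U_ge bedE kinE dynE L1 L2 L3 a_asym v_asym eta_asym q qD vq).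
left; have v0 q : - d <= q.2 <= eta q.1 -> ve q = 0.
  by move=> qD; apply: contrapT => /eqP vq; apply: nv; exists q.
have [eta0 aU] := @still_wave _ d (c - b) eta (eta^`()%classic) (fun y => c - Ue y) a ve d0 delta0
  etad etaE ca cve a_ge bedE kinE L1 a_asym eta_asym v0.
split => // -[x y] /(closure_fluidP ceta etad) /= yx.
  by have := v0 (x, y) yx; rewrite /ve clE.
have yd : - d <= y <= 0 by rewrite -(eta0 x).
have := aU x y yd; rewrite /a /ue clE// /Ue.
case/andP: yd => h1 h2; rewrite (min_idPl h2) (max_idPr h1); lra.
Qed.

Lemma froude_oint (b : R) : b < c -> (forall p, D p -> u p <= b) ->
  \int[lebesgue_measure]_(y in `[- d, 0]) (1 / (c - U y) ^+ 2) =
  oint (fun y => ((c - Ue y) ^+ 2)^-1) (- d) 0.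
Proof.
move=> bc ub; have U_ge := Ue_upper (a_lower ub).
have cUc : continuous (fun y => c - Ue y) by cont.
have ci : continuous (fun y => ((c - Ue y) ^+ 2)^-1).
  apply: contV => [y|]; last by cont.
  by rewrite expf_neq0// gt_eqF// (lt_le_trans _ (U_ge y))// subr_gt0.
rewrite -oint_Rintegral//; last by move: d0; lra.
apply: eq_Rintegral => y; rewrite inE/= in_itv/= => /andP[h1 h2].
by rewrite div1r /Ue (min_idPl h2) (max_idPr h1).
Qed.

End Wave.

Unset Implicit Arguments.

Theorem theorem1p1 (R : realType) (g d c : R)
    (g_gt0 : 0 < g) (d_gt0 : 0 < d) (c_gt0 : 0 < c)
    (alpha r : R) (alpha_gt0 : 0 < alpha) (alpha_lt1 : alpha < 1)
    (rE : r = 2 / (1 - alpha))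
    (eta : R -> R) (u v P : R * R -> R) (U : R -> R)
    (wave : solitary_wave g d c r eta u v P U)
    (sup_u : (ereal_sup [set (u p)%:E | p in fluid d eta] < c%:E)%E)
    (regular : regular_wave d alpha r eta u v P U)
    (nontrivial : ~ trivial_wave d eta u v U)
    (F : R) (froude : is_froude_number g d c U F) :
  [/\ F <> 1,
      wave_of_elevation eta -> 1 < F &
      wave_of_depression eta -> F < 1].
Proof.
have r1 : 1 <= r by rewrite rE ler_pdivlMr; lra.
have [b bc ub] := unif_bound sup_u.
have [//|[M [M0 gap]]] := wave_dichotomy g_gt0 d_gt0 alpha_gt0 r1 wave regular bc ub.
have [F0] := froude; rewrite (froude_oint d_gt0 alpha_gt0 wave regular bc ub) => FE.
have ceta : continuous eta.
  have [h _ _] := rw_eta regular.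
  by apply: der_cont => x; exact: derivableP.
move: gap; rewrite -FE; set N := oint eta (- M) M => gap.
have E : 1 - 1 / F ^+ 2 = (F - 1) * (F + 1) / F ^+ 2 by field; rewrite gt_eqF.
have F1 : 0 < (F + 1) / F ^+ 2 by rewrite divr_gt0 ?exprn_gt0//; lra.
have gap' : 0 < (F - 1) * N.
  by move: gap; rewrite E -mulrA mulrAC mulrC pmulr_rgt0.
have MM : - M <= M by lra.
split.
- by move=> F1'; move: gap'; rewrite F1' subrr mul0r ltxx.
- move=> [pos _]; have N0 : 0 <= N by apply: oint_ge0.
  by rewrite ltNge; apply/negP => F1'; move: gap'; nra.
- move=> [neg _]; have N0 : N <= 0.
    have := oint_cst (0 : R) (- M) M; rewrite mul0r => <-.
    by apply: le_oint => //; exact: cont_cst.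
  by rewrite ltNge; apply/negP => F1'; move: gap'; nra.
Qed.
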